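(* Let $n<\omega$. For a class $\mathcal{C}$ of measurable subsets of $2^\omega$ write $\mathcal{C}\cap\mathbf{K}$ for the set of compact sets in $\mathcal{C}$, viewed as a subset of $\mathbf{K}$. (a) The following sets $\mathcal{C}\cap\mathbf{K}$ are $\boldsymbol{\Pi}^1_1$-complete subsets of $\mathbf{K}$: for $\mathcal{C}$ one of $\mathrm{Shrp}_n$, $\mathrm{Shrp}_{\le n}$, $\mathrm{Shrp}_{<\omega}$, $\mathrm{Shrp}_{\le\omega}$, $\mathrm{Shrp}_\omega$; $\mathrm{Blr}_n$, $\mathrm{Blr}_{\le n}$, $\mathrm{Blr}_{<\omega}$, $\mathrm{Blr}_{\le\omega}$, $\mathrm{Blr}_\omega$; $\mathrm{Rng}_{\le n}$, $\mathrm{Rng}_{<\omega}$, $\mathrm{Rng}_{\le\omega}$, $\mathrm{Rng}_{\mathrm{inj}}$, $\mathrm{Rng}_{\mathrm{MGR}}$, $\mathrm{Rng}_{\lambda\le a}$ for $a\in[0;1)$, $\mathrm{Rng}_{\lambda<a}$ for $a\in(0;1]$; $\mathrm{Sld}$, $\mathrm{qDl}$, $\mathrm{Dl}$. (b) The following sets $\mathcal{C}\cap\mathbf{K}$ are $2$-$\boldsymbol{\Sigma}^1_1$-complete: $\mathcal{C}$ one of $\mathrm{Rng}_{n+1}$, $\mathrm{Rng}_\omega$, $\mathrm{Rng}_{\lambda=a}$ with $a\in(0;1)$, and $\mathrm{Rng}(S)$ with $\emptyset\ne S\subseteq(0;1)$ countable. (c) $\mathrm{Spng}\cap\mathbf{K}$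 is in $2$-$\boldsymbol{\Sigma}^1_1$ and is both $\boldsymbol{\Sigma}^1_1$-hard and $\boldsymbol{\Pi}^1_1$-hard.
   Context: $2^{\omega}$ is the Cantor space; $N_s=\{x\in2^\omega:s\subset x\}$; $\mu$ is the coin-tossing measure, $\mu(N_s)=2^{-\mathrm{lh}(s)}$. For measurable $A$ and $z\in2^\omega$, $\mathcal{D}_A(z)=\lim_n\mu(A\cap N_{z\restriction n})/\mu(N_{z\restriction n})$ when the limit exists; $\operatorname{ran}\mathcal{D}_A$ is the set of values attained where defined. $z$ is blurry for $A$ if $\mathcal{D}_A(z)$ does not exist, sharp if it exists and is in $(0;1)$; $\mathrm{Blur}(A)$, $\mathrm{Sharp}(A)$ are the sets of such points. $A$ is solid if $\mathrm{Blur}(A)=\emptyset$, quasi-dualistic if $\mathrm{Sharp}(A)=\emptyset$, dualistic if both, spongy if quasi-dualistic but not solid; $\mathrm{Sld},\mathrm{qDl},\mathrm{Dl},\mathrm{Spng}$ denote these classes. For $\kappa\le\omega$ and $\bowtie$ one of $=,\le,<$: $\mathrm{Shrp}_{\bowtie\kappa}=\{A:|\mathrm{Sharp}(A)|\bowtie\kappa\}$, $\mathrm{Blr}_{\bowtie\kappa}=\{A:|\mathrm{Blur}(A)|\bowtie\kappa\}$, $\mathrm{Rng}_{\bowtie\kappa}=\{A:|\operatorname{ran}\mathcal{D}_A\cap(0;1)|\bowtie\kappa\}$; a subscript $\kappa$ alone means $=\kappa$. $\mathrm{Rng}_{\mathrm{inj}}=\{A:\forall z_1,z_2(\mathcal{D}_A(z_1)=\mathcal{D}_A(z_2)\in(0;1)\Rightarrow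 z_1=z_2)\}$; $\mathrm{Rng}_{\mathrm{MGR}}=\{A:\operatorname{ran}\mathcal{D}_A \text{ is meager}\}$; $\mathrm{Rng}_{\lambda\bowtie a}=\{A:\lambda(\operatorname{ran}\mathcal{D}_A)\bowtie a\}$ with $\lambda$ Lebesgue measure; $\mathrm{Rng}(S)=\{A:\operatorname{ran}\mathcal{D}_A=S\cup\{0,1\}\}$. $\mathbf{K}$ is the Polish space of compact subsets of $2^\omega$ with the Vietoris topology. $2$-$\boldsymbol{\Sigma}^1_1$ consists of the sets $A\cap B$ with $A$ analytic and $B$ coanalytic. A set $A\subseteq X$ is $\boldsymbol{\Gamma}$-hard if for every zero-dimensional Polish $Z$ and $B\in\boldsymbol{\Gamma}(Z)$ there is a continuous $f:Z\to X$ with $B=f^{-1}(A)$, and $\boldsymbol{\Gamma}$-complete if moreover $A\in\boldsymbol{\Gamma}(X)$. *)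

(* Defs.v *)
From HB Require Import structures.
From mathcomp Require Import all_boot all_order all_algebra.
From mathcomp Require Import all_classical all_reals all_analysis.
From mathcomp Require Import Rstruct Rstruct_topology.
Set Implicit Arguments.
Unset Strict Implicit.
Unset Printing Implicit Defensive.
Import Order.TTheory GRing.Theory Num.Theory.
Import numFieldTopology.Exports.
Local Open Scope classical_set_scope.
Local Open Scope ring_scope.
Local Open Scope card_scope.

Notation R := Rdefinitions.R.

Notation baire := (prod_topology (fun _ : nat => nat)).

Definition cyl (s : seq bool) : set cantor_space :=
  [set x | forall i, (i < size s)%N -> x i = nth false s i].

(** Coin-tossing measure (as the Caratheodory outer measure generated by
    mu(N_s) = 2^-lh(s); on measurable sets this is the coin-tossing measure). *)
Definition mu (A : set cantor_space) : \bar R :=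
  ereal_inf [set (\sum_(0 <= i <oo) ((2%:R ^- size (c i) : R)%:E))%E
            | c in [set c : nat -> seq bool | A `<=` \bigcup_i cyl (c i)]].

Definition density_to (A : set cantor_space) (z : cantor_space) (r : R) : Prop :=
  (fun n : nat => fine (mu (A `&` cyl (mkseq z n))) / fine (mu (cyl (mkseq z n))))
    @ \oo --> r.

Definition ranD (A : set cantor_space) : set R := [set r | exists z, density_to A z r].
Definition unit_open : set R := [set r | 0 < r < 1].

Definition Blur (A : set cantor_space) : set cantor_space :=
  [set z | ~ exists r, density_to A z r].
Definition Sharp (A : set cantor_space) : set cantor_space :=
  [set z | exists r, density_to A z r /\ unit_open r].

Definition Sld (A : set cantor_space) := Blur A = set0.
Definition qDl (A : set cantor_space) := Sharp A = set0.
Definition Dl (A : set cantor_space) := Sld A /\ qDl A.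
Definition Spng (A : set cantor_space) := qDl A /\ ~ Sld A.

Definition Shrp_eq (n : nat) (A : set cantor_space) := Sharp A #= `I_n.
Definition Shrp_le (n : nat) (A : set cantor_space) := Sharp A #<= `I_n.
Definition Shrp_fin (A : set cantor_space) := finite_set (Sharp A).
Definition Shrp_ctbl (A : set cantor_space) := countable (Sharp A).
Definition Shrp_omega (A : set cantor_space) := Sharp A #= @setT nat.

Definition Blr_eq (n : nat) (A : set cantor_space) := Blur A #= `I_n.
Definition Blr_le (n : nat) (A : set cantor_space) := Blur A #<= `I_n.
Definition Blr_fin (A : set cantor_space) := finite_set (Blur A).
Definition Blr_ctbl (A : set cantor_space) := countable (Blur A).
Definition Blr_omega (A : set cantor_space) := Blur A #= @setT nat.

Definition Rng_eq (n : nat) (A : set cantor_space) := (ranD A `&` unit_open) #= `I_n.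
Definition Rng_le (n : nat) (A : set cantor_space) := (ranD A `&` unit_open) #<= `I_n.
Definition Rng_fin (A : set cantor_space) := finite_set (ranD A `&` unit_open).
Definition Rng_ctbl (A : set cantor_space) := countable (ranD A `&` unit_open).
Definition Rng_omega (A : set cantor_space) := (ranD A `&` unit_open) #= @setT nat.

Definition Rng_inj (A : set cantor_space) :=
  forall z1 z2 r, density_to A z1 r -> density_to A z2 r -> unit_open r -> z1 = z2.

Definition nowhere_dense_R (S : set R) := interior (closure S) = set0.
Definition meager_R (S : set R) :=
  exists F : nat -> set R, (forall k, nowhere_dense_R (F k)) /\ S `<=` \bigcup_k F k.
Definition Rng_MGR (A : set cantor_space) := meager_R (ranD A).

Definition lamD (A : set cantor_space) : \bar R := (@lebesgue_measure R) (ranD A).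
Definition Rng_lam_le (a : R) (A : set cantor_space) := (lamD A <= a%:E)%E.
Definition Rng_lam_lt (a : R) (A : set cantor_space) := (lamD A < a%:E)%E.
Definition Rng_lam_eq (a : R) (A : set cantor_space) := lamD A = a%:E.

Definition Rng_S (S : set R) (A : set cantor_space) := ranD A = S `|` [set 0; 1].

(** The hyperspace K of compact subsets of 2^omega, with the Vietoris topology,
    given through its subbase {K | K ⊆ U}, {K | K ∩ U ≠ ∅} (U open). *)
Definition Kspace := {A : set cantor_space | compact A}.

Definition vcont {X : topologicalType} (f : X -> Kspace) : Prop :=
  forall U : set cantor_space, open U ->
    open [set x | proj1_sig (f x) `<=` U] /\
    open [set x | proj1_sig (f x) `&` U !=set0].

Definition KC (C : set cantor_space -> Prop) : set Kspace :=
  [set K | C (proj1_sig K)].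

Definition Sigma11 {X : Type} (cont : (baire -> X) -> Prop) (A : set X) : Prop :=
  A = set0 \/ exists g : baire -> X, cont g /\ A = range g.
Definition Pi11 {X : Type} (cont : (baire -> X) -> Prop) (A : set X) : Prop :=
  Sigma11 cont (~` A).
Definition D2Sigma11 {X : Type} (cont : (baire -> X) -> Prop) (A : set X) : Prop :=
  exists B C, Sigma11 cont B /\ Pi11 cont C /\ A = B `&` C.

Definition SigmaZ (Z : topologicalType) (B : set Z) := Sigma11 (fun g : baire -> Z => continuous g) B.
Definition PiZ (Z : topologicalType) (B : set Z) := Pi11 (fun g : baire -> Z => continuous g) B.
Definition D2SigmaZ (Z : topologicalType) (B : set Z) := D2Sigma11 (fun g : baire -> Z => continuous g) B.

Definition SigmaK (A : set Kspace) := Sigma11 (fun g : baire -> Kspace => vcont g) A.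
Definition PiK (A : set Kspace) := Pi11 (fun g : baire -> Kspace => vcont g) A.
Definition D2SigmaK (A : set Kspace) := D2Sigma11 (fun g : baire -> Kspace => vcont g) A.

Definition polish (T : topologicalType) : Prop :=
  exists d : T -> T -> R,
    [/\ (forall x y, d x y = 0 <-> x = y),
        (forall x y, d x y = d y x) /\ (forall x y z, d x z <= d x y + d y z),
        (forall U : set T, open U <->
          (forall x, U x -> exists e : R, 0 < e /\ [set y | d x y < e] `<=` U)),
        (forall u : nat -> T,
          (forall e : R, 0 < e -> exists N, forall m k, (N <= m)%N -> (N <= k)%N -> d (u m) (u k) < e) ->
          exists l : T, u @ \oo --> l)
      & (exists D : set T, countable D /\
          forall U : set T, open U -> U !=set0 -> D `&` U !=set0)].

Definition zero_dim (T : topologicalType) : Prop :=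
  forall (U : set T) (x : T), open U -> U x -> exists V : set T, [/\ clopen V, V x & V `<=` U].

Definition hardK (Gamma : forall Z : topologicalType, set Z -> Prop) (A : set Kspace) : Prop :=
  forall (Z : topologicalType), polish Z -> zero_dim Z ->
    forall B : set Z, Gamma Z B ->
      exists f : Z -> Kspace, vcont f /\ B = f @^-1` A.

Definition Pi11_completeK (A : set Kspace) := PiK A /\ hardK PiZ A.
Definition D2Sigma11_completeK (A : set Kspace) := D2SigmaK A /\ hardK D2SigmaZ A.

(* Main.v *)
Require Import Defs.
From HB Require Import structures.
From mathcomp Require Import all_boot all_order all_algebra.
From mathcomp Require Import all_classical all_reals all_analysis.
From mathcomp Require Import Rstruct Rstruct_topology.
From mathcomp Require Import ring lra zify.
From Stdlib Require Cantor.

(** Upper bounds. For closed [A] the relation "[z] has density [r]" is arithmetical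
    in (A, z, r), so each class reduces to a quantifier over the sections of a
    Borel set. Analytic predicates are presented as projections of closed
    relations, i.e. through trees of finite sequences. "There is exactly one
    branch" is coanalytic because, off the branch, the well-founded subtrees can
    be compared by simulations; cardinalities up to [omega] follow from tuples
    and isolated points. "Uncountably many values", "measure greater than [a]"
    and "nonmeager" are analytic via, respectively, a dense-in-itself set of
    branches with distinct values, a compact set of branches whose values no small
    finite union of rational intervals covers, and a scheme of rational intervals
    carrying an analytic set large in all of them.

    Hardness. Given [w : seq bool -> R] with values in [0, 1] there is a closed
    set [oscset w] such that along a spine, homeomorphic to Cantor space, its
    density oscillates like [w (x | k)], and which has density 0 or 1 off the
    spine. Reading [x] as a sequence of block lengths, [w] can be chosen so that
    the sharp points (or the blurry points) are exactly the branches of a tree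
    [T], with a prescribed continuous function of the branch as density; the map
    from trees to compact sets is continuous. Every analytic subset of a
    zero-dimensional Polish space is the set of [z] at which a clopen family
    of trees [T z] has a branch. Combining such trees gives all reductions. *)

Set Implicit Arguments.
Unset Strict Implicit.
Unset Printing Implicit Defensive.
Import Order.TTheory GRing.Theory Num.Theory.
Import numFieldTopology.Exports numFieldNormedType.Exports.
Local Open Scope classical_set_scope.
Local Open Scope ring_scope.

(** Classes such as [Shrp_eq n] assert the existence of points and are coanalytic all the same. The
    reason is that sharpness and blurriness of a point are Borel, hence expressible with unique
    witnesses ([U11]): counting points becomes counting branches, and a countable nonempty set of
    branches has an isolated one, that is, a node with exactly one branch through it. Membership of
    a real in [ranD A] has many witnesses, one for each point with that density; the isolated-branch
    argument is lost, and exact conditions on the range remain an analytic lower bound joined to a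
    coanalytic upper bound. In the reductions the obstacle is the countably many spine points whose
    letters end with zeros: they belong to no branch. With [sharp_weight] they become blurry or get
    density 0 or 1, which neither [Sharp] nor the range in the open interval can see. With
    [blur_weight] they get density 0 and no sharp point exists; [Sld], [Dl] and the [Blr] classes
    use this second kind. [Spng] uses both: the first, where a blurry point is always present, for
    coanalytic hardness, the second for analytic hardness. *)

Local Notation N := (nat -> nat).

(** * Analytic predicates on ultrametric-like spaces *)

(* [eqn n] is the equivalence "equal up to precision 2^-n". *)
Class ctx (X : Type) := Ctx {
  eqn : nat -> X -> X -> Prop;
  eqn_refl : forall n x, eqn n x x;
  eqn_sym : forall n x y, eqn n x y -> eqn n y x;
  eqn_trans : forall n x y z, eqn n x y -> eqn n y z -> eqn n x z;
  eqn_le : forall m n x y, (m <= n)%N -> eqn n x y -> eqn m x y }.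

Definition nat_eqn (n : nat) (x y : N) := forall i, (i < n)%N -> x i = y i.

#[global] Program Instance ctxN : ctx N := @Ctx _ nat_eqn _ _ _ _.
Next Obligation. by []. Qed.
Next Obligation. by move=> n x y h i /h. Qed.
Next Obligation. by move=> n x y z h k i l; rewrite h// k. Qed.
Next Obligation. by move=> m n x y mn h i im; apply: h; apply: leq_trans mn. Qed.

#[global] Program Instance ctx_prod (X Y : Type) (cX : ctx X) (cY : ctx Y) :
  ctx (X * Y) := @Ctx _ (fun n p q => eqn n p.1 q.1 /\ eqn n p.2 q.2) _ _ _ _.
Next Obligation. by move=> *; split; exact: eqn_refl. Qed.
Next Obligation. by move=> X Y ? ? n x y [h1 h2]; split; exact: eqn_sym. Qed.
Next Obligation.
move=> X Y ? ? n x y z [h1 h2] [k1 k2]; split.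
  exact: eqn_trans h1 k1.
exact: eqn_trans h2 k2.
Qed.
Next Obligation.
by move=> X Y ? ? m n x y mn [h1 h2]; split; [exact: eqn_le h1|exact: eqn_le h2].
Qed.

Section Continuity.
Context {X : Type} {cX : ctx X}.

(** Three notions for the topology whose basic open sets are the [eqn]-classes: clopen predicates
    here, then continuous maps ([cfun]) and locally constant maps into a discrete type ([nfun]). *)
Definition cpred (P : X -> Prop) :=
  forall x, exists n, forall x', eqn n x x' -> (P x' <-> P x).

Definition cfun {Y : Type} {cY : ctx Y} (f : X -> Y) :=
  forall x n, exists m, forall x', eqn m x x' -> eqn n (f x) (f x').

Definition nfun {V : Type} (f : X -> V) :=
  forall x, exists n, forall x', eqn n x x' -> f x' = f x.

Lemma cpred_cst (P : Prop) : cpred (fun _ => P).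
Proof. by move=> x; exists 0%N. Qed.

Lemma cpredN (P : X -> Prop) : cpred P -> cpred (fun x => ~ P x).
Proof. by move=> cP x; have [n hn] := cP x; exists n => x' /hn ->. Qed.

Lemma cpred2 (F : Prop -> Prop -> Prop) (P Q : X -> Prop) :
  cpred P -> cpred Q -> cpred (fun x => F (P x) (Q x)).
Proof.
move=> cP cQ x; have [n hn] := cP x; have [m hm] := cQ x.
exists (maxn n m) => x' h.
have /propext -> : P x' <-> P x by apply: hn; apply: eqn_le h; rewrite leq_maxl.
by have /propext -> : Q x' <-> Q x by apply: hm; apply: eqn_le h; rewrite leq_maxr.
Qed.

Lemma nfun_cpred {V : Type} (f : X -> V) (P : V -> Prop) :
  nfun f -> cpred (fun x => P (f x)).
Proof. by move=> cf x; have [n hn] := cf x; exists n => x' /hn ->. Qed.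

Lemma nfun_dep {V : Type} (f : X -> V) (P : V -> X -> Prop) :
  nfun f -> (forall v, cpred (P v)) -> cpred (fun x => P (f x) x).
Proof.
move=> cf cP x; have [n hn] := cf x; have [m hm] := cP (f x) x.
exists (maxn n m) => x' h; rewrite hn; last by apply: eqn_le h; rewrite leq_maxl.
by apply: hm; apply: eqn_le h; rewrite leq_maxr.
Qed.

Lemma nfun_cst {V : Type} (v : V) : nfun (fun _ => v).
Proof. by move=> x; exists 0%N. Qed.

Lemma nfun_comp {V W : Type} (f : X -> V) (g : V -> W) :
  nfun f -> nfun (fun x => g (f x)).
Proof. by move=> cf x; have [n hn] := cf x; exists n => x' /hn ->. Qed.

Lemma nfun_comp2 {U V W : Type} (e : X -> U) (f : X -> V) (g : U -> V -> W) :
  nfun e -> nfun f -> nfun (fun x => g (e x) (f x)).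
Proof.
move=> ce cf x; have [n hn] := ce x; have [m hm] := cf x.
exists (maxn n m) => x' h; rewrite hn ?hm//; apply: eqn_le h; rewrite ?leq_maxl ?leq_maxr//.
Qed.

Lemma cfun_pair {Y Z : Type} {cY : ctx Y} {cZ : ctx Z} (f : X -> Y) (g : X -> Z) :
  cfun f -> cfun g -> cfun (fun x => (f x, g x)).
Proof.
move=> cf cg x n; have [m hm] := cf x n; have [p hp] := cg x n.
exists (maxn m p) => x' h; split => /=; [apply: hm|apply: hp]; apply: eqn_le h.
  by rewrite leq_maxl.
by rewrite leq_maxr.
Qed.

End Continuity.

Lemma cpred_comp {X Y : Type} {cX : ctx X} {cY : ctx Y} (P : Y -> Prop) (f : X -> Y) :
  cpred P -> cfun f -> cpred (fun x => P (f x)).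
Proof.
move=> cP cf x; have [n hn] := cP (f x); have [m hm] := cf x n.
by exists m => x' /hm; exact: hn.
Qed.

Lemma nfun_cfun {V X Y : Type} {cX : ctx X} {cY : ctx Y} (g : Y -> V) (f : X -> Y) :
  nfun g -> cfun f -> nfun (fun x => g (f x)).
Proof.
move=> cP cf x; have [n hn] := cP (f x); have [m hm] := cf x n.
by exists m => x' /hm; exact: hn.
Qed.

Lemma cfun_comp {X Y Z : Type} {cX : ctx X} {cY : ctx Y} {cZ : ctx Z}
  (g : Y -> Z) (f : X -> Y) : cfun g -> cfun f -> cfun (fun x => g (f x)).
Proof.
move=> cg cf x n; have [m hm] := cg (f x) n; have [p hp] := cf x m.
by exists p => x' /hp; exact: hm.
Qed.

Lemma cfun_fst {X Y : Type} {cX : ctx X} {cY : ctx Y} : cfun (@fst X Y).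
Proof. by move=> x n; exists n => x' []. Qed.

Lemma cfun_snd {X Y : Type} {cX : ctx X} {cY : ctx Y} : cfun (@snd X Y).
Proof. by move=> x n; exists n => x' []. Qed.

Lemma nfun_coord (i : nat) : nfun (fun y : N => y i).
Proof. by move=> y; exists i.+1 => y' h; rewrite h. Qed.

Lemma cfun_reindex (r : nat -> nat) : cfun (fun (y : N) i => y (r i)).
Proof.
move=> y n; exists (\max_(i < n) (r i).+1)%N => y' h i ni; apply: h.
exact: (@leq_bigmax _ (fun i : 'I_n => (r i).+1) (Ordinal ni)).
Qed.

Lemma nfun_mkseq (k : nat) : nfun (fun y : N => mkseq y k).
Proof.
move=> y; exists k => y' h; apply/eq_in_map => i.
by rewrite mem_iota /= add0n => /h.
Qed.

Definition scons (k : nat) (y : N) : N := fun i => if i is j.+1 then y j else k.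
Definition stail (y : N) : N := fun i => y i.+1.

Lemma scons_stail y : scons (y 0%N) (stail y) = y.
Proof. by apply/funext => -[]. Qed.

Definition row (k : nat) (y : N) : N := fun i => y (Cantor.to_nat (k, i)).
Definition unrow (f : nat -> N) : N :=
  fun c => f (Cantor.of_nat c).1 (Cantor.of_nat c).2.

Lemma row_unrow k f : row k (unrow f) = f k.
Proof. by apply/funext => i; rewrite /row /unrow Cantor.cancel_of_to. Qed.

Lemma row_inj y y' : (forall k, row k y = row k y') -> y = y'.
Proof.
move=> h; apply/funext => c; rewrite -(Cantor.cancel_to_of c).
by case: (Cantor.of_nat c) => k i; have /(congr1 (fun f => f i)) := h k.
Qed.

Section Analytic.
Context {X : Type} {cX : ctx X}.

Definition witness (phi : nat -> X -> N -> Prop) (x : X) (y : N) :=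
  forall n, phi n x y.

(** A closed subset of [X * N], presented as a countable intersection of clopen ones. *)
Definition closed_rel (phi : nat -> X -> N -> Prop) :=
  forall n, cpred (fun p : X * N => phi n p.1 p.2).

Definition S11 (P : X -> Prop) := exists2 phi, closed_rel phi &
  forall x, P x <-> exists y, witness phi x y.

(** Injective projections of closed sets. Unlike arbitrary projections, they keep the points of a
    section in bijection with the branches of a tree. *)
Definition U11 (P : X -> Prop) := exists2 phi, closed_rel phi &
  (forall x, P x <-> exists y, witness phi x y) /\
  (forall x y y', witness phi x y -> witness phi x y' -> y = y').

(** Asking for unique witnesses on both sides makes complementation free; closure under countable
    operations then has a direct proof. *)
Definition Bor (P : X -> Prop) := U11 P /\ U11 (fun x => ~ P x).

Lemma U11_S11 P : U11 P -> S11 P.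
Proof. by move=> [phi cphi [h _]]; exists phi. Qed.

Lemma S11_ext (P Q : X -> Prop) : (forall x, P x <-> Q x) -> S11 P -> S11 Q.
Proof. by move=> PQ [phi cphi h]; exists phi => // x; rewrite -PQ. Qed.

Lemma U11_ext (P Q : X -> Prop) : (forall x, P x <-> Q x) -> U11 P -> U11 Q.
Proof. by move=> PQ [phi cphi [h u]]; exists phi => //; split => // x; rewrite -PQ. Qed.

Lemma Bor_ext (P Q : X -> Prop) : (forall x, P x <-> Q x) -> Bor P -> Bor Q.
Proof.
by move=> PQ [h1 h2]; split; [apply: U11_ext h1|apply: U11_ext h2 => x; rewrite PQ].
Qed.

Lemma closed_all (phi : nat -> nat -> X -> N -> Prop) :
  (forall k, closed_rel (phi k)) ->
  closed_rel (fun n x y => phi (Cantor.of_nat n).1 (Cantor.of_nat n).2 x (row (Cantor.of_nat n).1 y)).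
Proof.
move=> cphi n; case: (Cantor.of_nat n) => k i /=.
apply: (@cpred_comp _ _ _ _ (fun p : X * N => phi k i p.1 p.2)
  (fun p : X * N => (p.1, row k p.2)) (cphi k i)).
apply: cfun_pair; first exact: cfun_fst.
by exact: (cfun_comp (cfun_reindex _) cfun_snd).
Qed.

Lemma witness_all (phi : nat -> nat -> X -> N -> Prop) x y :
  witness (fun n x y => phi (Cantor.of_nat n).1 (Cantor.of_nat n).2 x (row (Cantor.of_nat n).1 y)) x y
  <-> forall k, witness (phi k) x (row k y).
Proof.
split=> [h k i|h n]; last exact: h.
by have := h (Cantor.to_nat (k, i)); rewrite Cantor.cancel_of_to.
Qed.

Lemma closed_ex (phi : nat -> nat -> X -> N -> Prop) :
  (forall k, closed_rel (phi k)) ->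
  closed_rel (fun n x y => phi (y 0%N) n x (stail y)).
Proof.
move=> cphi n /=.
apply: (@nfun_dep _ _ _ (fun p : X * N => p.2 0%N)
  (fun k (p : X * N) => phi k n p.1 (stail p.2))).
  by exact: (nfun_cfun (nfun_coord _) cfun_snd).
move=> k; apply: (@cpred_comp _ _ _ _ (fun p : X * N => phi k n p.1 p.2)
  (fun p : X * N => (p.1, stail p.2)) (cphi k n)).
apply: cfun_pair; first exact: cfun_fst.
by exact: (cfun_comp (cfun_reindex _) cfun_snd).
Qed.

Lemma S11_all (P : nat -> X -> Prop) :
  (forall k, S11 (P k)) -> S11 (fun x => forall k, P k x).
Proof.
move=> hk; have [phi cphi hP] := all_sig2 (fun k => cid2 (hk k)).
exists (fun n x y => phi (Cantor.of_nat n).1 (Cantor.of_nat n).2 x (row (Cantor.of_nat n).1 y)).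
  exact: closed_all.
move=> x; split=> [h|[y /witness_all hy] k]; last by apply/hP; exists (row k y).
have /choice[f hf] : forall k, exists y, witness (phi k) x y by move=> k; exact/hP.
by exists (unrow f); apply/witness_all => k; rewrite row_unrow.
Qed.

Lemma U11_all (P : nat -> X -> Prop) :
  (forall k, U11 (P k)) -> U11 (fun x => forall k, P k x).
Proof.
move=> hk; have [phi cphi hP] := all_sig2 (fun k => cid2 (hk k)).
exists (fun n x y => phi (Cantor.of_nat n).1 (Cantor.of_nat n).2 x (row (Cantor.of_nat n).1 y)).
  exact: closed_all.
split=> [x|x y y' /witness_all h /witness_all h'].
  split=> [h|[y /witness_all hy] k]; last by apply/(hP k).1; exists (row k y).
  have /choice[f hf] : forall k, exists y, witness (phi k) x y.
    by move=> k; exact/(hP k).1.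
  by exists (unrow f); apply/witness_all => k; rewrite row_unrow.
by apply: row_inj => k; exact: (hP k).2 (h k) (h' k).
Qed.

Lemma S11_exn (P : nat -> X -> Prop) :
  (forall k, S11 (P k)) -> S11 (fun x => exists k, P k x).
Proof.
move=> hk; have [phi cphi hP] := all_sig2 (fun k => cid2 (hk k)).
exists (fun n x y => phi (y 0%N) n x (stail y)); first exact: closed_ex.
move=> x; split=> [[k /hP[y hy]]|[y hy]]; first by exists (scons k y).
by exists (y 0%N); apply/hP; exists (stail y).
Qed.

(** The index is stored as the first value of the witness, and disjointness makes it unique. *)
Lemma U11_exn (P : nat -> X -> Prop) :
  (forall k l x, P k x -> P l x -> k = l) ->
  (forall k, U11 (P k)) -> U11 (fun x => exists k, P k x).
Proof.
move=> disj hk; have [phi cphi hP] := all_sig2 (fun k => cid2 (hk k)).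
exists (fun n x y => phi (y 0%N) n x (stail y)); first exact: closed_ex.
split=> [x|x y y' h h'].
  split=> [[k /(hP k).1[y hy]]|[y hy]]; first by exists (scons k y).
  by exists (y 0%N); apply/(hP _).1; exists (stail y).
have e : y 0%N = y' 0%N.
  by apply: (disj _ _ x); apply/(hP _).1; eexists; [exact: h|exact: h'].
rewrite -(scons_stail y) -(scons_stail y') e; congr (scons _ _).
by apply: (hP (y 0%N)).2 h _; rewrite e; exact: h'.
Qed.

Lemma cpred_U11 (P : X -> Prop) : cpred P -> U11 P.
Proof.
move=> cP; exists (fun n x y => P x /\ y n = 0%N).
  move=> n; apply: (@cpred2 _ _ and (fun p : X * N => P p.1) (fun p => p.2 n = 0%N)).
    by apply: (cpred_comp cP); exact: cfun_fst.
  apply: (@nfun_cpred _ _ _ (fun p : X * N => p.2 n) (fun v => v = 0%N)).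
  by exact: (nfun_cfun (nfun_coord _) cfun_snd).
split=> [x|x y y' h h']; last by apply/funext => i; rewrite (h i).2 (h' i).2.
by split=> [Px|[y /(_ 0%N)[]//]]; exists (fun _ => 0%N) => n.
Qed.

Lemma cpred_Bor (P : X -> Prop) : cpred P -> Bor P.
Proof. by move=> cP; split; apply: cpred_U11 => //; exact: cpredN. Qed.

Lemma BorN (P : X -> Prop) : Bor P -> Bor (fun x => ~ P x).
Proof.
by move=> [h1 h2]; split => //; apply: U11_ext h1 => x; split=> [? ?|/contrapT].
Qed.

Lemma U11_finite_all (P : nat -> X -> Prop) (k : nat) :
  (forall i, U11 (P i)) -> U11 (fun x => forall i, (i < k)%N -> P i x).
Proof.
move=> h; apply: U11_all => i.
case: (boolP (i < k)%N) => ik.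
  by apply: U11_ext (h i) => x; split=> // /(_ isT).
by apply: U11_ext (cpred_U11 (cpred_cst True)) => x.
Qed.

Lemma U11_and (P Q : X -> Prop) : U11 P -> U11 Q -> U11 (fun x => P x /\ Q x).
Proof.
move=> hP hQ.
have : forall k, U11 (fun x => if k is 0 then P x else Q x) by case.
move=> /U11_all; apply: U11_ext => x; split=> [h|[? ?] []//].
by split; [exact: (h 0%N)|exact: (h 1%N)].
Qed.

Lemma least_nat (P : nat -> Prop) : (exists k, P k) ->
  exists k, P k /\ forall i, (i < k)%N -> ~ P i.
Proof.
move=> [k0 Pk0]; have : exists k, `[<P k>] by exists k0; exact/asboolP.
move=> /ex_minnP[k /asboolP Pk kmin]; exists k; split=> // i ik Pi.
by have := kmin i (asboolT Pi); rewrite leqNgt ik.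
Qed.

Lemma Bor_all (P : nat -> X -> Prop) :
  (forall k, Bor (P k)) -> Bor (fun x => forall k, P k x).
Proof.
move=> h; split; first by apply: U11_all => k; exact: (h k).1.
(* Recording the least failing index makes the cases disjoint and so keeps the witness unique. *)
have : U11 (fun x => exists k, ~ P k x /\ forall i, (i < k)%N -> P i x).
  apply: U11_exn => [k l x [nk ak] [nl al]|k].
    by case: (ltngtP k l) => // kl; [have := al _ kl|have := ak _ kl].
  by apply: U11_and; [exact: (h k).2|apply: U11_finite_all => i; exact: (h i).1].
apply: U11_ext => x; split=> [[k [nk _]] /(_ k)//|/existsNP/least_nat[k [nk ik]]].
by exists k; split=> // i /ik/contrapT.
Qed.

Lemma Bor_exn (P : nat -> X -> Prop) :
  (forall k, Bor (P k)) -> Bor (fun x => exists k, P k x).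
Proof.
move=> h; have /BorN : Bor (fun x => forall k, ~ P k x).
  by apply: Bor_all => k; exact: BorN.
by apply: Bor_ext => x; split=> [/existsNP[k /contrapT]|[k ? /(_ k)]//]; exists k.
Qed.

Lemma Bor_and (P Q : X -> Prop) : Bor P -> Bor Q -> Bor (fun x => P x /\ Q x).
Proof.
move=> hP hQ.
have : forall k, Bor (fun x => if k is 0 then P x else Q x) by case.
move=> /Bor_all; apply: Bor_ext => x; split=> [h|[? ?] []//].
by split; [exact: (h 0%N)|exact: (h 1%N)].
Qed.

Lemma Bor_or (P Q : X -> Prop) : Bor P -> Bor Q -> Bor (fun x => P x \/ Q x).
Proof.
move=> hP hQ; have /BorN := Bor_and (BorN hP) (BorN hQ).
by apply: Bor_ext => x; split=> [/not_andP[]/contrapT|[? []|? []]//]; [left|right].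
Qed.

Lemma Bor_imp (P Q : X -> Prop) : Bor P -> Bor Q -> Bor (fun x => P x -> Q x).
Proof.
move=> hP hQ; apply: Bor_ext (Bor_or (BorN hP) hQ) => x; split; first by case.
by move=> h; case: (EM (P x)); [right; exact: h|left].
Qed.

Lemma Bor_S11 (P : X -> Prop) : Bor P -> S11 P.
Proof. by move=> [/U11_S11]. Qed.

Lemma cpred_S11 (P : X -> Prop) : cpred P -> S11 P.
Proof. by move=> /cpred_U11/U11_S11. Qed.

Lemma S11_and (P Q : X -> Prop) : S11 P -> S11 Q -> S11 (fun x => P x /\ Q x).
Proof.
move=> hP hQ.
have : forall k, S11 (fun x => if k is 0 then P x else Q x) by case.
move=> /S11_all; apply: S11_ext => x; split=> [h|[? ?] []//].
by split; [exact: (h 0%N)|exact: (h 1%N)].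
Qed.

Lemma S11_or (P Q : X -> Prop) : S11 P -> S11 Q -> S11 (fun x => P x \/ Q x).
Proof.
move=> hP hQ.
have : forall k, S11 (fun x => if k is 0 then P x else Q x) by case.
move=> /S11_exn; apply: S11_ext => x; split=> [[[|k] h]|[h|h]]; [by left|by right| |].
  by exists 0%N.
by exists 1%N.
Qed.

End Analytic.

Definition sjoin (u v : N) : N := fun i => if odd i then v i./2 else u i./2.
Definition sleft (y : N) : N := fun i => y i.*2.
Definition sright (y : N) : N := fun i => y i.*2.+1.

Lemma sleft_join u v : sleft (sjoin u v) = u.
Proof. by apply/funext => i; rewrite /sleft /sjoin odd_double doubleK. Qed.

Lemma sright_join u v : sright (sjoin u v) = v.
Proof. by apply/funext => i; rewrite /sright /sjoin /= odd_double uphalf_double. Qed.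

Lemma sjoinK y : sjoin (sleft y) (sright y) = y.
Proof.
apply/funext => i; rewrite /sjoin /sleft /sright.
by rewrite -[in RHS](odd_double_half i); case: (odd i).
Qed.

Section Substitution.
Context {X Y : Type} {cX : ctx X} {cY : ctx Y}.

Lemma closed_rel_comp (phi : nat -> Y -> N -> Prop) (f : X -> Y) :
  cfun f -> closed_rel phi -> closed_rel (fun n x => phi n (f x)).
Proof.
move=> cf cphi n.
apply: (@cpred_comp _ _ _ _ (fun p : Y * N => phi n p.1 p.2)
  (fun p : X * N => (f p.1, p.2)) (cphi n)).
by apply: cfun_pair; [exact: (cfun_comp cf cfun_fst)|exact: cfun_snd].
Qed.

Lemma S11_comp (P : Y -> Prop) (f : X -> Y) :
  cfun f -> S11 P -> S11 (fun x => P (f x)).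
Proof.
by move=> cf [phi cphi h]; eexists; [exact: closed_rel_comp cf cphi|move=> x; rewrite h].
Qed.

Lemma U11_comp (P : Y -> Prop) (f : X -> Y) :
  cfun f -> U11 P -> U11 (fun x => P (f x)).
Proof.
move=> cf [phi cphi [h u]]; eexists; first exact: closed_rel_comp cf cphi.
by split=> [x|x y y']; [rewrite h|exact: u].
Qed.

Lemma closed_rel_join (phi : nat -> X * N -> N -> Prop) : closed_rel phi ->
  closed_rel (fun n x y => phi n (x, sleft y) (sright y)).
Proof.
move=> cphi n.
apply: (@cpred_comp _ _ _ _ (fun p : X * N * N => phi n p.1 p.2)
  (fun p : X * N => ((p.1, sleft p.2), sright p.2)) (cphi n)).
apply: cfun_pair.
  apply: cfun_pair; first exact: cfun_fst.
  by exact: (cfun_comp (cfun_reindex _) cfun_snd).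
by exact: (cfun_comp (cfun_reindex _) cfun_snd).
Qed.

Lemma S11_exN (P : X * N -> Prop) : S11 P -> S11 (fun x => exists u, P (x, u)).
Proof.
move=> [phi cphi h]; eexists; first exact: closed_rel_join cphi.
move=> x; split=> [[u /h[y hy]]|[y hy]]; last by exists (sleft y); apply/h; exists (sright y).
by exists (sjoin u y) => n; rewrite sleft_join sright_join.
Qed.

End Substitution.

(** * Trees and the unicity theorem *)

Definition branch (T : seq nat -> Prop) (y : N) := forall n, T (mkseq y n).

Definition tree (T : seq nat -> Prop) := forall s k, T s -> T (take k s).

Inductive wft (T : seq nat -> Prop) (s : seq nat) : Prop :=
  Wft : (forall k, T (rcons s k) -> wft T (rcons s k)) -> wft T s.

Lemma take_mkseq {A : Type} (y : nat -> A) k n : take k (mkseq y n) = mkseq y (minn k n).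
Proof. by rewrite -map_take take_iota. Qed.

Lemma mkseqS_rcons (y : N) n : mkseq y n.+1 = rcons (mkseq y n) (y n).
Proof. exact: mkseqS. Qed.

Lemma not_wft_branch (T : seq nat -> Prop) :
  tree T -> ~ wft T [::] -> exists y, branch T y.
Proof.
move=> tT nw.
have step s : ~ wft T s -> exists k, T (rcons s k) /\ ~ wft T (rcons s k).
  apply: contra_notP => h; constructor => k Tk; apply: contrapT => nk.
  by apply: h; exists k.
have /choice[f hf] : forall s, exists k, ~ wft T s -> T (rcons s k) /\ ~ wft T (rcons s k).
  move=> s; case: (EM (wft T s)) => [ws|/step[k hk]]; last by exists k.
  by exists 0%N.
pose S n := iter n (fun s => rcons s (f s)) [::].
have sS n : size (S n) = n by elim: n => //= n; rewrite size_rcons => ->.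
have nS n : ~ wft T (S n) by elim: n => //= n /hf[].
have yS n : mkseq (fun i => f (S i)) n = S n.
  by elim: n => // n IH; rewrite mkseqS_rcons IH.
exists (fun i => f (S i)) => n; rewrite yS.
have -> : S n = take n (S n.+1) by rewrite /= -cats1 take_cat sS ltnn subnn cats0.
by apply: tT; exact: (hf _ (nS n)).1.
Qed.

Lemma branch_not_wft (T : seq nat -> Prop) y : branch T y -> ~ wft T [::].
Proof.
move=> Ty w; suff : forall s, wft T s -> forall n, s = mkseq y n -> False.
  by move/(_ _ w 0%N); exact.
move=> s; elim=> {}s _ IH n sn; apply: (IH (y n) _ n.+1).
  by rewrite sn -mkseqS_rcons.
by rewrite mkseqS_rcons sn.
Qed.

(* [sim T S s t] holds iff the rank of [s] in [T] is at most that of [t] in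
   [S], and [sim_lt] iff it is strictly smaller. *)
Definition simulation (T S : seq nat -> Prop) (r : seq nat -> seq nat -> Prop) :=
  forall s t, r s t -> forall k, T (rcons s k) ->
    exists m, S (rcons t m) /\ r (rcons s k) (rcons t m).

Definition sim T S s t := exists2 r, simulation T S r & r s t.

Definition sim_lt T S s t := exists k, S (rcons t k) /\ sim T S s (rcons t k).

Lemma simulation_sim T S : simulation T S (sim T S).
Proof.
move=> s t [r hr rst] k Tk; have [m [Sm rm]] := hr _ _ rst _ Tk.
by exists m; split=> //; exists r.
Qed.

(** Coinduction: [sim] is the largest simulation, and adding the single pair [(s, t)] to it gives a
    simulation again. *)
Lemma sim_intro T S s t :
  (forall k, T (rcons s k) -> exists m, S (rcons t m) /\ sim T S (rcons s k) (rcons t m)) ->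
  sim T S s t.
Proof.
move=> h; exists (fun s' t' => sim T S s' t' \/ s' = s /\ t' = t); last by right.
move=> s' t' [/simulation_sim hs|[-> ->]] k Tk.
  by have [m [Sm hm]] := hs _ Tk; exists m; split=> //; left.
by have [m [Sm hm]] := h _ Tk; exists m; split=> //; left.
Qed.

Lemma sim_trans T S U s t u : sim T S s t -> sim S U t u -> sim T U s u.
Proof.
move=> hst htu; exists (fun s' u' => exists t', sim T S s' t' /\ sim S U t' u'); last by exists t.
move=> s' u' [t' [h1 h2]] k Tk.
have [m [Sm hm]] := simulation_sim h1 Tk.
have [p [Up hp]] := simulation_sim h2 Sm.
by exists p; split=> //; exists (rcons t' m).
Qed.

Lemma sim_wft T S s t : wft S t -> sim T S s t -> wft T s.
Proof.
move=> wt; elim: wt s => {}t _ IH s /simulation_sim h; constructor => k Tk.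
by have [m [Sm hm]] := h _ Tk; exact: IH hm.
Qed.

(** Comparability of ranks without ordinals. If [s] is not below [t], some child of [s] is below no
    child of [t]; by induction every child of [t] is strictly below that child, so [t] is at most
    that child and strictly below [s]. *)
Lemma sim_total T S s t : wft T s -> sim T S s t \/ sim_lt S T t s.
Proof.
move=> ws; elim: ws S t => {}s _ IH S t.
case: (EM (sim T S s t)) => [|ns]; first by left.
right; have [k [Tk hk]] : exists k, T (rcons s k) /\
    forall m, S (rcons t m) -> ~ sim T S (rcons s k) (rcons t m).
  apply: contra_notP ns => h; apply: sim_intro => k Tk.
  apply: contrapT => h'; apply: h; exists k; split=> // m Sm hm.
  by apply: h'; exists m.
exists k; split=> //; apply: sim_intro => m Sm.
by have [/hk|[p [Tp hp]]] := IH k Tk S (rcons t m); [|exists p].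
Qed.

(** Descent inside one well-founded tree: a strictly smaller member of the family is simulated from
    a child of the current node. *)
Lemma sim_minimal (I : Type) (F : I -> seq nat -> Prop) i0 : wft (F i0) [::] ->
  exists i, wft (F i) [::] /\ forall j, ~ sim_lt (F j) (F i) [::] [::].
Proof.
move=> w0; suff : forall T s, wft T s -> forall i, sim (F i) T [::] s ->
    exists i, wft (F i) [::] /\ forall j, ~ sim_lt (F j) (F i) [::] [::].
  by move/(_ _ _ w0 i0); apply; exists eq => // s _ <- k Fk; exists k.
move=> T s ws; elim: (ws) => {ws}s hs IH i si.
have ws : wft T s by constructor.
case: (EM (exists j, sim_lt (F j) (F i) [::] [::])) => [[j [k [Fk sj]]]|/forallNP h].
  have [m [Tm hm]] := simulation_sim si Fk.
  by exact: (IH m Tm j (sim_trans sj hm)).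
by exists i; split; [exact: (sim_wft ws si)|exact: h].
Qed.

Section TreeFamily.
Context {X : Type} {cX : ctx X}.

Definition cpred_tree (T : X -> seq nat -> Prop) := forall s, cpred (fun x => T x s).

Lemma cpred_nodeN (T : X -> seq nat -> Prop) n : cpred_tree T ->
  cpred (fun p : X * N => T p.1 (mkseq p.2 n)).
Proof.
move=> cT; apply: (@nfun_dep _ _ _ (fun p : X * N => mkseq p.2 n)
  (fun s (p : X * N) => T p.1 s)).
  exact: (nfun_cfun (nfun_mkseq _) cfun_snd).
by move=> s; exact: (cpred_comp (cT s) cfun_fst).
Qed.

Lemma S11_branch (T : X -> seq nat -> Prop) : cpred_tree T ->
  S11 (fun x => exists y, branch (T x) y).
Proof.
move=> cT; apply: (@S11_exN _ _ (fun p => branch (T p.1) p.2)).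
by apply: S11_all => n; apply: cpred_S11; exact: cpred_nodeN.
Qed.

Lemma S11_not_wft (T : X -> seq nat -> Prop) : cpred_tree T ->
  (forall x, tree (T x)) -> S11 (fun x => ~ wft (T x) [::]).
Proof.
move=> cT tT; apply: S11_ext (S11_branch cT) => x.
by split=> [[y /branch_not_wft]|/not_wft_branch]; [|exact].
Qed.

(** A simulation is a relation on a countable set, so guessing it costs one quantifier over [N]; its
    defining property only quantifies over finite sequences. *)
Lemma S11_sim (T S : X -> seq nat -> Prop) s t :
  cpred_tree T -> cpred_tree S -> S11 (fun x => sim (T x) (S x) s t).
Proof.
move=> cT cS; pose rel (u : N) (s t : seq nat) := u (pickle (s, t)) <> 0%N.
have crel s' t' : cpred (fun p : X * N => rel p.2 s' t').
  apply: (@nfun_cpred _ _ _ (fun p : X * N => p.2 (pickle (s', t'))) (fun v => v <> 0%N)).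
  exact: (nfun_cfun (nfun_coord _) cfun_snd).
have : S11 (fun x => exists u, simulation (T x) (S x) (rel u) /\ rel u s t).
  apply: (@S11_exN _ _ (fun p => simulation (T p.1) (S p.1) (rel p.2) /\ rel p.2 s t)).
  apply: S11_and; last exact: cpred_S11.
  have : S11 (fun p : X * N => forall c, if @unpickle (seq nat * seq nat * nat)%type c is Some (s', t', k) then
      ~ (rel p.2 s' t' /\ T p.1 (rcons s' k)) \/
      exists m, S p.1 (rcons t' m) /\ rel p.2 (rcons s' k) (rcons t' m) else True).
    apply: S11_all => c; case: (unpickle c) => [[[s' t'] k]|].
      2: by apply: cpred_S11; exact: cpred_cst.
    apply: S11_or.
      apply/cpred_S11/cpredN/(cpred2 and) => //.
      exact: (cpred_comp (cT _) cfun_fst).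
    apply: S11_exn => m; apply/cpred_S11/(cpred2 and) => //.
    exact: (cpred_comp (cS _) cfun_fst).
  apply: S11_ext => p; split=> [h s' t' r' k Tk|h c].
    have := h (pickle (s', t', k)); rewrite pickleK => -[|//].
    by move=> /not_andP[].
  case: (unpickle c) => [[[s' t'] k]|//].
  case: (EM (rel p.2 s' t' /\ T p.1 (rcons s' k))) => [[r' Tk]|]; last by left.
  by right; exact: h.
apply: S11_ext => x; split=> [[u [h1 h2]]|[r hr rst]]; first by exists (rel u).
pose u c := if @unpickle (seq nat * seq nat)%type c is Some (s, t) then nat_of_bool `[<r s t>] else 0%N.
exists u; have ru s' t' : rel u s' t' <-> r s' t'.
  by rewrite /rel /u pickleK; case: asboolP.
split; last exact/ru.
by move=> s' t' /ru/hr h k /h[m [Sm /ru rm]]; exists m.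
Qed.

Lemma S11_sim_lt (T S : X -> seq nat -> Prop) s t :
  cpred_tree T -> cpred_tree S -> S11 (fun x => sim_lt (T x) (S x) s t).
Proof.
move=> cT cS; apply: S11_exn => k; apply: S11_and; last exact: S11_sim.
exact/cpred_S11/cS.
Qed.

Lemma S11_all_seq {C : countType} (P : C -> X -> Prop) :
  (forall s, S11 (P s)) -> S11 (fun x => forall s, P s x).
Proof.
move=> h.
have : forall c, S11 (fun x => if unpickle c is Some s then P s x else True).
  move=> c; case: (unpickle c) => [s|]; first exact: h.
  exact/cpred_S11/cpred_cst.
move/S11_all; apply: S11_ext => x; split=> [hx s|hx c].
  by have := hx (pickle s); rewrite pickleK.
by case: (unpickle c).
Qed.

Lemma S11_ex_seq {C : countType} (P : C -> X -> Prop) :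
  (forall s, S11 (P s)) -> S11 (fun x => exists s, P s x).
Proof.
move=> h.
have : forall c, S11 (fun x => if unpickle c is Some s then P s x else False).
  move=> c; case: (unpickle c) => [s|]; first exact: h.
  exact/cpred_S11/cpred_cst.
move/S11_exn; apply: S11_ext => x; split=> [[c]|[s Ps]].
  by case: (unpickle c) => // s; exists s.
by exists (pickle s); rewrite pickleK.
Qed.

Section Unicity.
Variable T : X -> seq nat -> Prop.
Hypothesis cT : cpred_tree T.
Hypothesis tT : forall x, tree (T x).

(** This tree is well founded iff every branch of [T x] passes through [s], which is a coanalytic
    condition on [x]. *)
Definition minus s x r := T x r /\ ~~ prefix s r.

Lemma cpred_minus s : cpred_tree (minus s).
Proof. by move=> r; apply: (cpred2 and); [exact: cT|exact: cpred_cst]. Qed.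

Lemma tree_minus s x : tree (minus s x).
Proof.
move=> r k [Tr pr]; split; first exact: tT.
apply: contra pr => /prefixP[u ku]; rewrite -(cat_take_drop k r) ku -catA.
exact: prefix_prefix.
Qed.

(** Least rank of [minus] among the sequences of one length, ties being broken by [pickle]. This is
    the reduction property of coanalytic sets: at most one node per level is kept, even when there
    is no branch and every [minus] is well founded. *)
Definition selected x s := [/\ T x s, wft (minus s x) [::] &
  forall t, size t = size s ->
    ((pickle t < pickle s)%N -> ~ sim (minus t x) (minus s x) [::] [::]) /\
    ~ sim_lt (minus t x) (minus s x) [::] [::]].

(** Each clause fails in an analytic way: by a missing node, by a branch avoiding [s], or by a
    simulation. *)
Lemma S11_not_selected s : S11 (fun x => ~ selected x s).
Proof.
have : S11 (fun x => ~ T x s \/ (~ wft (minus s x) [::] \/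
    exists t, size t = size s /\
    (((pickle t < pickle s)%N /\ sim (minus t x) (minus s x) [::] [::]) \/
    sim_lt (minus t x) (minus s x) [::] [::]))).
  apply: S11_or; first exact/cpred_S11/cpredN/cT.
  apply: S11_or.
    by apply: S11_not_wft => [|x]; [exact: cpred_minus|exact: tree_minus].
  apply: S11_ex_seq => t; apply: S11_and; first exact/cpred_S11/cpred_cst.
  apply: S11_or; last by apply: S11_sim_lt; exact: cpred_minus.
  apply: S11_and; first exact/cpred_S11/cpred_cst.
  by apply: S11_sim; exact: cpred_minus.
apply: S11_ext => x; split=> [h [Ts ws hs]|h].
  case: h => [|[|[t [/hs[h1 h2] [[lt sm]|]]]]] //; exact: h1 sm.
apply: contrapT => /not_orP[/contrapT Ts /not_orP[/contrapT ws /forallNP ht]].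
apply: h; split=> // t st; split=> [lt sm|sl].
  by apply: (ht t); split=> //; left.
by apply: (ht t); split=> //; right.
Qed.

Lemma selected_inj x s t : size s = size t -> selected x s -> selected x t -> s = t.
Proof.
wlog : s t / (pickle t <= pickle s)%N.
  move=> wl st h1 h2; case/orP: (leq_total (pickle t) (pickle s)) => [le|le].
    exact: wl.
  by apply/esym/wl.
rewrite leq_eqVlt => /orP[/eqP/(pcan_inj pickleK)//|lt].
move=> st [_ _ hs] [_ wt ht]; exfalso.
have [h1 h2] := ht s st; have [h3 h4] := hs t (esym st).
by have [/(h3 lt)|/h2] := @sim_total _ (minus s x) _ [::] wt.
Qed.

Lemma branch_minus x s y : branch (T x) y -> mkseq y (size s) <> s ->
  branch (minus s x) y.
Proof.
move=> Ty ys n; split; first exact: Ty.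
apply/negP => /prefixP[u hu]; apply: ys.
have sn : (size s <= n)%N by rewrite -(size_mkseq y n) hu size_cat leq_addr.
by rewrite -(minn_idPl sn) -take_mkseq hu take_size_cat.
Qed.

Lemma minus_branch x s y : branch (minus s x) y ->
  branch (T x) y /\ mkseq y (size s) <> s.
Proof.
move=> h; split=> [n|ys]; first by case: (h n).
by have [_] := h (size s); rewrite ys prefix_refl.
Qed.

(* A nonempty thin tree selects, at each level, the initial segment of its
   branch; when there is no branch at all, reduction of the co-analytic sets
   "[minus s x] is well founded" selects at most one node per level, which
   keeps the selected nodes coherent and produces a branch. *)
Lemma uniqueP x : (exists y, branch (T x) y /\ forall y', branch (T x) y' -> y' = y) <->
  forall n, exists s, size s = n.+1 /\ selected x s /\ selected x (take n s).
Proof.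
split=> [[y [Ty uy]]|h].
  suff sel n : selected x (mkseq y n).
    move=> n; exists (mkseq y n.+1); split; first exact: size_mkseq.
    split; first exact: sel.
    by rewrite take_mkseq (minn_idPl (leqnSn n)); exact: sel.
  pose F (s : {s : seq nat | size s == n}) := minus (val s) x.
  (* On each level the initial segment of the only branch has no competitor. *)
  have wy s : size s = n -> wft (minus s x) [::] <-> s = mkseq y n.
    move=> sn; split=> [ws|sy].
      apply: contrapT => ne; apply: branch_not_wft ws.
      by apply: branch_minus Ty _; rewrite sn; exact: nesym.
    apply: contrapT => /(not_wft_branch (@tree_minus s x))[y' /minus_branch[/uy->]].
    by rewrite sn sy.
  have sy : size (mkseq y n) == n by rewrite size_mkseq.
  have [[s ss] [/= ws hs]] :=
    @sim_minimal _ F (exist (fun s => size s == n) _ sy) ((wy _ (eqP sy)).2 erefl).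
  have := (wy _ (eqP ss)).1 ws => {ws} es; subst s.
  have wfm := (wy _ (eqP ss)).2 erefl.
  split=> // t; rewrite size_mkseq => /eqP st; split=> [lt sm|].
    have := sim_wft wfm sm => /(wy _ (eqP st)) ty.
    by rewrite ty ltnn in lt.
  exact: (hs (exist (fun s => size s == n) t st)).
have /choice[f hf] := h.
pose y i := nth 0%N (f i) i.
(* The node chosen at one level and the truncation of the next one are both selected, so
   [selected_inj] makes the choices coherent. *)
have fS n : take n.+1 (f n.+1) = f n.
  have [s1 [_ h1]] := hf n.+1; have [s0 [h0 _]] := hf n.
  by apply: selected_inj h1 h0; rewrite size_take s1 s0 ltnSn.
have yf n : mkseq y n.+1 = f n.
  elim: n => [|n IH].
    rewrite /mkseq /= /y; have [] := hf 0%N.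
    by case: (f 0%N) => [//|a [|//]].
  rewrite mkseqS_rcons IH -fS /y.
  have [s1 _] := hf n.+1.
  by rewrite -take_nth ?s1// take_oversize// s1.
exists y; split=> [n|y' Ty'].
  case: n => [|n]; last by rewrite yf; case: (hf n) => _ [[]].
  have -> : mkseq y 0 = take 0 (f 0%N) by rewrite take0.
  by apply: tT; case: (hf 0%N) => _ [[]].
(* Another branch would avoid some selected [f n], and so be a branch of the well-founded
   [minus (f n) x]. *)
suff e n : mkseq y' n.+1 = mkseq y n.+1.
  apply/funext => n; have := congr1 (fun s => nth 0%N s n) (e n).
  by rewrite !nth_mkseq.
rewrite yf; apply: contrapT => ne; have [sn [[_ w _] _]] := hf n.
apply: branch_not_wft w; apply: branch_minus Ty' _.
by rewrite sn.
Qed.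

Lemma S11_not_unique :
  S11 (fun x => ~ exists y, branch (T x) y /\ forall y', branch (T x) y' -> y' = y).
Proof.
have : S11 (fun x => exists n, forall s, size s <> n.+1 \/
    (~ selected x s \/ ~ selected x (take n s))).
  apply: S11_exn => n; apply: S11_all_seq => s.
  apply: S11_or; first exact/cpred_S11/cpred_cst.
  by apply: S11_or; exact: S11_not_selected.
apply: S11_ext => x; split=> [[n h] /uniqueP/(_ n)[s [? []]]|].
  by case: (h s) => [|[|]].
apply: contra_notP => /forallNP h; apply/uniqueP => n.
have /existsNP[s /not_orP[/contrapT s1 /not_orP[/contrapT s2 /contrapT s3]]] := h n.
by exists s.
Qed.

End Unicity.

End TreeFamily.

(** * Cardinality of sections *)

Lemma mkseq_eqn (y y' : N) n : mkseq y n = mkseq y' n <-> nat_eqn n y y'.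
Proof.
split=> [h i ni|h]; first by have := congr1 (fun s => nth 0%N s i) h; rewrite !nth_mkseq.
by apply/eq_in_map => i; rewrite mem_iota add0n => /h.
Qed.

Lemma fusion (s : nat -> seq nat) :
  (forall i, (size (s i) < size (s i.+1))%N) ->
  (forall i, take (size (s i)) (s i.+1) = s i) ->
  exists y : N, forall i, mkseq y (size (s i)) = s i.
Proof.
move=> hlt hs; exists (fun j => nth 0%N (s j.+1) j) => i.
have ge j : (j <= size (s j))%N by elim: j => // j IH; exact: leq_ltn_trans IH (hlt _).
have le k m : (k <= m)%N -> (size (s k) <= size (s m))%N.
  by move=> /subnK <-; elim: (m - k)%N => [//|d IH]; rewrite addSn; apply: leq_trans IH _; exact/ltnW/hlt.
have nthS j k m : (j < size (s k))%N -> (k <= m)%N -> nth 0%N (s m) j = nth 0%N (s k) j.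
  move=> jk; elim: m => [|m IH]; first by rewrite leqn0 => /eqP ->.
  rewrite leq_eqVlt => /orP[/eqP <-//|]; rewrite ltnS => km; rewrite -(IH km).
  by rewrite -[in RHS](hs m) nth_take// (leq_trans jk (le _ _ km)).
apply: (@eq_from_nth _ 0%N); rewrite size_mkseq// => j ji.
rewrite nth_mkseq//; case: (leqP i j.+1) => ij; first exact: nthS.
by apply/esym/nthS; [exact: ge|exact: ltnW].
Qed.

(** Inequality of values is an open condition on the arguments, as for any continuous map into a
    Hausdorff space. This makes [f u <> f u'] analytic although [V] carries no structure. *)
Definition separating {V : Type} (f : N -> V) := forall u u', f u <> f u' ->
  exists n, forall v v', nat_eqn n u v -> nat_eqn n u' v' -> f v <> f v'.

Section DenseInItself.
Context {V : Type} (T : seq nat -> Prop) (g : N -> V).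
Hypothesis tT : tree T.
Hypothesis gsep : separating g.

(** Diagonalization: given an injection [e] of the values into [nat], stage [i] moves to a row whose
    value is not the one of code [i] and fixes enough coordinates to preserve this. The limit branch
    has a value without code. *)
Lemma dense_in_itself_uncountable (y : nat -> N) :
  (forall k, branch T (y k)) ->
  (forall k n, exists j, mkseq (y j) n = mkseq (y k) n /\ g (y j) <> g (y k)) ->
  ~ countable (g @` branch T).
Proof.
move=> Ty dy /countable_injP[e einj].
have step i (p : nat * nat) : exists q : nat * nat,
    [/\ (p.2 < q.2)%N, mkseq (y q.1) p.2 = mkseq (y p.1) p.2 &
    forall v, nat_eqn q.2 (y q.1) v -> branch T v -> e (g v) <> i].
  case: p => k n /=.
  case: (EM (exists u, branch T u /\ e (g u) = i)) => [[u [Tu eu]]|/forallNP nu]; last first.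
    by exists (k, n.+1); split=> //= v _ Tv ev; exact: (nu v (conj Tv ev)).
  have [j [jk gj]] : exists j, mkseq (y j) n = mkseq (y k) n /\ g (y j) <> g u.
    by case: (EM (g (y k) = g u)) => [<-|]; [exact: dy|exists k].
  have [m hm] := gsep gj; exists (j, maxn m n.+1) => /=; split=> //.
    by rewrite leq_maxr.
  move=> v jv Tv ev; apply: (hm v u) => //.
    by apply: (@eqn_le _ ctxN) jv; rewrite leq_maxl.
  by apply: einj; [rewrite inE; exists v|rewrite inE; exists u|rewrite ev].
have /choice[F hF] := fun ip : nat * (nat * nat) => step ip.1 ip.2.
pose S := fix S i : nat * nat := if i is i.+1 then F (i, S i) else (0%N, 0%N).
have hS i : [/\ ((S i).2 < (S i.+1).2)%N,
    mkseq (y (S i.+1).1) (S i).2 = mkseq (y (S i).1) (S i).2 &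
    forall v, nat_eqn (S i.+1).2 (y (S i.+1).1) v -> branch T v -> e (g v) <> i].
  exact: hF (i, S i).
pose s i := mkseq (y (S i).1) (S i).2.
have ss i : size (s i) = (S i).2 by rewrite size_mkseq.
have [z hz] : exists z, forall i, mkseq z (size (s i)) = s i.
  apply: fusion => i; rewrite !ss; have [h1 h2 _] := hS i; first exact: h1.
  by rewrite take_mkseq (minn_idPl (ltnW h1)).
have Sge i : (i <= (S i).2)%N.
  by elim: i => // i IH; apply: leq_ltn_trans IH _; case: (hS i).
have Tz : branch T z.
  move=> n; rewrite -(minn_idPl (Sge n)) -take_mkseq; apply: tT.
  by rewrite -ss hz; exact: Ty.
have [_ _ hz'] := hS (e (g z)); apply: (hz' z _ Tz erefl).
by apply/mkseq_eqn; have := hz (e (g z)).+1; rewrite ss => ->.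
Qed.

(** Rows are indexed by a good node and a bit. Of the two rows attached to an initial segment of a
    given row, at least one has another value than that row. *)
Lemma perfect_rows (good : seq nat -> Prop) (s0 : seq nat) : good s0 ->
  (forall s, good s -> exists a b, [/\ g a <> g b,
     (mkseq a (size s) = s /\ mkseq b (size s) = s),
     (branch T a /\ forall n, good (mkseq a n)) &
     (branch T b /\ forall n, good (mkseq b n))]) ->
  exists y : nat -> N, (forall k, branch T (y k)) /\
    forall k n, exists j, mkseq (y j) n = mkseq (y k) n /\ g (y j) <> g (y k).
Proof.
move=> gs0 h.
have /choice[F hF] : forall s, exists ab : N * N, good s -> [/\ g ab.1 <> g ab.2,
     (mkseq ab.1 (size s) = s /\ mkseq ab.2 (size s) = s),
     (branch T ab.1 /\ forall n, good (mkseq ab.1 n)) &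
     (branch T ab.2 /\ forall n, good (mkseq ab.2 n))].
  move=> s; case: (EM (good s)) => [/h[a [b hab]]|]; first by exists (a, b).
  by exists (fun=> 0%N, fun=> 0%N).
pose y c := if @unpickle (seq nat * bool)%type c is Some (s, b) then
  if `[< good s >] then (if b then (F s).1 else (F s).2) else (F s0).1 else (F s0).1.
have yP k : branch T (y k) /\ forall n, good (mkseq (y k) n).
  rewrite /y; case: unpickle => [[s b]|]; last by case: (hF _ gs0).
  case: asboolP => [/hF[]|_]; first by case: b.
  by case: (hF _ gs0).
exists y; split=> [k|k n]; first by case: (yP k).
have gn := (yP k).2 n; have [ne [e1 e2] _ _] := hF _ gn.
have yb b : y (pickle (mkseq (y k) n, b)) =
    if b then (F (mkseq (y k) n)).1 else (F (mkseq (y k) n)).2.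
  by rewrite {1}/y pickleK asboolT.
rewrite size_mkseq in e1 e2.
case: (EM (g (F (mkseq (y k) n)).1 = g (y k))) => [e|].
  exists (pickle (mkseq (y k) n, false)); rewrite yb; split=> //.
  by rewrite -e; exact: nesym.
by exists (pickle (mkseq (y k) n, true)); rewrite yb.
Qed.

(** Cantor-Bendixson analysis: a node is [good] when uncountably many values pass through it.
    Branches that leave the good nodes contribute countably many values, so above a good node two
    values remain among the branches that stay good. *)
Lemma uncountable_rows : ~ countable (g @` branch T) ->
  exists y : nat -> N, (forall k, branch T (y k)) /\
    forall k n, exists j, mkseq (y j) n = mkseq (y k) n /\ g (y j) <> g (y k).
Proof.
move=> unc; pose B s := branch T `&` [set y | mkseq y (size s) = s].
pose good s := ~ countable (g @` B s).
have g0 : good [::].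
  move=> h; apply: unc; apply: sub_countable h; apply: subset_card_le.
  by move=> _ [y Ty <-]; exists y.
apply: (perfect_rows g0) => s gs.
pose K := B s `&` [set y | forall n, good (mkseq y n)].
have [a [b [Ka Kb gab]]] : exists a b, [/\ K a, K b & g a <> g b].
  apply: contrapT => hK; apply: gs.
  pose F (o : option (seq nat)) :=
    if o is Some t then [set v | ~ good t /\ (g @` B t) v] else g @` K.
  apply: (@sub_countable _ _ _ (\bigcup_o F o)).
    apply: subset_card_le => _ [y By <-].
    case: (EM (forall n, good (mkseq y n))) => [gy|/existsNP[n ngy]].
      by exists None => //; exists y.
    exists (Some (mkseq y n)) => //; split=> //; exists y => //; split; first exact: By.1.
    by rewrite /= size_mkseq.
  apply: bigcup_countable => // -[t|] _ /=.
    case: (EM (good t)) => [gt|/contrapT ct].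
      by rewrite (_ : mkset _ = set0) ?countable0//; apply/seteqP; split=> // v [].
    by apply: sub_countable ct; apply: subset_card_le => v [].
  case: (EM (exists a, K a)) => [[a Ka]|/forallNP nK].
    apply: (@sub_countable _ _ _ [set g a]); last exact: finite_set_countable.
    apply: subset_card_le => _ [b Kb <-] /=; apply: contrapT => ne.
    by apply: hK; exists b, a.
  rewrite (_ : K = set0) ?image_set0; first exact: finite_set_countable.
  by apply/seteqP; split=> // y /nK.
by case: Ka => [[Ta sa] ga]; case: Kb => [[Tb sb] gb]; exists a, b; split.
Qed.

End DenseInItself.

Section NormalForm.
Context {X : Type} {cX : ctx X}.

(** A node asks for a witness over some point close to [x], not over [x] itself. The tree is then
    locally constant in [x], and closedness of the relation makes its branches exactly the witnesses
    over [x]. *)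
Definition tree_of (phi : nat -> X -> N -> Prop) (x : X) (s : seq nat) :=
  exists p : X * N, [/\ witness phi p.1 p.2, eqn (size s) x p.1 &
    mkseq p.2 (size s) = s].

Lemma cpred_tree_of phi : cpred_tree (tree_of phi).
Proof.
move=> s x; exists (size s) => x' xx'; split=> -[p [h1 h2 h3]]; exists p; split=> //.
  exact: eqn_trans h2.
by apply: eqn_trans h2; exact: eqn_sym.
Qed.

Lemma tree_tree_of phi x : tree (tree_of phi x).
Proof.
move=> s k [p [h1 h2 h3]]; exists p; split=> //.
  by apply: eqn_le h2; rewrite size_take; case: ltnP => // /ltnW.
by rewrite size_take_min -[in RHS]h3 take_mkseq.
Qed.

Lemma branch_tree_of phi x y : closed_rel phi ->
  branch (tree_of phi x) y <-> witness phi x y.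
Proof.
move=> cphi; split=> [h n|h n].
  have [m hm] := cphi n (x, y).
  have [p [h1 h2 h3]] := h m; rewrite size_mkseq in h2 h3.
  apply/(hm p); last exact: h1.
  by split=> //=; apply/mkseq_eqn.
by exists (x, y); rewrite size_mkseq; split=> //; exact: eqn_refl.
Qed.

Definition subtree (T : X -> seq nat -> Prop) s x r :=
  T x r /\ (prefix s r || prefix r s).

Lemma subtree_branch T s x y : branch (subtree T s x) y <->
  branch (T x) y /\ mkseq y (size s) = s.
Proof.
split=> [h|[Ty ys] n].
  split=> [n|]; first exact: (h n).1.
  have [_] := h (size s); rewrite !prefixE size_mkseq take_size.
  by rewrite take_oversize ?size_mkseq// => /orP[/eqP|/eqP].
split; first exact: Ty.
rewrite !prefixE size_mkseq take_mkseq; case: (leqP (size s) n) => sn.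
  by rewrite ys eqxx.
by rewrite -[X in take n X]ys take_mkseq (minn_idPl (ltnW sn)) eqxx orbT.
Qed.

Lemma cpred_subtree T s : cpred_tree T -> cpred_tree (subtree T s).
Proof. by move=> cT r; apply: (cpred2 and); [exact: cT|exact: cpred_cst]. Qed.

Lemma tree_subtree T s x : tree (T x) -> tree (subtree T s x).
Proof.
move=> tT r k [Tr sr]; split; first exact: tT.
move: sr; rewrite !prefixE => /orP[/eqP e|/eqP e]; last first.
  by rewrite size_take_min take_min e eqxx orbT.
case: (leqP k (size s)) => ks; last by rewrite take_takel ?(ltnW ks)// e eqxx.
have -> : take k r = take k s by rewrite -[in RHS]e take_takel.
by rewrite [in X in _ || X]size_take_min take_min take_size eqxx orbT.
Qed.

Section Values.
Context {V : Type} (f : N -> V).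
Hypothesis fsep : separating f.

Definition apart n u u' := forall v v', nat_eqn n u v -> nat_eqn n u' v' -> f v <> f v'.

Lemma apartP u u' : f u <> f u' <-> exists n, apart n u u'.
Proof. by split=> [/fsep|[n]]; [exact|apply=> i]. Qed.

Lemma apart_eqn n u u' w w' : nat_eqn n u w -> nat_eqn n u' w' ->
  apart n u u' -> apart n w w'.
Proof.
move=> uw uw' H v v' wv wv'; apply: H; first exact: (@eqn_trans _ ctxN _ _ w).
exact: (@eqn_trans _ ctxN _ _ w').
Qed.

Lemma cpred_apart {Y : Type} {cY : ctx Y} (g h : Y -> N) n : cfun g -> cfun h ->
  cpred (fun y => apart n (g y) (h y)).
Proof.
move=> cg ch y; have [m hm] := cg y n; have [p hp] := ch y n.
exists (maxn m p) => y' hy.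
have e1 : nat_eqn n (g y) (g y') by apply: hm; apply: eqn_le hy; rewrite leq_maxl.
have e2 : nat_eqn n (h y) (h y') by apply: hp; apply: eqn_le hy; rewrite leq_maxr.
by split; apply: apart_eqn => //; exact: (@eqn_sym _ ctxN).
Qed.

Lemma S11_neq {Y : Type} {cY : ctx Y} (g h : Y -> N) : cfun g -> cfun h ->
  S11 (fun y => f (g y) <> f (h y)).
Proof.
move=> cg ch; have : S11 (fun y => exists n, apart n (g y) (h y)).
  by apply: S11_exn => n; apply: cpred_S11; exact: cpred_apart.
by apply: S11_ext => y; rewrite apartP.
Qed.

Lemma separating_left : separating (f \o sleft).
Proof.
move=> u u' /fsep[n hn]; exists n.*2 => v v' uv uv'; apply: hn => i ni.
  by apply: uv; rewrite ltn_double.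
by apply: uv'; rewrite ltn_double.
Qed.

Definition section (P : X * N -> Prop) x : set V := f @` [set u | P (x, u)].

Lemma section_tree (P : X * N -> Prop) : S11 P ->
  exists T, [/\ cpred_tree T, (forall x, tree (T x)) &
    forall x u, P (x, u) <-> exists2 y, branch (T x) y & sleft y = u].
Proof.
move=> [phi cphi h]; exists (tree_of (fun n x y => phi n (x, sleft y) (sright y))).
split; [exact: cpred_tree_of|by move=> x; exact: tree_tree_of|move=> x u].
rewrite h; split=> [[y hy]|[y /branch_tree_of-/(_ (closed_rel_join cphi)) hy <-]].
  exists (sjoin u y); last exact: sleft_join.
  apply/branch_tree_of; first exact: closed_rel_join.
  by move=> n; rewrite sleft_join sright_join.
by exists (sright y).
Qed.

Lemma section_branch (P : X * N -> Prop) T x :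
  (forall u, P (x, u) <-> exists2 y, branch (T x) y & sleft y = u) ->
  section P x = (f \o sleft) @` branch (T x).
Proof.
move=> h; apply/seteqP; split=> [_ [u /h[y Ty <-] <-]|_ [y Ty <-]]; first by exists y.
by exists (sleft y) => //; apply/h; exists y.
Qed.

Lemma S11_uncountable (P : X * N -> Prop) : S11 P ->
  S11 (fun x => ~ countable (section P x)).
Proof.
move=> /section_tree[T [cT tT hT]].
have : S11 (fun x => exists w, forall k, branch (T x) (row k w) /\ forall n, exists j,
    mkseq (row j w) n = mkseq (row k w) n /\
    f (sleft (row j w)) <> f (sleft (row k w))).
  apply: (@S11_exN _ _ (fun p => forall k, branch (T p.1) (row k p.2) /\
    forall n, exists j, mkseq (row j p.2) n = mkseq (row k p.2) n /\
    f (sleft (row j p.2)) <> f (sleft (row k p.2)))).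
  have crow k : cfun (fun p : X * N => row k p.2).
    exact: (cfun_comp (cfun_reindex _) cfun_snd).
  have crowl k : cfun (fun p : X * N => sleft (row k p.2)).
    exact: (cfun_comp (cfun_reindex _) (crow k)).
  apply: S11_all => k; apply: S11_and.
    apply: S11_all => n; apply: cpred_S11.
    exact: (cpred_comp (cpred_nodeN n cT) (cfun_pair cfun_fst (crow k))).
  apply: S11_all => n; apply: S11_exn => j; apply: S11_and; last exact: S11_neq.
  apply: cpred_S11.
  apply: (@nfun_cpred _ _ _ (fun p : X * N => (mkseq (row j p.2) n, mkseq (row k p.2) n))
    (fun v => v.1 = v.2)).
  apply: nfun_comp2; exact: (nfun_cfun (nfun_mkseq _) (crow _)).
apply: S11_ext => x; rewrite (section_branch (hT x)); split=> [[w hw]|].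
  apply: (dense_in_itself_uncountable (tT x) separating_left (y := row^~ w)) => k.
    by case: (hw k).
  by move=> n; case: (hw k) => _ /(_ n).
move=> /(uncountable_rows)[y [Ty dy]]; exists (unrow y) => k; rewrite row_unrow.
by split=> // n; have [j hj] := dy k n; exists j; rewrite row_unrow.
Qed.

End Values.

Lemma separating_id : separating (@id N).
Proof.
move=> u u' ne; have [i hi] : exists i, u i <> u' i.
  by apply: contra_notP ne => /forallNP h; apply/funext => i; exact: contrapT (h i).
by exists i.+1 => v v' uv uv' e; apply: hi; rewrite uv// uv'// -/(v i) e.
Qed.

(* A countable nonempty closed set has an isolated point. *)
Lemma S11_not_countable_nonempty (P : X * N -> Prop) : U11 P ->
  S11 (fun x => ~ (countable [set u | P (x, u)] /\ exists u, P (x, u))).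
Proof.
move=> UP; have [phi cphi [hphi uphi]] := UP.
pose psi n x y := phi n (x, sleft y) (sright y).
have cpsi : closed_rel psi by exact: closed_rel_join.
pose T := tree_of psi.
have cT : cpred_tree T by exact: cpred_tree_of.
have tT x : tree (T x) by exact: tree_tree_of.
have TP x y : branch (T x) y -> P (x, sleft y).
  by move=> /(branch_tree_of _ _ cpsi) hy; apply/hphi; exists (sright y).
have PT x u : P (x, u) -> exists2 y, branch (T x) y & sleft y = u.
  move=> /hphi[y hy]; exists (sjoin u y); last exact: sleft_join.
  by apply/(branch_tree_of _ _ cpsi) => n; rewrite /psi sleft_join sright_join.
have injT x y y' : branch (T x) y -> branch (T x) y' -> sleft y = sleft y' -> y = y'.
  move=> /(branch_tree_of _ _ cpsi) hy /(branch_tree_of _ _ cpsi) hy' e.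
  rewrite -(sjoinK y) -(sjoinK y') e; congr sjoin.
  by apply: uphi hy' => n; rewrite -e; exact: hy.
(* A branch is isolated when it is the only branch of some [subtree]; failure of this at all nodes
   is analytic by [S11_not_unique]. *)
have : S11 (fun x => ~ countable (section (@id N) P x) \/
    forall s, ~ exists y, branch (subtree T s x) y /\
      forall y', branch (subtree T s x) y' -> y' = y).
  apply: S11_or; first by apply: S11_uncountable separating_id _ _; exact: U11_S11.
  apply: S11_all_seq => s; apply: S11_not_unique; first exact: cpred_subtree.
  by move=> x; exact: tree_subtree.
apply: S11_ext => x.
have -> : section (@id N) P x = [set u | P (x, u)] by rewrite /section image_id.
split=> [[h [//]|h [cP [u /PT[y Ty yu]]]]|].
  (* Without isolated branches, [perfect_rows] applies to the nodes lying on branches and gives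
     uncountably many branches; unique witnesses turn these into uncountably many points. *)
  have iso s : (exists y, branch (T x) y /\ mkseq y (size s) = s) ->
      exists a b, [/\ a <> b, (mkseq a (size s) = s /\ mkseq b (size s) = s),
        branch (T x) a & branch (T x) b].
    move=> [a [Ta sa]]; apply: contrapT => nab; apply: (h s); exists a.
    split=> [|b /subtree_branch[Tb sb]]; first exact/subtree_branch.
    by apply: contrapT => ne; apply: nab; exists b, a.
  have g0 : exists y', branch (T x) y' /\ mkseq y' 0 = [::] by exists y.
  have [] := @perfect_rows _ (T x) (@id N)
    (fun s => exists y, branch (T x) y /\ mkseq y (size s) = s) [::] g0.
    move=> s /iso[a [b [ab [sa sb] Ta Tb]]]; exists a, b; split=> //; split=> // n.
      by exists a; rewrite size_mkseq.
    by exists b; rewrite size_mkseq.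
  move=> z [Tz dz].
  apply: (dense_in_itself_uncountable (tT x) separating_id Tz dz).
  apply: sub_countable cP; rewrite image_id.
  have : (sleft @` branch (T x) #= branch (T x))%card.
    by apply: inj_card_eq => a b /set_mem Ta /set_mem Tb; exact: injT.
  rewrite card_eq_le => /andP[_ le]; apply: card_le_trans le _; apply: subset_card_le.
  by move=> _ [a Ta <-]; exact: TP.
move=> /not_andP[ncP|nP]; [by left|right] => s [y [/subtree_branch[Ty _] _]].
by apply: nP; exists (sleft y); exact: TP.
Qed.

End NormalForm.

(** * Finite and countable cardinals expressed by lower bounds *)

Section CardII.
Context {V : Type}.
Implicit Types D : set V.

Lemma not_geq_le D n : ~~ (`I_n.+1 #<= D)%card <-> (D #<= `I_n)%card.
Proof.
split=> [|Dn]; last first.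
  by apply/negP => nD; have := card_le_trans nD Dn; rewrite card_le_II ltnn.
case: (EM (finite_set D)) => [/finite_setP[m Dm]|/infiniteP inf] /negP ng.
  move: Dm; rewrite card_eq_le => /andP[Dm mD].
  apply: card_le_trans Dm _; rewrite card_le_II leqNgt; apply/negP => nm.
  by apply: ng; apply: card_le_trans mD; rewrite card_le_II.
by exfalso; apply: ng; apply: card_le_trans inf; exact: subset_card_le.
Qed.

(** The clauses are grouped by complexity: the lower bound alone is analytic, but joined to
    countability it becomes coanalytic for sections with unique witnesses. *)
Lemma card_eq_II D n : (D #= `I_n)%card <->
  [/\ countable D, (`I_n #<= D)%card & ~~ (`I_n.+1 #<= D)%card].
Proof.
rewrite card_eq_le; split=> [/andP[Dn nD]|[_ nD /not_geq_le Dn]]; last by rewrite Dn.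
split=> //; last exact/not_geq_le.
by apply: finite_set_countable; exact: card_le_finite Dn (finite_II n).
Qed.

Lemma finite_set_not_geq D : finite_set D <-> exists n, ~~ (`I_n #<= D)%card.
Proof.
split=> [/finite_set_leP[n Dn]|[[|n]]].
- by exists n.+1; apply/not_geq_le.
- by rewrite II0 card_ge0.
- by move/not_geq_le => Dn; exact: card_le_finite Dn (finite_II n).
Qed.

Lemma card_eq_nat D : (D #= [set: nat])%card <->
  countable D /\ forall n, (`I_n #<= D)%card.
Proof.
split=> [|[cD hD]].
  rewrite card_eq_le => /andP[cD nD]; split=> // n.
  by apply: card_le_trans nD; exact: subset_card_le.
rewrite card_eq_le; apply/andP; split=> //; apply/infiniteP.
by move/finite_set_not_geq => [n /negP]; exact.
Qed.

End CardII.

Lemma card_geq_rows {V : pointedType} (f : N -> V) (E : set N) n :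
  (`I_n #<= f @` E)%card <-> exists w : nat -> N, (forall i, (i < n)%N -> E (w i)) /\
    forall i j, (i < n)%N -> (j < n)%N -> i <> j -> f (w i) <> f (w j).
Proof.
split=> [/pcard_leP[g]|[w [hE hw]]].
  have /choice[w hw] : forall i, exists u, (i < n)%N -> E u /\ f u = g i.
    move=> i; case: (ltnP i n) => ni; last by exists (fun=> 0%N).
    by have [u Eu <-] := @funS _ _ _ _ g i ni; exists u.
  exists w; split=> [i /hw[]//|i j ni nj].
  by rewrite (hw _ ni).2 (hw _ nj).2; apply: contra_not => /(@inj _ _ _ g); apply; rewrite inE.
have : ((f \o w) @` `I_n #= `I_n)%card.
  apply: inj_card_eq => i j /set_mem ni /set_mem nj; apply: contra_eq => /eqP ij.
  by apply/eqP; exact: hw.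
rewrite card_eq_le => /andP[_ le]; apply: card_le_trans le _.
by apply: subset_card_le => _ [i ni <-]; exists (w i) => //; exact: hE.
Qed.

Section CardSections.
Context {X : Type} {cX : ctx X}.

Lemma S11_geq {V : pointedType} (f : N -> V) (P : X * N -> Prop) n :
  separating f -> S11 P -> S11 (fun x => (`I_n #<= section f P x)%card).
Proof.
move=> fsep SP.
have crow k : cfun (fun p : X * N => row k p.2).
  exact: (cfun_comp (cfun_reindex _) cfun_snd).
have : S11 (fun x => exists w, (forall i, (i < n)%N -> P (x, row i w)) /\
    forall i j, (i < n)%N -> (j < n)%N -> i <> j -> f (row i w) <> f (row j w)).
  apply: (@S11_exN _ _ (fun p => (forall i, (i < n)%N -> P (p.1, row i p.2)) /\
    forall i j, (i < n)%N -> (j < n)%N -> i <> j -> f (row i p.2) <> f (row j p.2))).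
  apply: S11_and; apply: S11_all => i.
    case: (ltnP i n) => ni; last by apply: S11_ext (cpred_S11 (cpred_cst True)).
    apply: S11_ext (S11_comp (cfun_pair cfun_fst (crow i)) SP) => p.
    by split=> [//|/(_ isT)].
  apply: S11_all => j.
  case: (EM [/\ (i < n)%N, (j < n)%N & i <> j]) => [[ni nj ij]|h].
    by apply: S11_ext (S11_neq fsep (crow i) (crow j)) => p; split=> [//|/(_ ni nj ij)].
  by apply: S11_ext (cpred_S11 (cpred_cst True)) => p; split=> // _ ? ? ?; case: h.
apply: S11_ext => x; rewrite card_geq_rows; split=> [[w [h1 h2]]|[w [h1 h2]]].
  by exists (row^~ w).
by exists (unrow w); split=> [i|i j]; rewrite !row_unrow; [exact: h1|exact: h2].
Qed.

Definition fiber (P : X * N -> Prop) x : set N := [set u | P (x, u)].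

Lemma section_id (P : X * N -> Prop) x : section id P x = fiber P x.
Proof. by rewrite /section image_id. Qed.

(** The rows from [n] on are zero so that a tuple has a single code; countability of [P] then passes
    to its tuples. *)
Definition tuples (P : X * N -> Prop) n (p : X * N) :=
  [/\ forall i, (i < n)%N -> P (p.1, row i p.2),
      forall i, (n <= i)%N -> row i p.2 = fun=> 0%N &
      forall i j, (i < n)%N -> (j < n)%N -> i <> j -> row i p.2 <> row j p.2].

Lemma U11_if {Y : Type} {cY : ctx Y} (b : Prop) (P : Y -> Prop) :
  U11 P -> U11 (fun y => b -> P y).
Proof.
case: (EM b) => hb UP; first by apply: U11_ext UP => y; split=> [//|/(_ hb)].
by apply: U11_ext (cpred_U11 (cpred_cst True)) => y.
Qed.

Lemma U11_tuples (P : X * N -> Prop) n : U11 P -> U11 (tuples P n).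
Proof.
move=> UP.
have crow k : cfun (fun p : X * N => row k p.2).
  exact: (cfun_comp (cfun_reindex _) cfun_snd).
have : U11 (fun p : X * N => (forall i, (i < n)%N -> P (p.1, row i p.2)) /\
   ((forall i, (n <= i)%N -> row i p.2 = fun=> 0%N) /\
    forall i j, (i < n)%N -> (j < n)%N -> i <> j -> row i p.2 <> row j p.2)).
  apply: U11_and; last apply: U11_and; apply: U11_all => i.
  - by apply: U11_if; exact: U11_comp (cfun_pair cfun_fst (crow i)) UP.
  - apply: U11_if; have : U11 (fun p : X * N => forall k, row i p.2 k = 0%N).
      apply: U11_all => k; apply: cpred_U11.
      apply: (@nfun_cpred _ _ _ (fun p : X * N => row i p.2 k) (fun v => v = 0%N)).
      exact: (nfun_cfun (nfun_coord _) (crow i)).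
    by apply: U11_ext => p; split=> [h|->//]; exact/funext.
  - apply: U11_all => j; do 3 apply: U11_if.
    have : Bor (fun p : X * N => exists k, row i p.2 k <> row j p.2 k).
      apply: Bor_exn => k; apply: cpred_Bor; apply: cpredN.
      apply: (@nfun_cpred _ _ _ (fun p : X * N => (row i p.2 k, row j p.2 k))
        (fun v => v.1 = v.2)).
      apply: nfun_comp2; exact: (nfun_cfun (nfun_coord _) (crow _)).
    move=> [+ _]; apply: U11_ext => p; split=> [[k nk] /(congr1 (fun f => f k))//|ne].
    apply: contrapT => /forallNP h; apply: ne; apply/funext => k.
    exact: contrapT (h k).
apply: U11_ext => p; split=> [[? []]|[]] //.
Qed.

Lemma tuples_card (P : X * N -> Prop) n x :
  (exists w, tuples P n (x, w)) <-> (`I_n #<= fiber P x)%card.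
Proof.
rewrite -section_id card_geq_rows; split=> [[w [h1 _ h3]]|[w [h1 h2]]].
  by exists (row^~ w).
exists (unrow (fun i => if (i < n)%N then w i else fun=> 0%N)); split=> /=.
- by move=> i ni; rewrite row_unrow ni; exact: h1.
- by move=> i ni; rewrite row_unrow ltnNge ni.
- by move=> i j ni nj; rewrite !row_unrow ni nj; exact: h2.
Qed.

Lemma countable_tuples (P : X * N -> Prop) n x :
  countable (fiber P x) -> countable (fiber (tuples P n) x).
Proof.
move=> /countable_injP[e einj].
apply/countable_injP; exists (fun w => pickle (mkseq (fun i => e (row i w)) n)).
move=> w w' /set_mem[/= h1 h2 _] /set_mem[/= k1 k2 _] /(pcan_inj pickleK) ew.
apply: row_inj => i; case: (ltnP i n) => ni; last by rewrite h2// k2.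
have := congr1 (fun s => nth 0%N s i) ew; rewrite !nth_mkseq// => /einj; apply.
  by rewrite inE; exact: h1.
by rewrite inE; exact: k1.
Qed.

(** Having [n] points means that the set of tuples is nonempty, and the isolated-point argument
    applies to that set. *)
Lemma S11_not_countable_geq (P : X * N -> Prop) n : U11 P ->
  S11 (fun x => ~ (countable (fiber P x) /\ (`I_n #<= fiber P x)%card)).
Proof.
move=> UP.
have : S11 (fun x => ~ countable (section id P x) \/
    ~ (countable (fiber (tuples P n) x) /\ exists w, tuples P n (x, w))).
  apply: S11_or; last exact/S11_not_countable_nonempty/U11_tuples.
  by apply: S11_uncountable; [exact: separating_id|exact: U11_S11].
apply: S11_ext => x; rewrite tuples_card section_id.
split=> [[nc [//]|nct [cD gD]]|/not_andP[|]]; [|by left|right].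
  by apply: nct; split=> //; exact: countable_tuples.
by case.
Qed.

Lemma S11_not_card_eq (P : X * N -> Prop) n : U11 P ->
  S11 (fun x => ~ (fiber P x #= `I_n)%card).
Proof.
move=> UP.
have : S11 (fun x => ~ (countable (fiber P x) /\ (`I_n #<= fiber P x)%card) \/
    (`I_n.+1 #<= section id P x)%card).
  apply: S11_or; first exact: S11_not_countable_geq.
  by apply: S11_geq; [exact: separating_id|exact: U11_S11].
apply: S11_ext => x; rewrite section_id card_eq_II; split=> [[h [c g _]|h [_ _ /negP]]|h].
- exact: h.
- exact.
case: (boolP (`I_n.+1 #<= fiber P x)%card) => [|ng]; first by right.
by left=> -[c g]; apply: h.
Qed.

Lemma S11_not_card_nat (P : X * N -> Prop) : U11 P ->
  S11 (fun x => ~ (fiber P x #= [set: nat])%card).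
Proof.
move=> UP.
have : S11 (fun x => exists n,
    ~ (countable (fiber P x) /\ (`I_n #<= fiber P x)%card)).
  by apply: S11_exn => n; exact: S11_not_countable_geq.
apply: S11_ext => x; rewrite card_eq_nat; split=> [[n h] [c g]|h]; first exact: h.
apply: contrapT => /forallNP k; apply: h; split=> [|n].
  by have /contrapT[] := k 0%N.
by have /contrapT[] := k n.
Qed.

End CardSections.

(* Makes the normed-module lemmas applicable to [density_to], whose limits are
   stated for the pseudometric structure of [R]. *)
HB.instance Definition _ := NormedModule.copy R R^o.

(** * Topology of sequence spaces *)

Section SequenceSpace.
Context {T : discreteTopologicalType}.

Definition agree n (f g : nat -> T) := forall i, (i < n)%N -> g i = f i.

Lemma nbhs_agree (f : prod_topology (fun _ : nat => T)) n : nbhs f (agree n f).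
Proof.
have FF : Filter (nbhs f) by exact: nbhs_filter.
elim: n => [|n IH]; first by apply: (@filterS _ _ _ setT) => //; exact: filterT.
have cn : nbhs f [set g : prod_topology (fun _ : nat => T) | g n = f n].
  exact: (@proj_continuous _ (fun _ : nat => T) n f [set f n] (discrete_set1 _)).
apply: filterS2 IH cn => g fg gn i; rewrite ltnS leq_eqVlt => /orP[/eqP ->//|].
exact: fg.
Qed.

Lemma nbhs_seqP (f : prod_topology (fun _ : nat => T)) U :
  nbhs f U <-> exists n, agree n f `<=` U.
Proof.
split=> [|[n fU]].
  2: exact: (@filterS _ (nbhs f) (nbhs_filter f) _ _ fU (nbhs_agree f n)).
pose F : set_system (prod_topology (fun _ : nat => T)) :=
  [set U | exists n, agree n f `<=` U].
have FF : Filter F.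
  split=> [|P Q [n hn] [m hm]|P Q PQ [n hn]].
  - by exists 0%N.
  - exists (maxn n m) => g fg; split; [apply: hn|apply: hm] => i ni; apply: fg.
      by rewrite leq_max ni.
    by rewrite leq_max ni orbT.
  - by exists n => g /hn/PQ.
have : F --> f.
  apply/cvg_sup => i.
  have surj : (fun g : prod_topology (fun _ : nat => T) => g i) @` setT = setT.
    by rewrite eqEsubset; split=> v // _; exists (fun=> v).
  apply/cvg_image => // W /nbhs_singleton Wf.
  exists ((fun g : prod_topology (fun _ : nat => T) => g i) @^-1` W).
    by exists i.+1 => g fg; rewrite /= fg.
  exact: image_preimage.
by apply.
Qed.

Lemma open_seqP (U : set (prod_topology (fun _ : nat => T))) :
  open U <-> forall f, U f -> exists n, agree n f `<=` U.
Proof.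
rewrite openE; split=> h f Uf; first exact/nbhs_seqP/h.
exact/nbhs_seqP/h.
Qed.

End SequenceSpace.

(** Compactness in combinatorial form: used with two letters for the Cantor space, and with the
    letters up to [alpha i] for the sequences bounded by [alpha]. *)
Lemma konig {T : eqType} (x0 : T) (alpha : nat -> seq T) (B : seq T -> Prop) :
  (forall s k, B s -> B (take k s)) ->
  (forall n, exists s, [/\ size s = n, B s &
    forall i, (i < n)%N -> nth x0 s i \in alpha i]) ->
  exists y : nat -> T, (forall n, B (mkseq y n)) /\ forall i, y i \in alpha i.
Proof.
move=> Bt Bn.
pose C s := B s /\ forall i, (i < size s)%N -> nth x0 s i \in alpha i.
have Ct s k : C s -> C (take k s).
  move=> [Bs hs]; split=> [|i]; first exact: Bt.
  rewrite size_take_min leq_min => /andP[ik si].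
  by rewrite nth_take// hs.
pose inf s := forall n, exists t, size t = n /\ C (s ++ t).
have inf0 : inf [::] by move=> n; have [s [sn Bs hs]] := Bn n; exists s; rewrite /C sn.
have infS s : inf s -> exists a, a \in alpha (size s) /\ inf (rcons s a).
  move=> is_; apply: contrapT => /forallNP nh.
  have /choice[m hm] : forall a, exists n, a \in alpha (size s) ->
      forall t, size t = n -> ~ C (rcons s a ++ t).
    move=> a; case: (boolP (a \in alpha (size s))) => [aa|]; last by exists 0%N.
    have /existsNP[n hn] : ~ inf (rcons s a) by move=> ia; apply: (nh a).
    by exists n => _ t tn Ct'; apply: hn; exists t.
  have [t0 []] := is_ (\max_(a <- alpha (size s)) m a).+1.
  case: t0 => [//|a t] [ts] Cat.
  have aa : a \in alpha (size s).
    have := Cat.2 (size s); rewrite nth_cat ltnn subnn /= size_cat /=.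
    by apply; rewrite addnS ltnS leq_addr.
  have mt : (m a <= size t)%N by rewrite ts; apply: leq_bigmax_seq.
  apply: (hm a aa (take (m a) t)); first exact: size_takel.
  have := Ct _ (size (rcons s a) + m a)%N Cat.
  by rewrite -cat_rcons take_cat ltnNge leq_addr /= addKn.
have /choice[f hf] : forall s, exists a, inf s -> a \in alpha (size s) /\ inf (rcons s a).
  by move=> s; case: (EM (inf s)) => [/infS[a ha]|]; [exists a|exists x0].
pose S n := iter n (fun s => rcons s (f s)) [::].
have sS n : size (S n) = n by elim: n => //= n; rewrite size_rcons => ->.
have iS n : inf (S n) by elim: n => //= n /hf[].
have yS n : mkseq (fun i => f (S i)) n = S n.
  by elim: n => // n IH; rewrite mkseqS IH.
exists (fun i => f (S i)); split=> [n|i]; last by rewrite -[X in alpha X](sS i); case: (hf _ (iS i)).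
by rewrite yS; have [t [/size0nil ->]] := iS n 0%N; rewrite cats0 => -[].
Qed.

(** * The density function of a closed set *)

Lemma cylE s (z : cantor_space) : cyl s z <-> mkseq z (size s) = s.
Proof.
split=> [h|<- i]; last by rewrite size_mkseq => ni; rewrite nth_mkseq.
by apply: (@eq_from_nth _ false); rewrite size_mkseq// => i ni; rewrite nth_mkseq// h.
Qed.

Lemma cyl_mkseq n (z z' : cantor_space) : cyl (mkseq z n) z' <-> agree n z z'.
Proof.
rewrite /cyl /= size_mkseq; split=> h i ni; have := h i ni; rewrite nth_mkseq//.
Qed.

Lemma cyl_prefix s (z : cantor_space) n : (size s <= n)%N ->
  cyl s z <-> prefix s (mkseq z n).
Proof.
move=> sn; rewrite cylE prefixE take_mkseq (minn_idPl sn).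
by split=> [->|/eqP//]; exact: eqxx.
Qed.

Definition meets (A : set cantor_space) s := A `&` cyl s !=set0.

Lemma meets_closed (A : set cantor_space) (z : cantor_space) : closed A ->
  (forall n, meets A (mkseq z n)) -> A z.
Proof.
move=> cA h; apply: contrapT => nA.
have [n hn] := (open_seqP _).1 (closed_openC cA) z nA.
by have [z' [Az' /cyl_mkseq/hn]] := h n.
Qed.

Lemma meets_take A s k : meets A s -> meets A (take k s).
Proof.
move=> [z [Az sz]]; exists z; split=> // i; rewrite size_take_min leq_min => /andP[ik si].
by rewrite nth_take// sz.
Qed.

Lemma meets_split A s : meets A s <-> meets A (rcons s false) \/ meets A (rcons s true).
Proof.
split=> [[z [Az sz]]|]; last first.
  by case=> /(@meets_take _ _ (size s)); rewrite -cats1 take_size_cat.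
have : meets A (rcons s (z (size s))).
  exists z; split=> //; apply/cylE; rewrite size_rcons mkseqS.
  by move/cylE : sz => ->.
by case: (z (size s)); [right|left].
Qed.

Lemma compact_closedK (A : set cantor_space) : compact A <-> closed A.
Proof.
split; first exact: (compact_closed cantor_space_hausdorff).
by move=> cA; exact: (subclosed_compact cA cantor_space_compact).
Qed.

Lemma closed_Kspace (K : Kspace) : closed (proj1_sig K).
Proof. by apply/compact_closedK; case: K. Qed.

Lemma Kspace_ext (K L : Kspace) :
  (forall s, meets (proj1_sig K) s <-> meets (proj1_sig L) s) -> K = L.
Proof.
move=> h; have e : proj1_sig K = proj1_sig L.
  rewrite eqEsubset; split=> z Kz; apply: meets_closed; try exact: closed_Kspace.
    by move=> n; apply/h; exists z; split=> //; exact/cyl_mkseq.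
  by move=> n; apply/h; exists z; split=> //; exact/cyl_mkseq.
case: K e {h} => A cA; case: L => B cB /= e; subst B.
by congr exist; exact: Prop_irrelevance.
Qed.

(** Relative measure in [cyl s] of the clopen set of points whose node [n] levels below [s] meets
    [A]; for closed [A] these sets decrease to [A] within [cyl s]. *)
Fixpoint apx (A : set cantor_space) n s : R :=
  if n is m.+1 then (apx A m (rcons s false) + apx A m (rcons s true)) / 2
  else (`[< meets A s >])%:R.

Lemma apx_ge0 A n s : 0 <= apx A n s.
Proof.
by elim: n s => [|n IH] s /=; [exact: ler0n|rewrite divr_ge0// addr_ge0].
Qed.

Lemma apx_le1 A n s : apx A n s <= 1.
Proof.
elim: n s => [|n IH] s /=; first by case: asboolP.
by have := IH (rcons s false); have := IH (rcons s true); lra.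
Qed.

Lemma apx_nmeets A n s : ~ meets A s -> apx A n s = 0.
Proof.
elim: n s => [|n IH] s ns /=; first by rewrite asboolF.
by rewrite !IH ?addr0 ?mul0r// => h; apply: ns; apply/meets_split; [right|left].
Qed.

Lemma apx_nincr A s : nonincreasing_seq (fun n => apx A n s).
Proof.
apply/nonincreasing_seqP => n; elim: n s => [|n IH] s.
  case: (EM (meets A s)) => ms; last by rewrite !apx_nmeets.
  by rewrite [leRHS]/= asboolT//; exact: apx_le1.
have h1 := IH (rcons s false); have h2 := IH (rcons s true).
have -> : apx A n.+2 s = (apx A n.+1 (rcons s false) + apx A n.+1 (rcons s true)) / 2 by [].
have -> : apx A n.+1 s = (apx A n (rcons s false) + apx A n (rcons s true)) / 2 by [].
lra.
Qed.

Definition dens A s : R := limn (fun n => apx A n s).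

Lemma cvg_apx A s : (fun n => apx A n s) @ \oo --> dens A s.
Proof.
apply: nonincreasing_is_cvgn; first exact: apx_nincr.
by exists 0 => _ [n _ <-]; exact: apx_ge0.
Qed.

Lemma dens_le_apx A s n : dens A s <= apx A n s.
Proof. by apply: nonincreasing_cvgn_ge; [exact: apx_nincr|exact: cvg_apx]. Qed.

Lemma dens_ge0 A s : 0 <= dens A s.
Proof. by apply: limr_ge; [exact: cvg_apx|apply: nearW => n; exact: apx_ge0]. Qed.

Lemma dens_le1 A s : dens A s <= 1.
Proof. exact: le_trans (dens_le_apx A s 0) (apx_le1 _ _ _). Qed.

Lemma cvg_average (u v : nat -> R) (a b : R) : u @ \oo --> a -> v @ \oo --> b ->
  (fun n => (u n + v n) / 2) @ \oo --> (a + b) / 2.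
Proof. by move=> ua vb; exact: (cvgM (cvgD ua vb) (cvg_cst _)). Qed.

Lemma dens_split A s : dens A s = (dens A (rcons s false) + dens A (rcons s true)) / 2.
Proof.
have h1 : (fun n => apx A n.+1 s) @ \oo --> dens A s.
  by rewrite (cvg_shiftS (fun n => apx A n s)); exact: cvg_apx.
have h2 : (fun n => (apx A n (rcons s false) + apx A n (rcons s true)) / 2) @ \oo -->
    (dens A (rcons s false) + dens A (rcons s true)) / 2.
  by apply: cvg_average; exact: cvg_apx.
exact: (cvg_unique _ h1 h2).
Qed.

Lemma dens_nmeets A s : ~ meets A s -> dens A s = 0.
Proof.
move=> ns; apply/eqP; rewrite eq_le dens_ge0 andbT.
by rewrite (le_trans (dens_le_apx A s 0))//= asboolF.
Qed.

Lemma cyl_rcons s b : cyl (rcons s b) `<=` cyl s.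
Proof. by move=> z h i ni; rewrite h ?size_rcons 1?ltnW// nth_rcons ni. Qed.

Lemma cyl_nonempty s : cyl s !=set0.
Proof. by exists (nth false s). Qed.

Lemma dens_cyl A s : cyl s `<=` A -> dens A s = 1.
Proof.
have a1 n t : cyl t `<=` A -> apx A n t = 1.
  elim: n t => [|n IH] t tA /=.
    rewrite asboolT//; have [z tz] := cyl_nonempty t.
    by exists z; split=> //; exact: tA.
  by rewrite !IH; [lra|exact: subset_trans (@cyl_rcons _ _) tA..].
move=> sA; apply: cvg_lim => //.
by under eq_fun do rewrite a1//; exact: cvg_cst.
Qed.

(** * The coin-tossing measure of closed sets *)

Definition wt (s : seq bool) : R := 2 ^- size s.

Lemma wt_gt0 s : 0 < wt s.
Proof. by rewrite /wt invr_gt0 exprn_gt0. Qed.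

Lemma wt_rcons s b : wt (rcons s b) = wt s / 2.
Proof. by rewrite /wt size_rcons exprS invfM mulrC. Qed.

Lemma exp2_small (e : R) : 0 < e -> exists k, (2 : R) ^- k < e.
Proof.
move=> e0; have [k hk] := ltr_add_invr e0; exists k.+1; apply: le_lt_trans hk.
by rewrite add0r lef_pV2 ?posrE ?exprn_gt0 ?ltr0n// -natrX ler_nat ltnW// ltn_expl.
Qed.

Lemma nneseries_le_partial (u : nat -> \bar R) (x : \bar R) :
  (forall i, (0 <= u i)%E) -> (forall n, (\sum_(0 <= i < n) u i <= x)%E) ->
  (\sum_(0 <= i <oo) u i <= x)%E.
Proof.
move=> u0 ux; apply: lime_le; first by apply: is_cvg_nneseries => i _ _; exact: u0.
exact: nearW.
Qed.

Lemma mu_le_list (X : set cantor_space) (l : seq (seq bool)) :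
  (forall z, X z -> exists2 s, s \in l & cyl s z) ->
  (mu X <= (\sum_(s <- l) wt s)%:E)%E.
Proof.
move=> Xl; apply/lee_addgt0Pr => e e0.
have [L hL] := exp2_small e0.
(* Covers are infinite sequences, so the list is padded with cylinders of total weight at most
   [2 ^- L], which is below [e]. *)
pose c i := if (i < size l)%N then nth [::] l i else nseq (L + i).+1 false.
apply: (@le_trans _ _ (\sum_(0 <= i <oo) ((wt (c i))%:E))%E).
  apply: ereal_inf_lbound; exists c => //.
  move=> z /Xl[s sl sz]; exists (index s l) => //.
  by rewrite /c index_mem sl nth_index.
apply: nneseries_le_partial => [i|n]; first by rewrite lee_fin ltW// wt_gt0.
rewrite sumEFin lee_fin.
pose a i : R := if (i < size l)%N then wt (nth [::] l i) else 0.
have hb i : wt (c i) <= a i + 2 ^- (L + i).+1.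
  rewrite /c /a; case: ifP => _.
    by rewrite lerDl invr_ge0 exprn_ge0.
  by rewrite add0r /wt size_nseq.
have ha m : \sum_(0 <= i < m) a i <= \sum_(s <- l) wt s.
  rewrite (big_nth [::]) [leRHS](_ : _ = \sum_(0 <= i < size l) a i); last first.
    by apply: eq_big_nat => i /andP[_ il]; rewrite /a il.
  have a0 i : 0 <= a i by rewrite /a; case: ifP => // _; exact/ltW/wt_gt0.
  case: (leqP m (size l)) => ml.
    by rewrite [leRHS](big_cat_nat (n := m))//= lerDl sumr_ge0.
  rewrite (big_cat_nat (n := size l)) ?(ltnW ml)//= [X in _ + X]big1_seq ?addr0//.
  by move=> i /=; rewrite mem_index_iota /a => /andP[li _]; rewrite ltnNge li.
have hg m : \sum_(0 <= i < m) (2 : R) ^- (L + i).+1 = 2 ^- L * (1 - 2 ^- m).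
  elim: m => [|m IH]; first by rewrite big_geq// expr0 invr1 subrr mulr0.
  rewrite big_nat_recr//= IH exprS exprD [in RHS]exprS !invfM.
  have : (2 : R) / 2 = 1 by rewrite divff.
  move: (2 ^- L) (2 ^- m) => x y _.
  lra.
apply: (@le_trans _ _ (\sum_(0 <= i < n) (a i + 2 ^- (L + i).+1))).
  by apply: ler_sum => i _; exact: hb.
rewrite big_split /= hg lerD ?ha//; apply: le_trans (ltW hL).
by rewrite ler_piMr ?invr_ge0 ?exprn_ge0// lerBlDr lerDl invr_ge0 exprn_ge0.
Qed.

Fixpoint apx_list A n s : seq (seq bool) :=
  if n is m.+1 then apx_list A m (rcons s false) ++ apx_list A m (rcons s true)
  else if `[< meets A s >] then [:: s] else [::].

Lemma apx_list_wt A n s : \sum_(t <- apx_list A n s) wt t = wt s * apx A n s.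
Proof.
elim: n s => [|n IH] s /=.
  by case: asboolP => _; rewrite ?big_cons big_nil /= ?mulr1 ?mulr0 ?addr0.
by rewrite big_cat /= !IH !wt_rcons; lra.
Qed.

Lemma apx_list_cover A n s z : A z -> cyl s z -> exists2 t, t \in apx_list A n s & cyl t z.
Proof.
elim: n s => [|n IH] s Az sz /=.
  by rewrite asboolT; [exists s; rewrite ?mem_seq1|exists z].
have sz' : cyl (rcons s (z (size s))) z.
  by apply/cylE; rewrite size_rcons mkseqS; move/cylE: sz => ->.
have [t tin tz] := IH _ Az sz'; exists t => //.
by rewrite mem_cat; move: tin; case: (z (size s)) => ->; rewrite ?orbT.
Qed.

(** Proportion of the extensions of [s] by [n] letters that begin with [t]: the share of the
    cylinder of [t] in a finite cover. *)
Fixpoint hit (t : seq bool) n s : R :=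
  if n is m.+1 then (hit t m (rcons s false) + hit t m (rcons s true)) / 2
  else (prefix t s)%:R.

Lemma hit0 t n s : ~~ prefix t s -> ~~ prefix s t -> hit t n s = 0.
Proof.
elim: n s => [|n IH] s ts st /=; first by rewrite (negbTE ts).
have aux b : ~~ prefix t (rcons s b) && ~~ prefix (rcons s b) t.
  apply/andP; split; last first.
    by apply: contra st => /prefixP[u ->]; rewrite -cats1 -catA prefix_prefix.
  rewrite -cats1 prefixE take_cat; case: ltnP => tsz; first by rewrite -prefixE.
  apply: contra st => /eqP <-; exact: prefix_prefix.
by rewrite !IH ?addr0 ?mul0r//; [case/andP: (aux true)|case/andP: (aux true)
  |case/andP: (aux false)|case/andP: (aux false)].
Qed.

Lemma hit_le1 t n s : hit t n s <= 1.
Proof.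
elim: n s => [|n IH] s /=; first by case: prefix.
by have := IH (rcons s false); have := IH (rcons s true); lra.
Qed.

Lemma hit_le t n s : wt s * hit t n s <= wt t.
Proof.
elim: n s => [|n IH] s.
  rewrite /=; case: (boolP (prefix t s)) => [/prefixP[u ->]|_].
    by rewrite mulr1 /wt size_cat exprD invfM ler_piMr ?invr_ge0 ?exprn_ge0// invf_le1 ?exprn_ege1 ?exprn_gt0// ler1n.
  by rewrite mulr0 ltW// wt_gt0.
case: (boolP (prefix t s)) => [/prefixP[u ->]|ts].
  apply: (@le_trans _ _ (wt (t ++ u))).
    by rewrite ler_piMr ?hit_le1// ltW// wt_gt0.
  by rewrite /wt size_cat exprD invfM ler_piMr ?invr_ge0 ?exprn_ge0// invf_le1 ?exprn_ege1 ?exprn_gt0// ler1n.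
case: (boolP (prefix s t)) => [/prefixP[u tu]|st]; last first.
  by rewrite hit0// mulr0 ltW// wt_gt0.
case: u tu => [|b u] tu; first by rewrite tu cats0 prefix_refl in ts.
have nb : hit t n (rcons s (~~ b)) = 0.
  apply: hit0; rewrite tu.
    apply/negP => /prefixP[v]; rewrite -cats1 -catA => /eqP.
    by rewrite eqseq_cat// eqxx /= eqseq_cons; case: (b).
  rewrite prefixE -cat_rcons take_size_cat ?size_rcons// eqseq_rcons eqxx /=.
  by case: (b).
have := IH (rcons s b); rewrite /= wt_rcons.
by move: nb; case: (b) => /= ->; lra.
Qed.

Lemma apx_le_hit A n s (l : seq (seq bool)) :
  (forall r, size r = n -> meets A (s ++ r) -> has (fun t => prefix t (s ++ r)) l) ->
  apx A n s <= \sum_(t <- l) hit t n s.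
Proof.
elim: n s => [|n IH] s h /=.
  have hit_ge0 t : 0 <= (prefix t s)%:R :> R by exact: ler0n.
  case: asboolP => ms; last by rewrite sumr_ge0.
  have := h [::] erefl; rewrite cats0 => /(_ ms)/hasP[t tl ts].
  by rewrite (big_rem t tl) /= ts lerDl sumr_ge0.
rewrite -mulr_suml big_split /= ler_pM2r ?invr_gt0// lerD// IH// => r rn;
  rewrite cat_rcons; apply: h; by rewrite /= rn.
Qed.

Lemma apx_close A s e : 0 < e -> exists n, apx A n s < dens A s + e.
Proof.
move=> e0; have /cvgrPdist_lt/(_ e e0)[n _ hn] := @cvg_apx A s.
by exists n; have := hn n (leqnn n); rewrite ltr_distlC => /andP[].
Qed.

(** The nodes meeting [A] give covers for the upper bound. For the lower bound, compactness reduces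
    a countable cover to a finite one, whose weight is compared with [apx] at a single level through
    [hit]. *)
Lemma mu_cyl_closed A s : closed A -> mu (A `&` cyl s) = (wt s * dens A s)%:E.
Proof.
move=> cA; apply/eqP; rewrite eq_le; apply/andP; split.
  have h n : (mu (A `&` cyl s) <= (wt s * apx A n s)%:E)%E.
    rewrite -apx_list_wt; apply: mu_le_list => z [Az sz].
    exact: apx_list_cover.
  apply/lee_addgt0Pr => e e0; have [n hn] := apx_close A s e0.
  apply: le_trans (h n) _; rewrite -EFinD lee_fin.
  rewrite (@le_trans _ _ (wt s * (dens A s + e)))//.
    by rewrite ler_pM2l ?wt_gt0// ltW.
  rewrite mulrDr lerD2l ler_piMl ?(ltW e0)// /wt invf_le1 ?exprn_gt0//.
  by rewrite exprn_ege1// ler1n.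
apply: le_ereal_inf_tmp => _ [c cov <-].
(* Bounding the index by the length makes these nodes a tree; a branch would be a point of [A] in
   [cyl s] that no cylinder of the cover contains. *)
pose B t := [/\ (prefix s t || prefix t s), meets A t &
  forall i, (i < size t)%N -> ~~ prefix (c i) t].
have [n0 hn0] : exists n0, forall t, size t = n0 -> ~ B t.
  apply: contrapT => /forallNP h.
  have Bt t k : B t -> B (take k t).
    move=> [st mt ct]; split; [|exact: meets_take|].
      move: st; rewrite !prefixE => /orP[/eqP e|/eqP e]; last first.
        by rewrite size_take_min take_min e eqxx orbT.
      case: (leqP k (size s)) => ks; last by rewrite take_takel ?(ltnW ks)// e eqxx.
      have -> : take k t = take k s by rewrite -[in RHS]e take_takel.
      by rewrite [in X in _ || X]size_take_min take_min take_size eqxx orbT.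
    move=> i; rewrite size_take_min leq_min => /andP[_ /ct]; apply: contra.
    by move=> /prefixP[u hu]; rewrite -(cat_take_drop k t) hu -catA prefix_prefix.
  have [|z [Bz _]] := @konig bool false (fun=> [:: true; false]) B Bt.
    move=> n; have /existsNP[t /not_implyP[tn /contrapT Bt']] := h n.
    by exists t; split=> // i _; case: nth.
  have Az : A z by apply: meets_closed => // n; case: (Bz n).
  have sz : cyl s z.
    apply/cylE; have [+ _ _] := Bz (size s); rewrite !prefixE size_mkseq take_size.
    by rewrite take_oversize ?size_mkseq// => /orP[/eqP|/eqP].
  have [i _ ci] := cov z (conj Az sz).
  have [_ _ /(_ i)] := Bz (maxn i.+1 (size (c i))).
  rewrite size_mkseq leq_max leqnn => /(_ isT) /negP; apply.
  by apply/(@cyl_prefix _ _ (maxn i.+1 (size (c i)))) => //; rewrite leq_maxr.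
pose l := [seq c i | i <- iota 0 (n0 + size s)].
have ap : apx A n0 s <= \sum_(t <- l) hit t n0 s.
  apply: apx_le_hit => r rn ms; apply: contrapT => /negP nh.
  have Bsr : B (s ++ r).
    split=> //; first by rewrite prefix_prefix.
    move=> i; rewrite size_cat rn addnC => ni; apply: contra nh => ci.
    by apply/hasP; exists (c i) => //; apply: map_f; rewrite mem_iota.
  apply: (hn0 (take n0 (s ++ r))).
    by rewrite size_takel// size_cat rn leq_addl.
  case: Bsr => st mt ct; split; [|exact: meets_take|].
    rewrite !prefixE size_take_min take_min [take (size (s ++ r)) s]take_oversize.
      2: by rewrite size_cat leq_addr.
    case: (leqP n0 (size s)) => ns; first by rewrite [take n0 (s ++ r)]takel_cat// eqxx orbT.
    by rewrite take_takel ?(ltnW ns)// (take_size_cat _ erefl) eqxx.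
  move=> i; rewrite size_take_min leq_min => /andP[_ /ct]; apply: contra.
  by move=> /prefixP[u hu]; rewrite -(cat_take_drop n0 (s ++ r)) hu -catA prefix_prefix.
apply: (@le_trans _ _ (\sum_(t <- l) wt t)%:E).
  rewrite lee_fin; apply: (@le_trans _ _ (wt s * apx A n0 s)).
    by rewrite ler_pM2l ?wt_gt0// dens_le_apx.
  apply: (@le_trans _ _ (wt s * \sum_(t <- l) hit t n0 s)).
    by rewrite ler_pM2l ?wt_gt0.
  by rewrite mulr_sumr; apply: ler_sum => t _; exact: hit_le.
have -> : l = map c (index_iota 0 (n0 + size s)) by rewrite /index_iota subn0.
rewrite big_map -sumEFin.
by apply: nneseries_lim_ge => i _ _; rewrite lee_fin ltW// wt_gt0.
Qed.

Lemma density_toE A z r : closed A ->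
  density_to A z r <-> (fun n => dens A (mkseq z n)) @ \oo --> r.
Proof.
move=> cA; rewrite /density_to.
suff -> : (fun n => fine (mu (A `&` cyl (mkseq z n))) / fine (mu (cyl (mkseq z n)))) =
    (fun n => dens A (mkseq z n)) by [].
apply/funext => n; rewrite mu_cyl_closed// -[X in mu X]setTI mu_cyl_closed//=.
rewrite (dens_cyl (A := setT))// mulr1 mulrC mulKf// gt_eqF// wt_gt0//.
Qed.

Lemma density_toP A z r : closed A -> density_to A z r <->
  forall e, 0 < e -> exists M, forall n, (M <= n)%N -> `|dens A (mkseq z n) - r| < e.
Proof.
move=> cA; rewrite density_toE//; split=> [/cvgrPdist_lt h e /h [M _ hM]|h].
  by exists M => n /hM; rewrite distrC.
apply/cvgrPdist_lt => e /h[M hM]; exists M => // n /= /hM.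
by rewrite distrC.
Qed.

(** * The hyperspace of compact sets *)

(** Compact sets are close when their trees agree up to a level; [vcont_meets] links this with the
    Vietoris topology. *)
#[global] Program Instance ctxK : ctx Kspace := @Ctx _
  (fun n K L => forall s, (size s <= n)%N ->
     (meets (proj1_sig K) s <-> meets (proj1_sig L) s)) _ _ _ _.
Next Obligation. by []. Qed.
Next Obligation. by move=> n K L h s /h ->. Qed.
Next Obligation. by move=> n K L M h k s sn; rewrite h// k. Qed.
Next Obligation. by move=> m n K L mn h s sm; apply: h; exact: leq_trans mn. Qed.

Fixpoint words n : seq (seq bool) :=
  if n is m.+1 then [::] :: [seq true :: s | s <- words m] ++ [seq false :: s | s <- words m]
  else [:: [::]].

Lemma mem_words s n : (size s <= n)%N -> s \in words n.
Proof.
elim: n s => [|n IH] [|b s] //= sn; rewrite inE mem_cat; apply/orP; right.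
by case: b; apply/orP; [left|right]; apply: map_f; exact: IH.
Qed.

Lemma pickle_bound n : exists B, forall s : seq bool, (size s <= n)%N -> (pickle s < B)%N.
Proof.
exists (\max_(s <- words n) (pickle s).+1)%N => s /mem_words sw.
exact: (leq_bigmax_seq (F := fun s : seq bool => (pickle s).+1)).
Qed.

Lemma nbhs_all_in {Z : topologicalType} {I : eqType} (l : seq I) (Q : I -> set Z) (x : Z) :
  (forall i, i \in l -> nbhs x (Q i)) -> nbhs x [set y | forall i, i \in l -> Q i y].
Proof.
elim: l => [|i l IH] h; first by apply: filterS filterT.
have h1 := h i (mem_head _ _).
have {IH h}h2 := IH (fun j jl => h j (mem_behead (s := i :: l) jl)).
apply: filterS2 h1 h2 => y y1 y2 j; rewrite inE => /orP[/eqP ->//|].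
exact: y2.
Qed.

Lemma meets_open_cover (A U : set cantor_space) : closed A -> open U -> A `<=` U ->
  exists n, forall s, size s = n -> meets A s -> cyl s `<=` U.
Proof.
move=> cA oU AU; apply: contrapT => /forallNP h.
have [||z [Bz _]] := @konig bool false (fun=> [:: true; false])
    (fun s => meets A s /\ ~ cyl s `<=` U).
- move=> s k [ms nU]; split; first exact: meets_take.
  move=> sU; apply: nU; apply: subset_trans sU => z sz i.
  by rewrite size_take_min leq_min => /andP[ik si]; rewrite nth_take// sz.
- move=> n; have /existsNP[s /not_implyP[sn /not_implyP[ms nU]]] := h n.
  by exists s; split=> // i _; case: nth.
have Az : A z by apply: meets_closed => // n; case: (Bz n).
have [n hn] := (open_seqP _).1 oU z (AU _ Az).
by have [_] := Bz n; apply=> y /cyl_mkseq /hn.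
Qed.

(** By compactness, inclusion in an open set is seen on the finitely many nodes of one level, so
    both kinds of subbasic sets reduce to meeting or missing cylinders. *)
Lemma vcont_meets {Z : topologicalType} (f : Z -> Kspace) :
  (forall s, open [set z | meets (proj1_sig (f z)) s]) ->
  (forall s, open [set z | ~ meets (proj1_sig (f z)) s]) -> vcont f.
Proof.
move=> om onm U oU; split; last first.
  rewrite openE => z [x [Kx Ux]].
  have [n hn] := (open_seqP _).1 oU x Ux.
  have := om (mkseq x n); rewrite openE => /(_ z).
  have mz : meets (proj1_sig (f z)) (mkseq x n) by exists x; split=> //; exact/cyl_mkseq.
  move=> /(_ mz); apply: filterS => z' [y [Ky /cyl_mkseq xy]].
  by exists y; split=> //; exact: hn.
rewrite openE => z KU.
have [n hn] := meets_open_cover (@closed_Kspace (f z)) oU KU.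
pose Q s := [set z' | size s = n -> ~ cyl s `<=` U -> ~ meets (proj1_sig (f z')) s].
have : nbhs z [set z' | forall s, s \in words n -> Q s z'].
  apply: nbhs_all_in => s _.
  case: (EM (size s = n /\ ~ cyl s `<=` U)) => [[sn nU]|nsU].
    have := onm s; rewrite openE => /(_ z) h.
    have /h : ~ meets (proj1_sig (f z)) s by move/(hn _ sn).
    by apply: filterS => z' nm _ _.
  by apply: filterS filterT => z' _ sn nU; case: nsU.
apply: filterS => z' hz' x Kx.
have := hz' (mkseq x n); rewrite /Q /= mem_words ?size_mkseq// => /(_ isT erefl).
move=> hx; have : cyl (mkseq x n) `<=` U.
  by apply: contrapT => /hx; apply; exists x; split=> //; exact/cyl_mkseq.
by apply; exact/cyl_mkseq.
Qed.

(** * Coding a compact set and a sequence by one sequence *)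

Section Coding.

Let sigma j : seq bool := odflt [::] (unpickle j).

Let code (p : Kspace * N) : N :=
  sjoin (fun j => nat_of_bool `[< meets (proj1_sig p.1) (sigma j) >]) p.2.

Let code_meets (p : Kspace * N) s :
  meets (proj1_sig p.1) s <-> code p (pickle s).*2 = 1%N.
Proof.
rewrite /code -/(sleft (sjoin _ _) _) sleft_join /sigma pickleK /=.
by case: asboolP.
Qed.

Let code_snd p i : code p i.*2.+1 = p.2 i.
Proof. by rewrite /code -/(sright (sjoin _ _) i) sright_join. Qed.

Let code_eqn m : exists n, forall p q, nat_eqn n (code p) (code q) -> eqn m p q.
Proof.
have [B hB] := pickle_bound m; exists (B + m).*2 => p q pq; split.
  move=> s sm; rewrite !code_meets pq// ltn_double.
  by apply: leq_trans (hB _ sm) _; rewrite leq_addr.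
by move=> i im; rewrite -!code_snd pq//; move: im; lia.
Qed.

Let code_inj p q : code p = code q -> p = q.
Proof.
case: p q => [K y] [L z] e; have -> : K = L.
  apply: Kspace_ext => s.
  by have := code_meets (K, y) s; have := code_meets (L, z) s; rewrite /= e => -> ->.
congr pair; apply/funext => i.
by have := code_snd (K, y) i; rewrite e code_snd.
Qed.

(** A limit of trees of compact sets is again pruned: an approximant that agrees with it up to level
    [n + size s] has a point in [cyl s], hence a node of length [n] comparable with [s]; Konig's
    lemma then gives a point. *)
Let code_closed (a : N) :
  (forall n, exists p, nat_eqn n (code p) a) -> exists p, code p = a.
Proof.
move=> ha.
have a01 (s : seq bool) : a (pickle s).*2 = 1%N \/ a (pickle s).*2 = 0%N.
  have [p hp] := ha (pickle s).*2.+1.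
  rewrite -hp// /code -/(sleft (sjoin _ _) _) sleft_join.
  by case: asbool; [left|right].
pose A : set cantor_space := [set z | forall n, a (pickle (mkseq z n)).*2 = 1%N].
have cA : closed A.
  rewrite -openC openE => z /existsNP[n nz].
  apply/nbhs_seqP; exists n => z' /cyl_mkseq/cylE; rewrite size_mkseq => zz' /(_ n).
  by rewrite zz'.
have mA s : meets A s <-> a (pickle s).*2 = 1%N.
  split=> [[z [Az /cylE <-]]|as1]; first exact: Az.
  have [||z [Bz _]] := @konig bool false (fun=> [:: true; false])
    (fun t => (prefix s t || prefix t s) /\ forall k, a (pickle (take k t)).*2 = 1%N).
  - move=> t k [st ht]; split; last by move=> l; rewrite -take_min.
    move: st; rewrite !prefixE => /orP[/eqP e|/eqP e]; last first.
      by rewrite size_take_min take_min e eqxx orbT.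
    case: (leqP k (size s)) => ks; last by rewrite take_takel ?(ltnW ks)// e eqxx.
    have -> : take k t = take k s by rewrite -[in RHS]e take_takel.
    by rewrite [in X in _ || X]size_take_min take_min take_size eqxx orbT.
  - move=> n; have [B hB] := pickle_bound (n + size s).
    have [p hp] := ha B.*2.
    have hps t : (size t <= n + size s)%N ->
        meets (proj1_sig p.1) t <-> a (pickle t).*2 = 1%N.
      by move=> ts; rewrite code_meets hp// ltn_double; exact: hB.
    have [z [Kz sz]] := (hps s (leq_addl _ _)).2 as1.
    exists (mkseq z n); split; [exact: size_mkseq| |by move=> i _; case: nth].
    split.
      have pm l m : prefix (mkseq z l) (mkseq z m) || prefix (mkseq z m) (mkseq z l).
        rewrite !prefixE !size_mkseq !take_mkseq.
        by case: (leqP l m) => _; rewrite eqxx ?orbT.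
      by have := pm (size s) n; rewrite ((cylE _ _).1 sz).
    move=> k; apply/hps; last by exists z; split=> //; rewrite take_mkseq; exact/cyl_mkseq.
    by rewrite take_mkseq size_mkseq; apply: leq_trans (geq_minr _ _) (leq_addr _ _).
  exists z; split.
    by move=> n; have [_ /(_ n)] := Bz n; rewrite take_oversize// size_mkseq.
  apply/cylE; have [+ _] := Bz (size s); rewrite !prefixE size_mkseq take_size.
  by rewrite take_oversize ?size_mkseq// => /orP[/eqP|/eqP].
exists (exist _ A ((compact_closedK A).2 cA), sright a).
rewrite -[RHS]sjoinK /code /=; congr sjoin; apply/funext => j.
have -> : sleft a j = a (pickle (sigma j)).*2.
  have [p hp] := ha (j.*2 + (pickle (sigma j)).*2).+1.
  have h1 := hp j.*2; have h2 := hp (pickle (sigma j)).*2.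
  rewrite /sleft -h1 ?ltnS ?leq_addr// -h2 ?ltnS ?leq_addl//.
  rewrite /code -/(sleft (sjoin _ _) _) -/(sleft (sjoin _ _) (pickle _)) !sleft_join.
  by rewrite {2}/sigma pickleK.
case: asboolP => [/mA->//|nm]; case: (a01 (sigma j)) => [/mA//|->//].
Qed.

(* The code of the closed relation is a closed set of sequences, hence a
   retract of the Baire space: a sequence which is not the code of a pair is
   sent to a pair chosen for its longest extendible initial segment. *)
Lemma S11_SigmaK (P : Kspace -> Prop) : S11 P -> SigmaK [set K | P K].
Proof.
move=> [phi cphi hP]; pose F (p : Kspace * N) := witness phi p.1 p.2.
case: (EM (exists p, F p)) => [[p0 Fp0]|nF]; last first.
  left; apply/seteqP; split=> // K /hP[y hy].
  by apply: nF; exists (K, y).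
pose ext (s : seq nat) p := F p /\ mkseq (code p) (size s) = s.
have extE a n p : ext (mkseq a n) p <-> F p /\ nat_eqn n (code p) a.
  by rewrite /ext size_mkseq; split=> -[Fp /mkseq_eqn].
have /choice[g hg] : forall s, exists p, F p /\ ((exists q, ext s q) -> ext s p).
  move=> s; case: (EM (exists q, ext s q)) => [[q sq]|nq]; last by exists p0.
  by exists q; split=> //; case: sq.
pose extn a n := exists q, ext (mkseq a n) q.
have ext0 a : extn a 0%N by exists p0; apply/extE.
have extle a m n : (m <= n)%N -> extn a n -> extn a m.
  move=> mn [q /extE[Fq qa]]; exists q; apply/extE; split=> //.
  exact: (@eqn_le _ ctxN) mn qa.
have Fclosed a : (forall n, extn a n) -> exists2 p, F p & code p = a.
  move=> ha; have [n|p pa] := @code_closed a.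
    by have [q /extE[_ qa]] := ha n; exists q.
  exists p => // i; have [m hm] := cphi i p; have [n hn] := code_eqn m.
  have [q /extE[Fq]] := ha n; rewrite -pa => qp.
  apply/(hm q); last exact: Fq.
  by apply: hn; exact: (@eqn_sym _ ctxN).
have /choice[h hh] : forall a, exists p, F p /\
    ((forall n, extn a n) -> code p = a) /\
    (forall n, extn a n -> ~ extn a n.+1 -> p = g (mkseq a n)).
  move=> a; case: (EM (forall n, extn a n)) => [ea|nea].
    by have [p Fp pa] := Fclosed a ea; exists p; split=> //; split=> // n _ /(_ (ea _)).
  have /least_nat[m [nm lm]] : exists n, ~ extn a n by exact/existsNP.
  case: m nm lm => [/(_ (ext0 a))//|m] nm lm.
  exists (g (mkseq a m)); split; first by case: (hg (mkseq a m)).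
  split=> [/(_ m.+1)//|n en nen].
  congr (g (mkseq a _)); apply/eqP; rewrite eqn_leq; apply/andP; split.
    by rewrite leqNgt; apply/negP => nm'; exact: (nen (contrapT (lm n.+1 nm'))).
  by rewrite leqNgt; apply/negP => mn; apply: nm; exact: extle en.
have agr a n : extn a n -> nat_eqn n (code (h a)) a.
  move=> en; have [Fh [h1 h2]] := hh a.
  case: (EM (forall n, extn a n)) => [/h1 -> //|nea].
  have /least_nat[m [nm lm]] : exists n, ~ extn a n by exact/existsNP.
  case: m nm lm => [/(_ (ext0 a))//|m] nm lm.
  have em : extn a m := contrapT (lm _ (ltnSn m)).
  have nlm : (n <= m)%N by rewrite leqNgt; apply/negP => mn; apply: nm; exact: extle en.
  rewrite (h2 m em nm); have [_ /(_ em)/extE[_]] := hg (mkseq a m).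
  exact: (@eqn_le _ ctxN).
right; exists (fun a => (h a).1); split; last first.
  apply/seteqP; split=> [K /hP[y hy]|_ [a _ <-]].
    exists (code (K, y)) => //.
    have [_ [/(_ _)/code_inj -> //]] := hh (code (K, y)).
    by move=> n; exists (K, y); apply/extE.
  by apply/hP; exists (h a).2; case: (hh a).
(* At a code, continuity comes from the agreement [agr] of [h a] with [a]. Elsewhere the last
   extendible segment depends on finitely many coordinates, so [h] is locally constant. *)
have key s (a : N) : exists n, forall a', nat_eqn n a a' ->
    (meets (proj1_sig (h a').1) s <-> meets (proj1_sig (h a).1) s).
  case: (EM (forall n, extn a n)) => [ea|nea].
    exists (pickle s).*2.+1 => a' aa'; rewrite !code_meets.
    have e' : extn a' (pickle s).*2.+1.
      by rewrite /extn -((@mkseq_eqn _ _ _).2 aa'); exact: ea.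
    by rewrite (agr _ _ e')// (agr _ _ (ea (pickle s).*2.+1))// aa'.
  have /least_nat[m [nm lm]] : exists n, ~ extn a n by exact/existsNP.
  case: m nm lm => [/(_ (ext0 a))//|m] nm lm.
  exists m.+1 => a' aa'.
  have aam : mkseq a m = mkseq a' m.
    by apply/mkseq_eqn; apply: (@eqn_le _ ctxN) aa'.
  have em : extn a m := contrapT (lm _ (ltnSn m)).
  have em' : extn a' m by rewrite /extn -aam.
  have nm' : ~ extn a' m.+1 by rewrite /extn -((@mkseq_eqn _ _ _).2 aa').
  have [_ [_ h1]] := hh a; have [_ [_ h2]] := hh a'.
  by rewrite (h1 m em nm) (h2 m em' nm') aam.
apply: vcont_meets => s; apply/open_seqP => a ma; have [n hn] := key s a; exists n => a' aa'.
  by apply/hn => // i /aa' ->.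
by rewrite /= hn// => i /aa' ->.
Qed.

End Coding.

Lemma PiK_S11 (P : Kspace -> Prop) : S11 (fun K => ~ P K) -> PiK [set K | P K].
Proof. exact: S11_SigmaK. Qed.

Lemma D2SigmaK_S11 (P Q : Kspace -> Prop) : S11 P -> S11 (fun K => ~ Q K) ->
  D2SigmaK [set K | P K /\ Q K].
Proof.
move=> SP SQ; exists [set K | P K], [set K | Q K]; split; first exact: S11_SigmaK.
by split=> //; exact: PiK_S11.
Qed.

(** * Arithmetical definitions of sharp and blurry points *)

(** Every nonzero letter counts as the digit 1, so that binary expansions are defined on the whole
    of [N]. *)
Definition digit (v : N) i : R := (v i != 0%N)%:R.

Fixpoint partial (v : N) n : R :=
  if n is m.+1 then partial v m + digit v m * 2 ^- m.+1 else 0.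

Definition val (v : N) : R := limn (partial v).

Lemma exp2S n : (2 : R) ^- n = 2 ^- n.+1 + 2 ^- n.+1.
Proof. by rewrite exprS invfM; lra. Qed.

Lemma exp2_ge0 n : 0 <= (2 : R) ^- n.
Proof. by rewrite invr_ge0 exprn_ge0. Qed.

Lemma exp2_gt0 n : 0 < (2 : R) ^- n.
Proof. by rewrite invr_gt0 exprn_gt0. Qed.

Lemma digit_bounds v i : 0 <= digit v i <= 1.
Proof. by rewrite /digit; case: (_ != _); rewrite ?lexx ler01. Qed.

Lemma partial_bounds v n m : partial v n <= partial v (n + m) <= partial v n + 2 ^- n - 2 ^- (n + m).
Proof.
elim: m => [|m IH]; first by rewrite addn0 lexx addrK lexx.
rewrite addnS /=; move: IH; rewrite [2 ^- (n + m)]exp2S.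
have := digit_bounds v (n + m); have := exp2_ge0 (n + m).+1.
move: (2 ^- (n + m).+1) (digit v (n + m)) => x d x0 /andP[d0 d1] /andP[h1 h2].
have dx : 0 <= d * x by rewrite mulr_ge0.
have dx1 : d * x <= x by rewrite ler_piMl.
by lra.
Qed.

Lemma cvg_partial v : partial v @ \oo --> val v.
Proof.
apply: nondecreasing_is_cvgn.
  apply/nondecreasing_seqP => n; have := partial_bounds v n 1.
  by rewrite addn1 => /andP[].
exists 1 => _ [n _ <-]; have := partial_bounds v 0 n; rewrite /= add0n expr0 invr1.
by have := exp2_ge0 n; lra.
Qed.

Lemma val_partial v n : `|val v - partial v n| <= 2 ^- n.
Proof.
have h1 : partial v n <= val v.
  apply: limr_ge; first exact: cvg_partial.
  exists n => // m nm /=; have := partial_bounds v n (m - n).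
  by rewrite subnKC// => /andP[].
have h2 : val v <= partial v n + 2 ^- n.
  apply: limr_le; first exact: cvg_partial.
  exists n => // m nm /=; have := partial_bounds v n (m - n).
  by rewrite subnKC//; have := exp2_ge0 m; lra.
by rewrite ger0_norm; lra.
Qed.

Lemma val_uniq v (r : R) : (forall n, `|r - partial v n| <= 2 ^- n) -> val v = r.
Proof.
move=> h; apply/eqP/negPn/negP => ne.
have [n hn] : exists n, 2 ^- n < `|val v - r| / 2 by apply: exp2_small; rewrite divr_gt0// normr_gt0 subr_eq0.
have := h n; have := val_partial v n.
move: hn; rewrite !ler_norml !ltr_pdivlMr// => hn /andP[h1 h2] /andP[h3 h4].
by move: hn; apply/negP; rewrite -leNgt ler_norml; apply/andP; split; lra.
Qed.

Lemma val_bounds v : 0 <= val v <= 1.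
Proof.
have := val_partial v 0; rewrite expr0 invr1 /= subr0 ler_norml => /andP[_ ->].
rewrite andbT; apply: limr_ge; first exact: cvg_partial.
by apply: nearW => n; have := partial_bounds v 0 n; rewrite add0n => /andP[].
Qed.

Lemma partial_eqn n v v' : nat_eqn n v v' -> partial v n = partial v' n.
Proof.
elim: n => //= n IH vv'; rewrite (IH (@eqn_le _ ctxN _ _ _ _ (leqnSn n) vv')).
by rewrite /digit vv'.
Qed.

Lemma nfun_partial n : nfun (fun v : N => partial v n).
Proof. by move=> v; exists n => v' /partial_eqn. Qed.

Lemma val_eqn n v v' : nat_eqn n v v' -> `|val v - val v'| <= 2 ^- n + 2 ^- n.
Proof.
move=> /partial_eqn e; have := val_partial v n; have := val_partial v' n.
rewrite e !ler_norml => /andP[h1 h2] /andP[h3 h4].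
by apply/andP; split; lra.
Qed.

Lemma separating_val : separating val.
Proof.
move=> u u' ne; have [n hn] : exists n, 2 ^- n < `|val u - val u'| / 4.
  by apply: exp2_small; rewrite divr_gt0// normr_gt0 subr_eq0; apply/eqP.
exists n => v v' /val_eqn + /val_eqn + e; rewrite e.
rewrite !ler_norml => /andP[h1 h2] /andP[h3 h4].
move: hn; rewrite ltr_pdivlMr//; apply/negP; rewrite -leNgt.
by rewrite ler_norml; apply/andP; split; lra.
Qed.

(** Greedy expansion: [rem] iterates the doubling map and [v] records when it overflows. *)
Lemma val_surj (r : R) : 0 <= r <= 1 -> exists v : N, val v = r.
Proof.
move=> r01; pose step (x : R) : R := if 1 <= 2 * x then 2 * x - 1 else 2 * x.
pose rem i := iter i step r.
pose v i : nat := nat_of_bool (1 <= 2 * rem i).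
have rem01 i : 0 <= rem i <= 1.
  elim: i => [|i /andP[h1 h2]]; first exact: r01.
  have -> : rem i.+1 = step (rem i) by [].
  rewrite /step; case: (leP 1 (2 * rem i)) => h.
    by apply/andP; split; lra.
  by apply/andP; split; lra.
have pr n : r = partial v n + 2 ^- n * rem n.
  elim: n => [|n IH]; first by rewrite /= expr0 invr1 mul1r add0r.
  have -> : rem n.+1 = step (rem n) by [].
  rewrite {1}IH [2 ^- n]exp2S /= /digit /v /step.
  by case: (leP 1 (2 * rem n)) => _ /=; lra.
exists v; apply: val_uniq => n; rewrite {1}(pr n) addrAC subrr add0r.
have /andP[h1 h2] := rem01 n.
by rewrite ger0_norm ?mulr_ge0 ?exp2_ge0// ler_piMr// exp2_ge0.
Qed.

Definition cz (u : N) : cantor_space := fun i => u i != 0%N.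

(** [cz] forgets which nonzero letter was used; the letters 0 and 1 restore one sequence per point,
    as counting requires. *)
Definition bin (u : N) := forall i, (u i <= 1)%N.

Definition nz (z : cantor_space) : N := fun i => nat_of_bool (z i).

Lemma czK z : cz (nz z) = z.
Proof. by apply/funext => i; rewrite /cz /nz; case: (z i). Qed.

Lemma bin_nz z : bin (nz z).
Proof. by move=> i; rewrite /nz; case: (z i). Qed.

Lemma cz_inj u u' : bin u -> bin u' -> cz u = cz u' -> u = u'.
Proof.
move=> bu bu' e; apply/funext => i; have := congr1 (fun f => f i) e; rewrite /cz.
by move: (bu i) (bu' i); case: (u i) => [|[|]]//; case: (u' i) => [|[|]].
Qed.

Lemma separating_cz : separating cz.
Proof.
move=> u u' ne; have [i hi] : exists i, cz u i <> cz u' i.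
  by apply: contra_notP ne => /forallNP h; apply/funext => i; exact: contrapT (h i).
exists i.+1 => v v' uv uv' e; apply: hi; have := congr1 (fun f => f i) e.
by rewrite /cz uv// uv'.
Qed.

Definition Kset (K : Kspace) : set cantor_space := proj1_sig K.

Lemma apx_eqn n (K L : Kspace) m s : eqn m K L -> (n + size s <= m)%N ->
  apx (Kset K) n s = apx (Kset L) n s.
Proof.
move=> KL; elim: n s => [|n IH] s nm /=.
  by congr (_ %:R); rewrite (propext (KL s nm)).
by rewrite !IH// size_rcons; rewrite addSn in nm; rewrite addnS.
Qed.

Lemma density_bounds (A : set cantor_space) z r : closed A -> density_to A z r -> 0 <= r <= 1.
Proof.
move=> cA /(density_toP _ _ cA) h; apply/andP; split; rewrite leNgt; apply/negP => lt.
  have [|M /(_ _ (leqnn M))] := h (- r); first by rewrite oppr_gt0.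
  have := dens_ge0 A (mkseq z M); rewrite ltr_norml => ? /andP[_].
  by lra.
have [|M /(_ _ (leqnn M))] := h (r - 1); first by rewrite subr_gt0.
have := dens_le1 A (mkseq z M); rewrite ltr_norml => ? /andP[+ _].
by lra.
Qed.

Lemma dyadic_cauchy (u : nat -> R) (c : nat -> R) :
  (forall k, exists M, forall n, (M <= n)%N -> `|u n - c k| <= 2 ^- k) ->
  exists r, forall e, 0 < e -> exists M, forall n, (M <= n)%N -> `|u n - r| < e.
Proof.
move=> h; pose S := [set x | exists M, forall n, (M <= n)%N -> x <= u n].
have cS k : S (c k - 2 ^- k).
  by have [M hM] := h k; exists M => n /hM; rewrite ler_norml => /andP[? _]; lra.
have Sc k x : S x -> x <= c k + 2 ^- k.
  move=> [M hM]; have [M' hM'] := h k.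
  have := hM _ (leq_maxl M M'); have := hM' _ (leq_maxr M M').
  by rewrite ler_norml => /andP[_ ?] ?; lra.
have S0 : S !=set0 by exists (c 0%N - 2 ^- 0).
have Sb : has_sup S by split=> //; exists (c 0%N + 2 ^- 0) => x; exact: Sc.
exists (sup S) => e e0.
have [k hk] : exists k, 2 ^- k < e / 3 by apply: exp2_small; rewrite divr_gt0.
have [M hM] := h k; exists M => n /hM.
have h1 : c k - 2 ^- k <= sup S by apply: ub_le_sup (cS k); case: Sb.
have h2 : sup S <= c k + 2 ^- k by apply: ge_sup => // x; exact: Sc.
move: hk; rewrite ltr_pdivlMr// ler_norml ltr_norml => hk /andP[h3 h4].
by apply/andP; split; lra.
Qed.

(** * Borel complexity of statements about densities *)

Section Definability.
Context {X : Type} {cX : ctx X}.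

Lemma nfun_apply {V W : Type} (f : X -> V) (g : V -> X -> W) :
  nfun f -> (forall v, nfun (g v)) -> nfun (fun x => g (f x) x).
Proof.
move=> cf cg x; have [n hn] := cf x; have [m hm] := cg (f x) x.
exists (maxn n m) => x' h; rewrite hn; last by apply: eqn_le h; rewrite leq_maxl.
by apply: hm; apply: eqn_le h; rewrite leq_maxr.
Qed.

Lemma nfun_apx (K : X -> Kspace) (u : X -> N) m n : cfun K -> cfun u ->
  nfun (fun x => apx (Kset (K x)) m (mkseq (cz (u x)) n)).
Proof.
move=> cK cu.
apply: (@nfun_apply _ _ (fun x => mkseq (cz (u x)) n)
  (fun s x => apx (Kset (K x)) m s)).
  move=> x; have [p hp] := cu x n; exists p => x' /hp uu'.
  by apply/eq_in_map => i; rewrite mem_iota add0n /cz => /uu' ->.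
move=> s; apply: (@nfun_cfun _ _ _ _ _ (fun L => apx (Kset L) m s) _ _ cK) => L.
by exists (m + size s)%N => L' LL'; apply/esym; apply: apx_eqn LL' _.
Qed.

Section Predicates.
Variables (K : X -> Kspace) (u : X -> N).
Hypotheses (cK : cfun K) (cu : cfun u).

Let d x n := dens (Kset (K x)) (mkseq (cz (u x)) n).

(** [dens] is the infimum of the numbers [apx], each of which depends on finitely many nodes and
    coordinates. *)
Lemma Bor_dens_ge (r : X -> R) n : nfun r -> Bor (fun x => r x <= d x n).
Proof.
move=> cr; have : Bor (fun x => forall m, r x <= apx (Kset (K x)) m (mkseq (cz (u x)) n)).
  apply: Bor_all => m; apply: cpred_Bor.
  apply: (@nfun_cpred _ _ _
    (fun x => r x <= apx (Kset (K x)) m (mkseq (cz (u x)) n)) is_true).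
  exact: (nfun_comp2 (fun a b => a <= b) cr (nfun_apx m n cK cu)).
apply: Bor_ext => x; split=> [h|h m]; last exact: le_trans h (dens_le_apx _ _ _).
rewrite leNgt; apply/negP => lt; have [m] := apx_close (Kset (K x)) (mkseq (cz (u x)) n)
  (e := r x - d x n) (ltac:(by rewrite subr_gt0)).
by rewrite addrC subrK ltNge h.
Qed.

Lemma Bor_dens_le (r : X -> R) n : nfun r -> Bor (fun x => d x n <= r x).
Proof.
move=> cr; have : Bor (fun x => ~ exists j, r x + 2 ^- j <= d x n).
  apply/BorN/Bor_exn => j; apply: Bor_dens_ge.
  exact: (nfun_comp (fun v => v + 2 ^- j) cr).
apply: Bor_ext => x; split=> [h|h [j]]; last first.
  by move=> /le_trans/(_ h); have := exp2_gt0 j; lra.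
rewrite leNgt; apply/negP => lt; apply: h.
have [j hj] : exists j, 2 ^- j < d x n - r x by apply: exp2_small; rewrite subr_gt0.
by exists j; lra.
Qed.

Lemma Bor_if {Y : Type} {cY : ctx Y} (b : Prop) (P : Y -> Prop) :
  Bor P -> Bor (fun y => b -> P y).
Proof. by apply: Bor_imp; apply: cpred_Bor; exact: cpred_cst. Qed.

Lemma Bor_dist (r : X -> R) n e : nfun r -> Bor (fun x => `|d x n - r x| <= e).
Proof.
move=> cr; have : Bor (fun x => r x - e <= d x n /\ d x n <= r x + e).
  apply: Bor_and; [apply: Bor_dens_ge|apply: Bor_dens_le].
    exact: (nfun_comp (fun v => v - e) cr).
  exact: (nfun_comp (fun v => v + e) cr).
apply: Bor_ext => x; rewrite ler_distl; split=> [[h1 h2]|/andP[h1 h2]]; last by split.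
by apply/andP; split.
Qed.

Definition tends (r : X -> R) x := density_to (Kset (K x)) (cz (u x)) (r x).

Lemma tendsP r x : tends r x <->
  forall e, 0 < e -> exists M, forall n, (M <= n)%N -> `|d x n - r x| < e.
Proof. by apply: density_toP; exact: closed_Kspace. Qed.

(* [q x k] is any approximation of [r x] with error [2^-k] depending on
   finitely many coordinates. *)
Lemma Bor_tends (r : X -> R) (q : nat -> X -> R) :
  (forall k, nfun (q k)) -> (forall k x, `|r x - q k x| <= 2 ^- k) ->
  Bor (tends r).
Proof.
move=> cq rq; have : Bor (fun x => forall k, exists M, forall n, (M <= n)%N ->
    `|d x n - q k x| <= 2 ^- k + 2 ^- k).
  apply: Bor_all => k; apply: Bor_exn => M; apply: Bor_all => n; apply: Bor_if.
  exact: Bor_dist.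
apply: Bor_ext => x; rewrite tendsP; split=> [h e e0|h k].
  have [k hk] : exists k, 2 ^- k < e / 3 by apply: exp2_small; rewrite divr_gt0.
  have [M hM] := h k; exists M => n /hM; have := rq k x.
  move: hk; rewrite ltr_pdivlMr// !ler_norml !ltr_norml => hk /andP[h1 h2] /andP[h3 h4].
  by apply/andP; split; lra.
have [M hM] := h _ (exp2_gt0 k); exists M => n /hM; have := rq k x.
rewrite !ler_norml !ltr_norml => /andP[h1 h2] /andP[h3 h4].
by apply/andP; split; lra.
Qed.

(** The quantifier over the real limit is removed: convergence means that for each [k] the densities
    are eventually within [2 ^- k] of a fixed multiple of [2 ^- k]. Natural numerators suffice
    because densities are nonnegative. *)
Lemma Bor_blur : Bor (fun x => Blur (Kset (K x)) (cz (u x))).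
Proof.
have : Bor (fun x => ~ forall k, exists i M, forall n, (M <= n)%N ->
    `|d x n - i%:R * 2 ^- k| <= 2 ^- k).
  apply/BorN/Bor_all => k; apply: Bor_exn => i; apply: Bor_exn => M.
  by apply: Bor_all => n; apply: Bor_if; apply: Bor_dist; exact: nfun_cst.
apply: Bor_ext => x; rewrite /Blur /=; split; apply: contra_not.
  move=> [r hr] k; have {hr}h : tends (fun=> r) x by [].
  have /andP[r0 _] := density_bounds (@closed_Kspace (K x)) h.
  have rk0 : 0 <= r * 2 ^+ k by rewrite mulr_ge0// exprn_ge0.
  have /andP[t1 t2] := truncn_itv rk0.
  move: t1 t2; set t := Num.truncn _ => t1 t2; exists t.
  have h3 : t%:R * 2 ^- k <= r by rewrite ler_pdivrMr// exprn_gt0.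
  have h4 : r < t%:R * 2 ^- k + 2 ^- k.
    by rewrite -[X in _ + X]mul1r -mulrDl -(natrD _ t 1) addn1 ltr_pdivlMr// exprn_gt0.
  have e0 : 0 < t%:R * 2 ^- k + 2 ^- k - r by rewrite subr_gt0.
  have [M hM] := (tendsP _ _).1 h _ e0.
  exists M => n /hM; rewrite ltr_norml ler_norml => /andP[h1 h2].
  by apply/andP; split; lra.
move=> h; have [c hc] := choice h.
have [r hr] := dyadic_cauchy (u := d x) (c := fun k => (c k)%:R * 2 ^- k) hc.
by exists r; exact/tendsP.
Qed.

(** Once the limit exists, it is strictly between 0 and 1 iff the densities eventually keep a
    distance [2 ^- j] from both ends. *)
Lemma Bor_sharp : Bor (fun x => Sharp (Kset (K x)) (cz (u x))).
Proof.
have : Bor (fun x => ~ Blur (Kset (K x)) (cz (u x)) /\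
    exists j M, forall n, (M <= n)%N -> 2 ^- j <= d x n /\ d x n <= 1 - 2 ^- j).
  apply: Bor_and; first exact/BorN/Bor_blur.
  apply: Bor_exn => j; apply: Bor_exn => M; apply: Bor_all => n; apply: Bor_if.
  by apply: Bor_and; [apply: Bor_dens_ge|apply: Bor_dens_le]; exact: nfun_cst.
apply: Bor_ext => x; split=> [[/contrapT[r hr] [j [M h]]]|[r [hr /andP[r0 r1]]]].
  exists r; split=> //; have tr := (tendsP (fun=> r) x).1 hr.
  have [M' hM'] := tr _ (exp2_gt0 j.+1).
  have [h1 h2] := h _ (leq_maxl M M'); have := hM' _ (leq_maxr M M').
  have := exp2S j; have := exp2_gt0 j.+1.
  rewrite ltr_norml => h3 h4 /andP[h5 h6].
  by apply/andP; split; lra.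
split; first by move=> nr; apply: nr; exists r.
have [j1 hj1] := exp2_small r0.
have [j2 hj2] : exists j, 2 ^- j < 1 - r by apply: exp2_small; rewrite subr_gt0.
pose j := maxn j1 j2.
have le1 : (2 : R) ^- j <= 2 ^- j1 by rewrite lef_pV2 ?posrE ?exprn_gt0// ler_eXn2l ?ltr1n// leq_maxl.
have le2 : (2 : R) ^- j <= 2 ^- j2 by rewrite lef_pV2 ?posrE ?exprn_gt0// ler_eXn2l ?ltr1n// leq_maxr.
have [e [e0 e1 e2]] : exists e : R, [/\ 0 < e, e <= r - 2 ^- j & e <= 1 - r - 2 ^- j].
  exists (Num.min (r - 2 ^- j) (1 - r - 2 ^- j)); split.
  - by rewrite lt_min; apply/andP; split; lra.
  - by rewrite ge_min lexx.
  - by rewrite ge_min lexx orbT.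
have [M hM] := (tendsP (fun=> r) x).1 hr e e0.
exists j, M => n /hM; rewrite ltr_norml => /andP[h1 h2].
by split; lra.
Qed.

End Predicates.

End Definability.

(** * Measure and category quantifiers *)

Section Quantifiers.
Context {X : Type} {cX : ctx X}.

Lemma Bor_val_gt (v : X -> N) c : cfun v -> Bor (fun x => c < val (v x)).
Proof.
move=> cv; have : Bor (fun x => exists n, c < partial (v x) n - 2 ^- n).
  apply: Bor_exn => n; apply: cpred_Bor.
  apply: (@nfun_cpred _ _ _ (fun x => partial (v x) n) (fun r => c < r - 2 ^- n)).
  exact: (nfun_cfun (nfun_partial _) cv).
apply: Bor_ext => x; split=> [[n hn]|h].
  by have := val_partial (v x) n; rewrite ler_norml => /andP[? _]; lra.
have [n hn] : exists n, 2 ^- n < (val (v x) - c) / 2.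
  by apply: exp2_small; rewrite divr_gt0// subr_gt0.
exists n; have := val_partial (v x) n.
by move: hn; rewrite ltr_pdivlMr// ler_norml => ? /andP[_ ?]; lra.
Qed.

Lemma Bor_val_lt (v : X -> N) c : cfun v -> Bor (fun x => val (v x) < c).
Proof.
move=> cv; have : Bor (fun x => exists n, partial (v x) n + 2 ^- n < c).
  apply: Bor_exn => n; apply: cpred_Bor.
  apply: (@nfun_cpred _ _ _ (fun x => partial (v x) n) (fun r => r + 2 ^- n < c)).
  exact: (nfun_cfun (nfun_partial _) cv).
apply: Bor_ext => x; split=> [[n hn]|h].
  by have := val_partial (v x) n; rewrite ler_norml => /andP[_ ?]; lra.
have [n hn] : exists n, 2 ^- n < (c - val (v x)) / 2.
  by apply: exp2_small; rewrite divr_gt0// subr_gt0.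
exists n; have := val_partial (v x) n.
by move: hn; rewrite ltr_pdivlMr// ler_norml => ? /andP[? _]; lra.
Qed.

Definition ritv (i : rat * rat) : set R := [set r | ratr i.1 < r < ratr i.2].

Lemma Bor_val_ritv (v : X -> N) i : cfun v -> Bor (fun x => ritv i (val (v x))).
Proof.
move=> cv; have := Bor_and (Bor_val_gt (ratr i.1) cv) (Bor_val_lt (ratr i.2) cv).
by apply: Bor_ext => x; split=> [[h1 h2]|/andP[]//]; apply/andP.
Qed.

Lemma S11_imp_cst {Y : Type} {cY : ctx Y} (b : Prop) (P : Y -> Prop) :
  S11 P -> S11 (fun y => b -> P y).
Proof.
case: (EM b) => hb SP; first by apply: S11_ext SP => y; split=> [//|/(_ hb)].
by apply: S11_ext (cpred_S11 (cpred_cst True)) => y.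
Qed.

End Quantifiers.

(** Branches produced by [section_tree] interleave a point of the section with its witness; only the
    point carries the value. *)
Definition lval (y : N) : R := val (sleft y).

Lemma lval_eqn n y y' : nat_eqn n.*2 y y' -> `|lval y - lval y'| <= 2 ^- n + 2 ^- n.
Proof. by move=> yy'; apply: val_eqn => i ni; apply: yy'; rewrite ltn_double. Qed.

Lemma lval_cont (U : set R) y : open U -> U (lval y) ->
  exists n, forall y', nat_eqn n y y' -> U (lval y').
Proof.
move=> oU Uy; have /nbhs_ballP[e /= e0 he] := open_nbhs_nbhs (conj oU Uy).
have [n hn] : exists n, 2 ^- n < e / 2 by apply: exp2_small; rewrite divr_gt0.
exists n.*2 => y' /lval_eqn h; apply: he; rewrite /ball /=.
by apply: le_lt_trans h _; move: hn; rewrite ltr_pdivlMr//; lra.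
Qed.

Lemma open_between (a b : R) : open [set r : R | a < r < b].
Proof.
have -> : [set r : R | a < r < b] = [set r | r > a] `&` [set r | r < b].
  by apply/seteqP; split=> r /=; [move=> /andP[]|move=> [-> ->]].
by apply: openI; [exact: open_gt|exact: open_lt].
Qed.

Lemma open_ritv i : open (ritv i).
Proof. exact: open_between. Qed.

Lemma ritv_dense (a b : R) : a < b -> exists p, a < ratr p < b.
Proof. by move=> /rat_in_itvoo[p]; rewrite inE /= => /itvP h; exists p; rewrite !h. Qed.

Lemma ritv_base (U : set R) r : open U -> U r -> exists i, ritv i r /\ ritv i `<=` U.
Proof.
move=> oU Ur; have /nbhs_ballP[e /= e0 he] := open_nbhs_nbhs (conj oU Ur).
have [p /andP[p1 p2]] := @ritv_dense (r - e) r (ltac:(by rewrite ltrBlDr ltrDl)).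
have [q /andP[q1 q2]] := @ritv_dense r (r + e) (ltac:(by rewrite ltrDl)).
exists (p, q); split; first by rewrite /ritv /= p2 q1.
move=> s /andP[/= ps sq]; apply: he; rewrite /ball /= ltr_norml; apply/andP; split; lra.
Qed.

(** ** Category *)

Lemma sub_meager (A B : set R) : A `<=` B -> meager_R B -> meager_R A.
Proof. by move=> AB [F [hF BF]]; exists F; split=> //; exact: subset_trans BF. Qed.

Lemma meager_bigcup {C : countType} (A : C -> set R) :
  (forall c, meager_R (A c)) -> meager_R (\bigcup_c A c).
Proof.
move=> h; have /choice[F hF] : forall n, exists F : nat -> set R,
    (forall k, nowhere_dense_R (F k)) /\
    forall c, @unpickle C n = Some c -> A c `<=` \bigcup_k F k.
  move=> n; case: (unpickle n) => [c|].
    by have [F [h1 h2]] := h c; exists F; split=> // _ [<-].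
  exists (fun=> set0); split=> // k.
  by rewrite /nowhere_dense_R closure0 interior0.
exists (fun n => F (Cantor.of_nat n).1 (Cantor.of_nat n).2); split=> [k|r [c _ Ac]].
  by have [] := hF (Cantor.of_nat k).1.
have [_ /(_ c (pickleK c) _ Ac)[k _ Fk]] := hF (pickle c).
by exists (Cantor.to_nat (pickle c, k)) => //; rewrite Cantor.cancel_of_to.
Qed.

Lemma nowhere_dense_avoid (F : set R) (a b : R) : nowhere_dense_R F -> a < b ->
  forall e : R, 0 < e -> exists p q : rat,
    [/\ a <= ratr p, ratr p < ratr q :> R, ratr q <= b, ratr q - ratr p < e &
    forall r, ratr p <= r <= ratr q -> ~ F r].
Proof.
move=> ndF ab e e0.
have [r [ar rb nr]] : exists r, [/\ a < r, r < b & ~ closure F r].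
  apply: contrapT => h; have : [set r : R | a < r < b] `<=` closure F.
    move=> r /andP[ar rb]; apply: contrapT => nr.
    by apply: h; exists r.
  rewrite (open_subsetE _ (@open_between a b)) ndF.
  by move=> /(_ ((a + b) / 2)); apply; apply/andP; split; lra.
have oC : open (~` closure F) by rewrite openC; exact: closed_closure.
have /nbhs_ballP[d /= d0 hd] := open_nbhs_nbhs (conj oC nr).
pose c := Num.min (Num.min (r - a) (b - r)) (Num.min d (e / 2)).
have c0 : 0 < c by rewrite !lt_min !subr_gt0 ar rb d0 divr_gt0.
have [ca cb cd ce] : [/\ c <= r - a, c <= b - r, c <= d & c <= e / 2].
  by rewrite /c; split; rewrite !ge_min lexx ?orbT.
have [p /andP[p1 p2]] := @ritv_dense (r - c) r (ltac:(by rewrite ltrBlDr ltrDl)).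
have [q /andP[q1 q2]] := @ritv_dense r (r + c) (ltac:(by rewrite ltrDl)).
exists p, q; split; [lra|lra|lra|lra|].
move=> s /andP[ps sq] Fs; apply: (hd s); last exact: subset_closure.
rewrite /ball /= ltr_norml; apply/andP; split; lra.
Qed.

Definition big_on (A : set R) (i : rat * rat) := (i.1 < i.2)%R /\
  forall j : rat * rat, i.1 <= j.1 -> (j.1 < j.2)%R -> j.2 <= i.2 ->
    ~ meager_R (A `&` ritv j).

(** Banach's category argument: if no interval is big, the rational intervals in which [A] is meager
    have a dense open union [O]. Then [A] is meager inside [O] and nowhere dense outside. *)
Lemma nonmeager_big_on (A : set R) : ~ meager_R A -> exists i, big_on A i.
Proof.
move=> nA; apply: contrapT => /forallNP h; apply: nA.
pose B (i : rat * rat) := [set r | meager_R (A `&` ritv i) /\ ritv i r].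
pose O := \bigcup_i B i.
have ndO : nowhere_dense_R (~` O).
  rewrite /nowhere_dense_R -(closure_id _).1; last first.
    rewrite closedC; apply: bigcup_open => i _.
    case: (EM (meager_R (A `&` ritv i))) => mi.
      rewrite (_ : B i = ritv i); first exact: open_ritv.
      by apply/seteqP; split=> r; [case|].
    by rewrite (_ : B i = set0); [exact: open0|apply/seteqP; split=> r // []].
  apply/seteqP; split=> // r; rewrite /interior => /nbhs_ballP[e /= e0 he].
  have [p /andP[p1 p2]] := @ritv_dense (r - e) r (ltac:(by rewrite ltrBlDr ltrDl)).
  have [q /andP[q1 q2]] := @ritv_dense r (r + e) (ltac:(by rewrite ltrDl)).
  have pq : p < q by rewrite -(ltr_rat R); lra.
  have /not_andP[//|/existsNP[[p' q'] /not_implyP[/= pp' /not_implyP[/= pq']]]] := h (p, q).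
  move=> /not_implyP[qq' /contrapT mA].
  have lt' : ratr p' < ratr q' :> R by rewrite ltr_rat.
  have [s /andP[s1 s2]] := ritv_dense lt'.
  have sB : ritv (p', q') (ratr s) by rewrite /ritv /= s1 s2.
  have := he (ratr s); rewrite /ball /= ltr_norml; apply; last by exists (p', q').
  by move: pp' qq'; rewrite -(ler_rat R) -(ler_rat R) => ? ?; apply/andP; split; lra.
apply: (@sub_meager _ (\bigcup_(o : option (rat * rat))
    if o is Some i then A `&` B i else ~` O)).
  move=> r Ar; case: (EM (O r)) => [[i _ Bi]|nO]; last by exists None.
  by exists (Some i).
apply: meager_bigcup => -[i|].
  case: (EM (meager_R (A `&` ritv i))) => mi.
    by apply: sub_meager mi => r [Ar [_ ?]].
  by exists (fun=> set0); split=> [k|r [_ []//]]; rewrite /nowhere_dense_R closure0 interior0.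
by exists (fun=> ~` O); split=> // r nO; exists 0%N.
Qed.

Section CategoryQuantifier.
Variable T : seq nat -> Prop.
Hypothesis tT : tree T.

Definition through s : set N := branch T `&` [set y | mkseq y (size s) = s].

(** A strategy in a Banach-Mazur game: to any rational subinterval it answers with a smaller one and
    one more letter of a branch. As a relation on a countable set it can be guessed by a single
    sequence. *)
Definition scheme (W : (rat * rat) * seq nat -> Prop) :=
  [/\ exists2 i : rat * rat, i.1 < i.2 & W (i, [::]),
      forall i s, W (i, s) -> forall j : rat * rat,
        i.1 <= j.1 -> j.1 < j.2 -> j.2 <= i.2 -> exists (k : rat * rat) (n : nat),
        [/\ j.1 <= k.1, k.1 < k.2, k.2 <= j.2 & W (k, rcons s n)] &
      forall i s, W (i, s) -> exists2 y, through s y & ritv i (lval y)].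

(** At stage [k] the opponent plays an interval whose closure misses [F k]. The letters form a
    branch whose value lies in all the closed intervals, hence in no [F k]. *)
Lemma scheme_nonmeager W : scheme W -> ~ meager_R (lval @` branch T).
Proof.
move=> [[i0 i0lt Wi0] Wb Wc] [F [ndF AF]].
pose ok (p : (rat * rat) * seq nat) := W p /\ p.1.1 < p.1.2.
have step k p : exists q, ok p -> [/\ ok q, p.1.1 <= q.1.1, q.1.2 <= p.1.2,
    take (size p.2) q.2 = p.2 /\ size q.2 = (size p.2).+1 &
    forall r : R, ratr q.1.1 <= r <= ratr q.1.2 -> ~ F k r].
  case: (EM (ok p)) => [|nok]; last by exists p.
  case: p => [i s] [/= Wis ilt]; have ilt' : ratr i.1 < ratr i.2 :> R by rewrite ltr_rat.
  have [p [q [ip pq qi _ hF]]] := nowhere_dense_avoid (ndF k) ilt' ltr01.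
  rewrite !ler_rat ltr_rat in ip pq qi.
  have [j [n [h1 h2 h3 Wj]]] := Wb i s Wis (p, q) ip pq qi.
  exists (j, rcons s n) => _; split=> /=.
  - by split.
  - exact: le_trans h1.
  - exact: le_trans h3 qi.
  - by rewrite -cats1 take_size_cat// size_cat addn1.
  - move=> r /andP[r1 r2]; apply: hF; apply/andP; split.
      by apply: le_trans r1; rewrite ler_rat.
    by apply: le_trans r2 _; rewrite ler_rat.
have /choice[f hf] := fun kp : nat * ((rat * rat) * seq nat) => step kp.1 kp.2.
pose S := fix S i := if i is i.+1 then f (i, S i) else (i0, [::]).
have okS k : ok (S k).
  by elim: k => [|k IH]; [split|case: (hf (k, S k) IH)].
have hS k := hf (k, S k) (okS k).
have szS k : size (S k).2 = k by elim: k => // k IH; case: (hS k) => _ _ _ [_ ->] _; rewrite /= IH.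
have [y hy] := @fusion (fun k => (S k).2) (fun k => ltac:(by rewrite !szS))
  (fun k => let: And5 _ _ _ h _ := hS k in h.1).
have nest k m : (k <= m)%N -> (S k).1.1 <= (S m).1.1 /\ (S m).1.2 <= (S k).1.2.
  move=> /subnK <-; elim: (m - k)%N => [//|d [h1 h2]]; rewrite addSn.
  by have [_ h3 h4 _ _] := hS (d + k)%N; split; [exact: le_trans h3|exact: le_trans h2].
have Ty : branch T y.
  move=> k; have [z [Tz zk] _] := Wc _ _ (ltac:(by case: (S k) (okS k) => ? ? []) : W ((S k).1, (S k).2)).
  by have := hy k; rewrite szS => ->; rewrite -zk szS; exact: Tz.
have inS k : ratr (S k).1.1 <= lval y <= ratr (S k).1.2.
  have close e : 0 < e -> exists z, [/\ ratr (S k).1.1 < lval z, lval z < ratr (S k).1.2 &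
      `|lval y - lval z| < e].
    move=> e0; have [n hn] : exists n, 2 ^- n < e / 2 by apply: exp2_small; rewrite divr_gt0.
    pose m := (k + n.*2)%N.
    have [z [Tz zm] /andP[z1 z2]] := Wc _ _ (ltac:(by case: (S m) (okS m) => ? ? []) : W ((S m).1, (S m).2)).
    have [n1 n2] := nest k m (leq_addr _ _); exists z; split.
    - by apply: le_lt_trans z1; rewrite ler_rat.
    - by apply: lt_le_trans z2 _; rewrite ler_rat.
    - apply: le_lt_trans (_ : _ <= 2 ^- n + 2 ^- n) _.
        apply: lval_eqn; apply: (@eqn_le _ ctxN _ m); first exact: leq_addl.
        by apply/mkseq_eqn; have := hy m; rewrite szS => ->; rewrite -zm szS.
      by move: hn; rewrite ltr_pdivlMr//; lra.
  apply/andP; split; rewrite leNgt; apply/negP => lt.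
    have [|z [z1 _]] := close (ratr (S k).1.1 - lval y); first by rewrite subr_gt0.
    by rewrite ltr_norml => /andP[]; lra.
  have [|z [_ z2]] := close (lval y - ratr (S k).1.2); first by rewrite subr_gt0.
  by rewrite ltr_norml => /andP[]; lra.
have [|k _ Fk] := AF (lval y); first by exists y.
by have [_ _ _ _ /(_ (lval y) (inS k.+1))] := hS k.
Qed.

Lemma nonmeager_scheme : ~ meager_R (lval @` branch T) ->
  scheme (fun p => big_on (lval @` through p.2) p.1).
Proof.
move=> nm; split=> /=.
- have [|i hi] := @nonmeager_big_on (lval @` through [::]).
    by apply: contra_not nm; apply: sub_meager => _ [y Ty <-]; exists y.
  by exists i => //; case: hi.
- move=> i s [ilt hs] j ij jj ji.
  have [n hn] : exists n, ~ meager_R (lval @` through (rcons s n) `&` ritv j).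
    apply: contrapT => /forallNP h; apply: (hs j ij jj ji).
    apply: (@sub_meager _ (\bigcup_n (lval @` through (rcons s n) `&` ritv j))).
      move=> _ [[y [Ty ys] <-] jy]; exists (y (size s)) => //; split=> //.
      exists y => //; split=> //=; rewrite size_rcons mkseqS_rcons.
      by congr rcons.
    by apply: meager_bigcup => n; exact: contrapT (h n).
  have [k [klt hk]] := nonmeager_big_on hn.
  have [r [[_ /andP[r1 r2]] /andP[r3 r4]]] :
      ((lval @` through (rcons s n) `&` ritv j) `&` ritv k) !=set0.
    apply: contrapT => h; apply: (hk k) => //.
    by exists (fun=> set0); split=> [m|r hr]; [rewrite /nowhere_dense_R closure0 interior0|case: h; exists r].
  (* [k] need not lie inside [j]; the common point [r], which exists because the set is not meager
     in [k], makes their intersection a genuine interval. *)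
  exists (Num.max j.1 k.1, Num.min j.2 k.2), n; split=> /=.
  - by rewrite le_max lexx.
  - rewrite lt_min !gt_max jj klt /= andbT -!(ltr_rat R).
    by rewrite (lt_trans r3 r2) (lt_trans r1 r4).
  - by rewrite ge_min lexx.
  split=> [|l /=].
    rewrite /= lt_min !gt_max jj klt /= andbT -!(ltr_rat R).
    by rewrite (lt_trans r3 r2) (lt_trans r1 r4).
  rewrite ge_max le_min => /andP[jl kl] ll /andP[lj lk] ml; apply: (hk l) => //.
  by apply: sub_meager ml => q [[Aq _] lq].
- move=> i s [ilt hs]; apply: contrapT => h; apply: (hs i) => //.
  exists (fun=> set0); split=> [m|r [[y Ty yr] ir]].
    by rewrite /nowhere_dense_R closure0 interior0.
  by case: h; exists y => //; rewrite yr.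
Qed.

End CategoryQuantifier.

Section CategoryComplexity.
Context {X : Type} {cX : ctx X}.

Lemma S11_through (T : X -> seq nat -> Prop) (Q : N -> Prop) s : cpred_tree T ->
  S11 Q -> S11 (fun x => exists2 y, through (T x) s y & Q y).
Proof.
move=> cT SQ; have : S11 (fun x => exists y, (branch (T x) y /\ mkseq y (size s) = s) /\ Q y).
  apply: (@S11_exN _ _ (fun p => (branch (T p.1) p.2 /\ mkseq p.2 (size s) = s) /\ Q p.2)).
  apply: S11_and; last exact: (S11_comp cfun_snd SQ).
  apply: S11_and; first by apply: S11_all => n; apply: cpred_S11; exact: cpred_nodeN.
  apply: cpred_S11.
  apply: (@nfun_cpred _ _ _ (fun p : X * N => mkseq p.2 (size s)) (fun v => v = s)).
  exact: (nfun_cfun (nfun_mkseq _) cfun_snd).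
by apply: S11_ext => x; split=> [[y [Ty Qy]]|[y Ty Qy]]; exists y.
Qed.

Lemma S11_nonmeager (P : X * N -> Prop) : S11 P ->
  S11 (fun x => ~ meager_R (section val P x)).
Proof.
move=> /section_tree[T [cT tT hT]].
pose W (w : N) (p : (rat * rat) * seq nat) := w (pickle p) <> 0%N.
have cW p : cpred (fun q : X * N => W q.2 p).
  apply: (@nfun_cpred _ _ _ (fun q : X * N => q.2 (pickle p)) (fun v => v <> 0%N)).
  exact: (nfun_cfun (nfun_coord _) cfun_snd).
have : S11 (fun x => exists w, scheme (T x) (W w)).
  apply: (@S11_exN _ _ (fun p => scheme (T p.1) (W p.2))).
  have : S11 (fun q : X * N =>
      (exists i : rat * rat, i.1 < i.2 /\ W q.2 (i, [::])) /\
      ((forall i s, ~ W q.2 (i, s) \/ forall j : rat * rat,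
        i.1 <= j.1 /\ (j.1 < j.2 /\ j.2 <= i.2) -> exists k : rat * rat, exists n : nat,
          (j.1 <= k.1 /\ (k.1 < k.2 /\ k.2 <= j.2)) /\ W q.2 (k, rcons s n)) /\
      (forall i s, ~ W q.2 (i, s) \/
        exists2 y, through (T q.1) s y & ritv i (lval y)))).
    apply: S11_and; last apply: S11_and.
    - apply: S11_ex_seq => i; apply: S11_and; last exact: cpred_S11.
      exact/cpred_S11/cpred_cst.
    - apply: S11_all_seq => i; apply: S11_all_seq => s; apply: S11_or.
        exact/cpred_S11/cpredN.
      apply: S11_all_seq => j; apply: S11_imp_cst.
      apply: S11_ex_seq => k; apply: S11_exn => n; apply: S11_and; last exact: cpred_S11.
      exact/cpred_S11/cpred_cst.
    - apply: S11_all_seq => i; apply: S11_all_seq => s; apply: S11_or.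
        exact/cpred_S11/cpredN.
      apply: (S11_comp (P := fun x => exists2 y, through (T x) s y & ritv i (lval y)) cfun_fst).
      apply: S11_through => //; apply: Bor_S11; apply: Bor_val_ritv.
      exact: cfun_reindex.
  apply: S11_ext => q; split=> [[[i [ilt Wi]] [h2 h3]]|[[i ilt Wi] h2 h3]].
    split; first by exists i.
      move=> i' s Wi' j h4 h5 h6; have [//|/(_ j)[//|k [n [[h7 [h8 h9]] h10]]]] := h2 i' s.
      by exists k, n.
    by move=> i' s Wi'; have [] := h3 i' s.
  split; first by exists i.
  split=> i' s; case: (EM (W q.2 (i', s))) => Wi'; [right|by left|right|by left].
    move=> j [h4 [h5 h6]]; have [k [n [h7 h8 h9 h10]]] := h2 i' s Wi' j h4 h5 h6.
    by exists k, n.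
  exact: h3.
apply: S11_ext => x; rewrite (section_branch val (hT x)).
split=> [[w /scheme_nonmeager]|/nonmeager_scheme h]; first exact.
pose w c := if @unpickle ((rat * rat) * seq nat)%type c is Some p then
  nat_of_bool `[< big_on (lval @` through (T x) p.2) p.1 >] else 0%N.
exists w; have -> : W w = fun p => big_on (lval @` through (T x) p.2) p.1.
  by apply/funext => p; apply/propext; rewrite /W /w pickleK; case: asboolP.
exact: h.
Qed.

End CategoryComplexity.

(** ** Measure *)

Local Notation lam := (@lebesgue_measure R).

Lemma le_lam (A B : set R) : A `<=` B -> (lam A <= lam B)%E.
Proof. by move=> AB; exact: (@le_mu_ext _ _ _ (@wlength R idfun) A B AB). Qed.

(** Analytic sets are treated through outer measure. The measurable hulls [G n] need not increase;
    [H n], the intersection of the later ones, does, and it lies between [E n] and [G n]. *)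
Lemma lam_cont_below (E : nat -> set R) (b : R) :
  (forall n, E n `<=` E n.+1) -> (b%:E < lam (\bigcup_n E n))%E ->
  exists n, (b%:E < lam (E n))%E.
Proof.
move=> Ein bE; apply: contrapT => /forallNP h.
have {}h n : (lam (E n) <= b%:E)%E by rewrite leNgt; apply/negP; exact: h.
have /choice[G hG] : forall n, exists G : set (measurableTypeR R),
    [/\ measurable G, E n `<=` G & lam G = lam (E n)].
  move=> n; have [G [oG EG GE]] := outer_measure_Gdelta (E n).
  exists (\bigcap_i G i); split=> //; apply: bigcapT_measurable => i.
  exact: measurable_realfun.open_measurable.
pose H n := \bigcap_(m in [set m | (n <= m)%N]) G m.
have mH n : measurable (H n).
  by apply: bigcap_measurable => [|m _]; [exists n => /=|case: (hG m)].
have EE n m : (n <= m)%N -> E n `<=` E m.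
  move=> /subnK <-; elim: (m - n)%N => [//|d IH]; rewrite addSn.
  exact: subset_trans (Ein _).
have EH n : E n `<=` H n by move=> r Er m /= nm; case: (hG m) => _ + _; apply; exact: EE Er.
have Hb n : (lam (H n) <= b%:E)%E.
  apply: le_trans (h n); have [_ _ <-] := hG n; apply: le_lam => r; apply => /=.
  exact: leqnn.
have Hnd : nondecreasing_seq H.
  by move=> n m nm; apply/subsetPset => r Hr k /= mk; apply: Hr => /=; exact: leq_trans mk.
have cv := @nondecreasing_cvg_mu _ _ R lam H mH (bigcupT_measurable H mH) Hnd.
move: bE; apply/negP; rewrite -leNgt; apply: (@le_trans _ _ (lam (\bigcup_n H n))).
  by apply: le_lam => r [n _ /EH]; exists n.
rewrite -(cvg_lim _ cv)//.
apply: lime_le; last by apply: nearW.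
by apply/cvg_ex; eexists; exact: cv.
Qed.

Section MeasureQuantifier.
Variable T : seq nat -> Prop.
Hypothesis tT : tree T.

Definition below (alpha : N) : set N := branch T `&` [set y | forall i, (y i <= alpha i)%N].

Definition below_upto (alpha : N) k : set N :=
  branch T `&` [set y | forall i, (i < k)%N -> (y i <= alpha i)%N].

Definition rcover (l : seq (rat * rat)) : set R := [set r | exists2 i, i \in l & ritv i r].

Lemma open_rcover l : open (rcover l).
Proof.
rewrite (_ : rcover l = \bigcup_(i in [set` l]) ritv i).
  by apply: bigcup_open => i _; exact: open_ritv.
by apply/seteqP; split=> r [i il ir]; exists i.
Qed.

(** The values of the branches bounded by [alpha] form a compact set, for which measure at least [b]
    can be tested on finite unions of rational intervals. *)
Definition large (b : R) (alpha : N) := forall l, (lam (rcover l) < b%:E)%E ->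
  exists2 y, below alpha y & ~ rcover l (lval y).

Lemma below_konig (B : seq nat -> Prop) alpha :
  (forall s k, B s -> B (take k s)) ->
  (forall n, exists2 y, B (mkseq y n) & forall i, (i < n)%N -> (y i <= alpha i)%N) ->
  exists2 y, (forall n, B (mkseq y n)) & forall i, (y i <= alpha i)%N.
Proof.
move=> tB h; have [||y [By ya]] := @konig nat 0%N (fun i => iota 0 (alpha i).+1) B.
- exact: tB.
- move=> n; have [y By ya] := h n; exists (mkseq y n); split; [exact: size_mkseq|exact: By|].
  by move=> i ni; rewrite nth_mkseq// mem_iota add0n ltnS ya.
by exists y => // i; have := ya i; rewrite mem_iota add0n ltnS.
Qed.

(** An open superset of measure below [b] is exhausted by the finite unions [l n]. Each leaves some
    value uncovered, and compactness yields a value outside all of them, that is, outside the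
    superset. *)
Lemma large_measure (a b : R) alpha : a < b -> large b alpha ->
  (a%:E < lam (lval @` branch T))%E.
Proof.
move=> ab lb; rewrite ltNge; apply/negP => le.
have ba0 : 0 < (b - a) / 2 by rewrite divr_gt0// subr_gt0.
have [U [oU AU Ule]] := outer_measure_open_le (lval @` branch T) ba0.
have Ub : (lam U < b%:E)%E.
  apply: le_lt_trans Ule _; apply: (@le_lt_trans _ _ (a%:E + ((b - a) / 2)%:E)%E).
    by rewrite leeD2r.
  by rewrite -EFinD lte_fin; lra.
pose l n := [seq i <- pmap (@unpickle (rat * rat)%type) (iota 0 n) | `[< ritv i `<=` U >]].
have lU n : (lam (rcover (l n)) < b%:E)%E.
  apply: le_lt_trans Ub; apply: le_lam => r [i].
  by rewrite mem_filter => /andP[/asboolP iU _]; exact: iU.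
have ll n m i : (n <= m)%N -> i \in l n -> i \in l m.
  move=> nm; rewrite !mem_filter => /andP[-> /=]; rewrite !mem_pmap => /mapP[k kn ->].
  by apply/mapP; exists k => //; move: kn; rewrite !mem_iota !add0n => /leq_trans; apply.
pose B s := exists y, [/\ branch T y, mkseq y (size s) = s & ~ rcover (l (size s)) (lval y)].
have [||y By ya] := @below_konig B alpha.
- move=> s k [y [Ty ys ny]]; exists y; split=> //.
    by rewrite size_take_min -[in RHS]ys take_mkseq.
  move=> [i il ir]; apply: ny; exists i => //; apply: ll il.
  by rewrite size_take_min geq_minr.
- move=> n; have [y [Ty ya] ny] := lb _ (lU n); exists y => //.
  by exists y; rewrite size_mkseq.
have Ty : branch T y.
  by move=> n; have [z [Tz <- _]] := By n; exact: Tz.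
have Uy : U (lval y) by apply: AU; exists y.
have [i [iy iU]] := ritv_base oU Uy.
have [n hn] := lval_cont (@open_ritv i) iy.
have [z [Tz]] := By (maxn n (pickle i).+1); rewrite size_mkseq => /mkseq_eqn zy; apply.
exists i; last by apply: hn; apply: (@eqn_sym _ ctxN); apply: (@eqn_le _ ctxN) zy; rewrite leq_maxl.
rewrite mem_filter asboolT//= mem_pmap; apply/mapP; exists (pickle i); last by rewrite pickleK.
by rewrite mem_iota add0n leq_max ltnSn orbT.
Qed.

(** The bounds of the coordinates are chosen one after the other, continuity from below keeping the
    outer measure above [b]; compactness carries the conclusion to the limit. *)
Lemma measure_large (b : R) : (b%:E < lam (lval @` branch T))%E ->
  exists alpha, large b alpha.
Proof.
move=> bA.
have step k (alpha : N) : exists n, (b%:E < lam (lval @` below_upto alpha k))%E ->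
    (b%:E < lam (lval @` below_upto (fun i => if i == k then n else alpha i) k.+1))%E.
  case: (EM (b%:E < lam (lval @` below_upto alpha k))%E) => [h|]; last by exists 0%N.
  pose E n := lval @` below_upto (fun i => if i == k then n else alpha i) k.+1.
  have [||n hn] := @lam_cont_below E b; last by exists n.
    move=> n _ [y [Ty ya] <-]; exists y => //; split=> // i ik.
    by have := ya i ik; case: eqP => // _ /leqW.
  apply: lt_le_trans h _; apply: le_lam => _ [y [Ty ya] <-].
  exists (y k) => //; exists y => //; split=> // i; rewrite ltnS leq_eqVlt.
  by case: eqP => [-> //|_ /=]; exact: ya.
have /choice[f hf] := fun ka : nat * N => step ka.1 ka.2.
pose S := fix S k : N := if k is k.+1 then
  fun i => if i == k then f (k, S k) else S k i else fun=> 0%N.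
have hS k : (b%:E < lam (lval @` below_upto (S k) k))%E.
  elim: k => [|k IH]; last exact: hf (k, S k) IH.
  by apply: lt_le_trans bA _; apply: le_lam => _ [y Ty <-]; exists y.
have Sst k i : (i < k)%N -> S k i = S i.+1 i.
  elim: k => // k IH; rewrite ltnS leq_eqVlt => /orP[/eqP -> //|ik].
  by rewrite -(IH ik) /= ltn_eqF.
exists (fun i => S i.+1 i) => l lb.
pose B s := exists y, [/\ branch T y, mkseq y (size s) = s & ~ rcover l (lval y)].
have [||y By ya] := @below_konig B (fun i => S i.+1 i).
- move=> s k [y [Ty ys ny]]; exists y; split=> //.
  by rewrite size_take_min -[in RHS]ys take_mkseq.
- move=> n; have [y [Ty ya] ny] : exists2 y, below_upto (S n) n y & ~ rcover l (lval y).
    apply: contrapT => h; move: (hS n); apply/negP; rewrite -leNgt; apply: ltW.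
    apply: le_lt_trans lb; apply: le_lam => _ [y hy <-]; apply: contrapT => ny.
    by apply: h; exists y.
  exists y; first by exists y; rewrite size_mkseq.
  by move=> i ni; rewrite -(Sst n i ni); exact: ya.
exists y.
  by split=> //= n; have [z [Tz <- _]] := By n; exact: Tz.
move=> ly; have [n hn] := lval_cont (@open_rcover l) ly.
have [z [_]] := By n; rewrite size_mkseq => /mkseq_eqn zy; apply.
by apply: hn; exact: (@eqn_sym _ ctxN).
Qed.

End MeasureQuantifier.

Section MeasureComplexity.
Context {X : Type} {cX : ctx X}.

Lemma S11_measure_gt (P : X * N -> Prop) (a : R) : S11 P ->
  S11 (fun x => (a%:E < lam (section val P x))%E).
Proof.
move=> /section_tree[T [cT tT hT]].
(* The slack [2 ^- j] replaces the strict inequality by the condition [large], whose failure for a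
   given list is excluded by exhibiting one branch. *)
have : S11 (fun x => exists j, exists alpha, large (T x) (a + 2 ^- j) alpha).
  apply: S11_exn => j; apply: (@S11_exN _ _ (fun p => large (T p.1) (a + 2 ^- j) p.2)).
  apply: S11_all_seq => l; apply: S11_imp_cst.
  have : S11 (fun p : X * N => exists y, (branch (T p.1) y /\
      (forall i, (y i <= p.2 i)%N)) /\ forall i, i \in l -> ~ ritv i (lval y)).
    apply: (@S11_exN _ _ (fun q => (branch (T q.1.1) q.2 /\
      (forall i, (q.2 i <= q.1.2 i)%N)) /\ forall i, i \in l -> ~ ritv i (lval q.2))).
    apply: S11_and; first apply: S11_and.
    - apply: S11_all => n; apply: cpred_S11.
      exact: (@cpred_comp _ _ _ _ _ (fun q : X * N * N => (q.1.1, q.2))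
        (cpred_nodeN n cT) (cfun_pair (cfun_comp cfun_fst cfun_fst) cfun_snd)).
    - apply: S11_all => i; apply: cpred_S11.
      apply: (@nfun_cpred _ _ _ (fun q : X * N * N => (q.2 i, q.1.2 i)) (fun v => (v.1 <= v.2)%N)).
      apply: nfun_comp2; first exact: (nfun_cfun (nfun_coord _) cfun_snd).
      exact: (nfun_cfun (nfun_coord _) (cfun_comp cfun_snd cfun_fst)).
    - apply: S11_all_seq => i; apply: S11_imp_cst; apply/Bor_S11/BorN/Bor_val_ritv.
      exact: (cfun_comp (cfun_reindex _) cfun_snd).
  apply: S11_ext => p; split=> [[y [[Ty ya] ny]]|[y [Ty ya] ny]].
    by exists y => // -[i il ir]; exact: ny il ir.
  by exists y; split=> // i il ir; apply: ny; exists i.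
apply: S11_ext => x; rewrite (section_branch val (hT x)).
split=> [[j [alpha]]|h].
  by apply: large_measure => //; rewrite ltrDl exp2_gt0.
have [b ab bA] : exists2 b : R, a < b & (b%:E < lam ((val \o sleft) @` branch (T x)))%E.
  move: h; case: (lam _) => [r|_|//].
    rewrite lte_fin => ar; exists ((a + r) / 2); rewrite ?lte_fin; lra.
  by exists (a + 1); [rewrite ltrDl|exact: ltry].
have [j hj] : exists j, 2 ^- j < b - a by apply: exp2_small; rewrite subr_gt0.
exists j; apply: measure_large; apply: le_lt_trans bA.
by rewrite lee_fin; lra.
Qed.

End MeasureComplexity.

(** * Upper bounds *)

Section CardComplexity.
Context {X : Type} {cX : ctx X} {V : Type}.
Variable D : X -> set V.
Hypothesis geqD : forall n, S11 (fun x => (`I_n #<= D x)%card).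

Lemma S11_not_card_le n : S11 (fun x => ~ (D x #<= `I_n)%card).
Proof.
apply: S11_ext (geqD n.+1) => x; split=> [g /not_geq_le /negP|h]; first exact.
by apply: contrapT => /negP/not_geq_le.
Qed.

Lemma S11_not_finite : S11 (fun x => ~ finite_set (D x)).
Proof.
apply: S11_ext (S11_all geqD) => x; rewrite finite_set_not_geq; split=> [h [n /negP]|h n].
  exact.
by apply: contrapT => /negP ng; apply: h; exists n.
Qed.

End CardComplexity.

Lemma card_bin (A : set cantor_space) : (A #= [set u | A (cz u) /\ bin u])%card.
Proof.
have {1}-> : A = cz @` [set u | A (cz u) /\ bin u].
  apply/seteqP; split=> [z Az|_ [u [Au _] <-]//].
  by exists (nz z); rewrite ?czK//=; split; [rewrite czK|exact: bin_nz].
by apply: inj_card_eq => u v /set_mem[_ bu] /set_mem[_ bv]; exact: cz_inj.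
Qed.

Lemma card_eq_transl {T U V : Type} (A : set T) (B : set U) (C : set V) :
  (A #= B)%card -> (A #= C)%card = (B #= C)%card.
Proof.
by move=> AB; rewrite !card_eq_le (card_le_eql AB) (card_le_eqr AB).
Qed.

Lemma Bor_bin {X : Type} {cX : ctx X} (u : X -> N) : cfun u -> Bor (fun x => bin (u x)).
Proof.
move=> cu; apply: Bor_all => i; apply: cpred_Bor.
apply: (@nfun_cpred _ _ _ (fun x => u x i) (fun k => (k <= 1)%N)).
exact: (nfun_cfun (nfun_coord _) cu).
Qed.

Lemma S11_all_countable {X : Type} {cX : ctx X} {V : Type} (D : set V) (P : V -> X -> Prop) :
  countable D -> (forall r, D r -> S11 (P r)) -> S11 (fun x => forall r, D r -> P r x).
Proof.
move=> /countable_injP[e einj] h.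
have : S11 (fun x => forall n, forall r, D r -> e r = n -> P r x).
  apply: S11_all => n; case: (EM (exists2 r, D r & e r = n)) => [[r Dr en]|nr].
    apply: S11_ext (h r Dr) => x; split=> [Pr r' Dr' en'|]; last exact.
    by have -> : r' = r by apply: einj; rewrite ?inE// en en'.
  apply: S11_ext (cpred_S11 (cpred_cst True)) => x; split=> // _ r Dr en.
  by case: nr; exists r.
by apply: S11_ext => x; split=> [hx r Dr|hx n r Dr _]; [exact: hx Dr erefl|exact: hx].
Qed.

(** * Cardinality classes of sharp and of blurry points *)

Section PointClasses.
Variable C : set cantor_space -> set cantor_space.
Hypothesis BorC : forall (X : Type) (cX : ctx X) (K : X -> Kspace) (u : X -> N),
  cfun K -> cfun u -> Bor (fun x => C (Kset (K x)) (cz (u x))).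

Let P (p : Kspace * N) := C (Kset p.1) (cz p.2) /\ bin p.2.

Let UP : U11 P.
Proof.
have [] : Bor P; last by [].
by apply: Bor_and; [exact: BorC cfun_fst cfun_snd|exact: Bor_bin cfun_snd].
Qed.

Let card_C K : (C (Kset K) #= fiber P K)%card.
Proof. exact: card_bin. Qed.

Lemma point_geq n : S11 (fun K => (`I_n #<= C (Kset K))%card).
Proof.
apply: S11_ext (S11_geq n separating_id (U11_S11 UP)) => K.
by rewrite section_id (card_le_eqr (card_C K)).
Qed.

Lemma PiK_point_eq n : PiK (KC (fun A => (C A #= `I_n)%card)).
Proof.
apply: PiK_S11; apply: S11_ext (S11_not_card_eq n UP) => K.
by rewrite (card_eq_transl _ (card_C K)).
Qed.

Lemma PiK_point_le n : PiK (KC (fun A => (C A #<= `I_n)%card)).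
Proof. exact/PiK_S11/(S11_not_card_le point_geq). Qed.

Lemma PiK_point_finite : PiK (KC (fun A => finite_set (C A))).
Proof. exact/PiK_S11/(S11_not_finite point_geq). Qed.

Lemma PiK_point_countable : PiK (KC (fun A => countable (C A))).
Proof.
apply: PiK_S11; apply: S11_ext (S11_uncountable separating_id (U11_S11 UP)) => K.
by rewrite section_id /countable (card_le_eql (card_C K)).
Qed.

Lemma PiK_point_nat : PiK (KC (fun A => (C A #= [set: nat])%card)).
Proof.
apply: PiK_S11; apply: S11_ext (S11_not_card_nat UP) => K.
by rewrite (card_eq_transl _ (card_C K)).
Qed.

Lemma S11_point_nonempty : S11 (fun K => ~ C (Kset K) = set0).
Proof.
have : S11 (fun K => exists u, P (K, u)) by apply: S11_exN; exact: U11_S11.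
apply: S11_ext => K; split=> [[u [Cu _]] e|]; first by rewrite e in Cu.
move/eqP/set0P => [z Cz]; exists (nz z); split=> /=; first by rewrite czK.
exact: bin_nz.
Qed.

End PointClasses.

(** * Classes defined by the range of the density *)

Section Ranges.

Definition rngP (p : Kspace * N) := exists u, density_to (Kset p.1) (cz u) (val p.2).

Lemma Bor_tends_val {X : Type} {cX : ctx X} (K : X -> Kspace) (u v : X -> N) :
  cfun K -> cfun u -> cfun v ->
  Bor (fun x => density_to (Kset (K x)) (cz (u x)) (val (v x))).
Proof.
move=> cK cu cv; apply: (Bor_tends cK cu (r := fun x => val (v x))
  (q := fun k x => partial (v x) k)) => [k|k x]; last exact: val_partial.
exact: (nfun_cfun (nfun_partial _) cv).
Qed.

Lemma Bor_tends_cst {X : Type} {cX : ctx X} (K : X -> Kspace) (u : X -> N) (r : R) :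
  cfun K -> cfun u -> Bor (fun x => density_to (Kset (K x)) (cz (u x)) r).
Proof.
move=> cK cu; apply: (Bor_tends cK cu (r := fun x => r) (q := fun k x => r)) => [k|k x].
  exact: nfun_cst.
by rewrite subrr normr0 exp2_ge0.
Qed.

Lemma S11_rngP : S11 rngP.
Proof.
apply: (@S11_exN _ _ (fun q : Kspace * N * N => density_to (Kset q.1.1) (cz q.2) (val q.1.2))).
apply: Bor_S11; apply: (@Bor_tends_val _ _ (fun q : Kspace * N * N => q.1.1)
  (fun q => q.2) (fun q => q.1.2)).
- exact: (cfun_comp cfun_fst cfun_fst).
- exact: cfun_snd.
- exact: (cfun_comp cfun_snd cfun_fst).
Qed.

Lemma section_rngP K : section val rngP K = ranD (Kset K).
Proof.
apply/seteqP; split=> [_ [v [u hu] <-]|r [z hz]]; first by exists (cz u).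
have [v vr] := val_surj (density_bounds (@closed_Kspace K) hz).
by exists v => //; exists (nz z); rewrite /= vr czK.
Qed.

Definition rng01 (p : Kspace * N) := rngP p /\ unit_open (val p.2).

Lemma S11_rng01 : S11 rng01.
Proof.
apply: S11_and; first exact: S11_rngP.
have h : Bor (fun p : Kspace * N => 0 < val p.2 /\ val p.2 < 1).
  by apply: Bor_and; [exact: Bor_val_gt cfun_snd|exact: Bor_val_lt cfun_snd].
apply: S11_ext (Bor_S11 h) => p.
by split=> [[h1 h2]|/andP[]//]; apply/andP.
Qed.

Lemma section_rng01 K : section val rng01 K = ranD (Kset K) `&` unit_open.
Proof.
rewrite -section_rngP; apply/seteqP; split=> [_ [v [hv v01] <-]|_ [[v hv <-] v01]].
  by split=> //; exists v.
by exists v.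
Qed.

Lemma rng_geq n : S11 (fun K => (`I_n #<= ranD (Kset K) `&` unit_open)%card).
Proof.
apply: S11_ext (S11_geq n separating_val S11_rng01) => K.
by rewrite section_rng01.
Qed.

Lemma PiK_Rng_le n : PiK (KC (Rng_le n)).
Proof. exact/PiK_S11/(S11_not_card_le rng_geq). Qed.

Lemma PiK_Rng_fin : PiK (KC Rng_fin).
Proof. exact/PiK_S11/(S11_not_finite rng_geq). Qed.

Lemma S11_not_Rng_ctbl : S11 (fun K => ~ Rng_ctbl (Kset K)).
Proof.
apply: S11_ext (S11_uncountable separating_val S11_rng01) => K.
by rewrite section_rng01.
Qed.

Lemma PiK_Rng_ctbl : PiK (KC Rng_ctbl).
Proof. exact/PiK_S11/S11_not_Rng_ctbl. Qed.

Lemma D2SigmaK_Rng_eq n : D2SigmaK (KC (Rng_eq n)).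
Proof.
have -> : KC (Rng_eq n) = [set K | (`I_n #<= ranD (Kset K) `&` unit_open)%card /\ Rng_le n (Kset K)].
  apply/seteqP; split=> K; rewrite /KC /Rng_eq /= card_eq_le; first by move=> /andP[].
  by move=> [h1 h2]; apply/andP.
by apply: D2SigmaK_S11; [exact: rng_geq|exact: (S11_not_card_le rng_geq)].
Qed.

Lemma D2SigmaK_Rng_omega : D2SigmaK (KC Rng_omega).
Proof.
have -> : KC Rng_omega = [set K | (forall n, (`I_n #<= ranD (Kset K) `&` unit_open)%card) /\
    Rng_ctbl (Kset K)].
  by apply/seteqP; split=> K; [move=> /card_eq_nat[]|move=> [h1 h2]; apply/card_eq_nat].
by apply: D2SigmaK_S11; [exact: S11_all rng_geq|exact: S11_not_Rng_ctbl].
Qed.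

Lemma PiK_Rng_MGR : PiK (KC Rng_MGR).
Proof.
apply: PiK_S11; apply: S11_ext (S11_nonmeager S11_rngP) => K.
by rewrite section_rngP.
Qed.

Lemma S11_lam_gt a : S11 (fun K => ~ Rng_lam_le a (Kset K)).
Proof.
apply: S11_ext (S11_measure_gt a S11_rngP) => K.
by rewrite section_rngP ltNge; split=> /negP.
Qed.

Lemma S11_lam_ge (a : R) : S11 (fun K => (a%:E <= lamD (Kset K))%E).
Proof.
have : S11 (fun K => forall j, ((a - 2 ^- j)%:E < lam (section val rngP K))%E).
  by apply: S11_all => j; exact: S11_measure_gt S11_rngP.
apply: S11_ext => K; rewrite section_rngP -/(lamD (Kset K)); split=> [h|h j].
  apply/lee_subgt0Pr => e /exp2_small[j hj]; apply: le_trans (ltW (h j)).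
  by rewrite -EFinB lee_fin; lra.
by apply: lt_le_trans h; rewrite lte_fin ltrBlDr ltrDl exp2_gt0.
Qed.

Lemma PiK_Rng_lam_le a : PiK (KC (Rng_lam_le a)).
Proof. exact/PiK_S11/S11_lam_gt. Qed.

Lemma PiK_Rng_lam_lt a : PiK (KC (Rng_lam_lt a)).
Proof.
apply: PiK_S11; apply: S11_ext (S11_lam_ge a) => K.
by rewrite /Rng_lam_lt leNgt; split=> /negP.
Qed.

Lemma D2SigmaK_Rng_lam_eq a : D2SigmaK (KC (Rng_lam_eq a)).
Proof.
have -> : KC (Rng_lam_eq a) = [set K | (a%:E <= lamD (Kset K))%E /\ Rng_lam_le a (Kset K)].
  apply/seteqP; split=> K; rewrite /KC /Rng_lam_eq /Rng_lam_le /=.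
    by rewrite /Kset => ->.
  by move=> [h1 h2]; apply/eqP; rewrite eq_le h1 h2.
by apply: D2SigmaK_S11; [exact: S11_lam_ge|exact: S11_lam_gt].
Qed.

Lemma PiK_Rng_inj : PiK (KC Rng_inj).
Proof.
apply: PiK_S11.
pose Y := (Kspace * N * N * N)%type.
have cK : cfun (fun q : Y => q.1.1.1).
  exact: (cfun_comp cfun_fst (cfun_comp cfun_fst cfun_fst)).
have cu : cfun (fun q : Y => q.1.1.2).
  exact: (cfun_comp cfun_snd (cfun_comp cfun_fst cfun_fst)).
have cu' : cfun (fun q : Y => q.1.2) by exact: (cfun_comp cfun_snd cfun_fst).
have : S11 (fun K => exists u, exists u', exists v,
    (density_to (Kset K) (cz u) (val v) /\ density_to (Kset K) (cz u') (val v)) /\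
    ((0 < val v /\ val v < 1) /\ cz u <> cz u')).
  apply: (S11_exN (P := fun p : Kspace * N => exists u', exists v,
    (density_to (Kset p.1) (cz p.2) (val v) /\ density_to (Kset p.1) (cz u') (val v)) /\
    ((0 < val v /\ val v < 1) /\ cz p.2 <> cz u'))).
  apply: (S11_exN (P := fun p : Kspace * N * N => exists v,
    (density_to (Kset p.1.1) (cz p.1.2) (val v) /\ density_to (Kset p.1.1) (cz p.2) (val v)) /\
    ((0 < val v /\ val v < 1) /\ cz p.1.2 <> cz p.2))).
  apply: (S11_exN (P := fun q : Y =>
    (density_to (Kset q.1.1.1) (cz q.1.1.2) (val q.2) /\
     density_to (Kset q.1.1.1) (cz q.1.2) (val q.2)) /\
    ((0 < val q.2 /\ val q.2 < 1) /\ cz q.1.1.2 <> cz q.1.2))).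
  apply: S11_and; first apply: S11_and.
  - exact/Bor_S11/(Bor_tends_val cK cu cfun_snd).
  - exact/Bor_S11/(Bor_tends_val cK cu' cfun_snd).
  - apply: S11_and; last exact: (S11_neq separating_cz cu cu').
    by apply/Bor_S11/Bor_and; [exact: Bor_val_gt cfun_snd|exact: Bor_val_lt cfun_snd].
apply: S11_ext => K; split=> [[u [u' [v [[h1 h2] [[v0 v1] ne]]]]] inj|].
  by apply: ne; apply: (inj _ _ _ h1 h2); apply/andP.
move=> /existsNP[z1 /existsNP[z2 /existsNP[r /not_implyP[h1 /not_implyP[h2 /not_implyP[/andP[r0 r1] ne]]]]]].
have [v vr] := val_surj (density_bounds (@closed_Kspace K) h1).
by exists (nz z1), (nz z2), v; rewrite !czK vr.
Qed.

(** Countability of [S] makes both inclusions countable conjunctions: each required value is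
    attained, and a stray value differs from each element of the list. *)
Lemma D2SigmaK_Rng_S (S : set R) : countable S -> D2SigmaK (KC (Rng_S S)).
Proof.
move=> cS; pose D := S `|` [set 0; 1].
have cD : countable D.
  rewrite (_ : D = \bigcup_(b : bool) if b then S else [set 0; 1]).
    by apply: bigcup_countable => // -[] _ //; apply: finite_set_countable; rewrite finite_setU; split; exact: finite_set1.
  by apply/seteqP; split=> [r [Sr|r01]|r [[] _ h]]; [exists true|exists false|left|right].
have -> : KC (Rng_S S) = [set K | (forall r, D r -> ranD (Kset K) r) /\ ranD (Kset K) `<=` D].
  apply/seteqP; split=> K; rewrite /KC /Rng_S /=.
    by rewrite /Kset => ->; split=> [r|r].
  by move=> [h1 h2]; apply/seteqP; split.
apply: D2SigmaK_S11.
  apply: S11_all_countable cD _ => r _.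
  have : S11 (fun K => exists u, density_to (Kset K) (cz u) r).
    apply: (@S11_exN _ _ (fun q : Kspace * N => density_to (Kset q.1) (cz q.2) r)).
    exact/Bor_S11/(Bor_tends_cst _ cfun_fst cfun_snd).
  apply: S11_ext => K; split=> [[u hu]|[z hz]]; first by exists (cz u).
  by exists (nz z); rewrite czK.
have : S11 (fun K => exists v, rngP (K, v) /\ forall r, D r -> val v < r \/ r < val v).
  apply: (@S11_exN _ _ (fun p : Kspace * N => rngP p /\ forall r, D r -> val p.2 < r \/ r < val p.2)).
  apply: S11_and; first exact: S11_rngP.
  apply: S11_all_countable cD _ => r _.
  by apply/Bor_S11/Bor_or; [exact: Bor_val_lt cfun_snd|exact: Bor_val_gt cfun_snd].
apply: S11_ext => K; split=> [[v [[u hu] nD]] sub|].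
  by have /nD[] : D (val v) by [apply: sub; exists (cz u)]; rewrite ltxx.
move=> /existsNP[r /not_implyP[[z hz] nD]].
have [v vr] := val_surj (density_bounds (@closed_Kspace K) hz).
exists v; split; first by exists (nz z); rewrite /= czK vr.
move=> s Ds; rewrite vr; case: (ltgtP r s) => [|| rs]; [by left|by right|].
by rewrite -rs in Ds.
Qed.

End Ranges.

Lemma PiK_Sld : PiK (KC Sld).
Proof. by apply/PiK_S11/(S11_point_nonempty (C := Blur)) => *; exact: Bor_blur. Qed.

Lemma PiK_qDl : PiK (KC qDl).
Proof. by apply/PiK_S11/(S11_point_nonempty (C := Sharp)) => *; exact: Bor_sharp. Qed.

Lemma PiK_Dl : PiK (KC Dl).
Proof.
apply: PiK_S11; have : S11 (fun K => ~ Sld (Kset K) \/ ~ qDl (Kset K)).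
  by apply: S11_or; apply: S11_point_nonempty => *; [exact: Bor_blur|exact: Bor_sharp].
by apply: S11_ext => K; split=> [[h|h] []//|/not_andP].
Qed.

Lemma D2SigmaK_Spng : D2SigmaK (KC Spng).
Proof.
have -> : KC Spng = [set K | ~ Sld (Kset K) /\ qDl (Kset K)].
  by apply/seteqP; split=> K [].
by apply: D2SigmaK_S11; apply: S11_point_nonempty => *; [exact: Bor_blur|exact: Bor_sharp].
Qed.

(** * A closed set with prescribed oscillation of the density *)

(* Positions [2^k - 1] carry the letters of a sequence [x]; a point whose other
   coordinates vanish lies on the spine. A [1] in any other position [m] leaves
   the spine and enters a clopen filler decided by the next [m] digits. *)
Definition lev m := trunc_log 2 m.+1.
Definition free m := (2 ^ lev m == m.+1)%N.

Definition letters (z : cantor_space) k : seq bool := mkseq (fun i => z (2 ^ i).-1) k.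

Definition interp (a b f : R) : R := (1 - f) * a + f * b.

Definition frac m : R := (m.+1 - 2 ^ lev m)%:R / (2 ^ lev m)%:R.

(** Target density at the spine node of length [m]: linear interpolation between the weights of two
    consecutive words, along a block of [2 ^ lev m] positions. *)
Definition level w z m : R :=
  interp (w (letters z (lev m))) (w (letters z (lev m).+1)) (frac m).

Definition spine_upto (z : cantor_space) n := forall m, (m < n)%N -> ~~ free m -> z m = false.

(** A set of relative measure [r] that is initial in the lexicographic order has these relative
    measures in its two halves: the half [false] is filled first. The values 0 and 1 are
    absorbing. *)
Definition fill_step (r : R) (b : bool) : R :=
  if b then Num.max 0 (2 * r - 1) else Num.min 1 (2 * r).

Definition fill (r : R) (t : seq bool) : R := foldl fill_step r t.

Definition segment (z : cantor_space) a n : seq bool := mkseq (fun i => z (a + i)%N) n.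

Definition oscset (w : seq bool -> R) : set cantor_space :=
  [set z | forall m, ~~ free m -> spine_upto z m -> z m ->
    1 <= fill (level w z m) (segment z m.+1 m)].

Lemma lev_bounds m : (2 ^ lev m <= m.+1 < 2 ^ (lev m).+1)%N.
Proof. exact: trunc_log_bounds. Qed.

Lemma lev_pow k : lev (2 ^ k).-1 = k.
Proof. by rewrite /lev prednK ?expn_gt0// trunc_expnK. Qed.

Lemma free_pow k : free (2 ^ k).-1.
Proof. by rewrite /free lev_pow prednK ?expn_gt0. Qed.

Lemma free_lev m : free m -> m = (2 ^ lev m).-1.
Proof. by move/eqP => ->. Qed.

Lemma lev_lt m : (lev m <= m)%N.
Proof.
have /andP[h _] := lev_bounds m; rewrite -ltnS.
by apply: leq_trans h; exact: ltn_expl.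
Qed.

Lemma frac_free m : free m -> frac m = 0.
Proof. by rewrite /frac => /eqP ->; rewrite subnn mul0r. Qed.

Lemma frac_bounds m : 0 <= frac m <= 1.
Proof.
have /andP[h1 h2] := lev_bounds m; have p0 : (0 < 2 ^ lev m)%N by rewrite expn_gt0.
apply/andP; split; first by rewrite divr_ge0.
rewrite ler_pdivrMr ?ltr0n// mul1r ler_nat leq_subLR addnn -mul2n -expnS.
exact: ltnW.
Qed.

Lemma letters_agree (z z' : cantor_space) k n : (forall i, (i < k)%N -> ((2 ^ i).-1 < n)%N) ->
  agree n z z' -> letters z' k = letters z k.
Proof. by move=> h zz'; apply/eq_in_map => i; rewrite mem_iota add0n => /h/zz'. Qed.

(** The last letter read sits at position [2 ^ lev m - 1], which is below [m] unless [m] is free; in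
    that case [frac m = 0] and this letter has no influence. *)
Lemma level_agree w (z z' : cantor_space) m : agree m z z' -> level w z' m = level w z m.
Proof.
move=> zz'; have /andP[h1 h2] := lev_bounds m.
have e1 : letters z' (lev m) = letters z (lev m).
  apply: letters_agree zz' => i il; rewrite -ltnS prednK ?expn_gt0//.
  by apply: leq_trans h1; rewrite ltn_exp2l.
rewrite /level e1; case: (boolP (free m)) => fm.
  by rewrite frac_free// /interp !mul0r.
rewrite (@letters_agree z z' _ m)// => i; rewrite ltnS => il.
rewrite -ltnS prednK ?expn_gt0//; apply: (@leq_ltn_trans (2 ^ lev m)%N).
  by rewrite leq_exp2l.
by rewrite ltn_neqAle h1 andbT.
Qed.

Lemma segment_agree (z z' : cantor_space) a n : agree (a + n) z z' ->
  segment z' a n = segment z a n.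
Proof. by move=> h; apply/eq_in_map => i; rewrite mem_iota add0n => ni; apply: h; rewrite ltn_add2l. Qed.

Lemma spine_upto_agree (z z' : cantor_space) n : agree n z z' -> spine_upto z n -> spine_upto z' n.
Proof. by move=> h s m mn fm; rewrite h// s. Qed.

Lemma oscset_filler w z m : ~~ free m -> spine_upto z m -> z m ->
  oscset w z <-> 1 <= fill (level w z m) (segment z m.+1 m).
Proof.
move=> fm sm zm; split=> [|h m' fm' sm' zm']; first exact.
have -> // : m' = m; apply/eqP; rewrite eqn_leq; apply/andP; split; rewrite leqNgt; apply/negP => lt.
  by have := sm' m lt fm; rewrite zm.
by have := sm m' lt fm'; rewrite zm'.
Qed.

Lemma oscset_spine w z : (forall n, spine_upto z n) -> oscset w z.
Proof. by move=> h m fm _; rewrite (h m.+1 m (ltnSn m) fm). Qed.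

Lemma spine_split z : (forall n, spine_upto z n) \/
  exists m, [/\ ~~ free m, spine_upto z m & z m].
Proof.
case: (EM (exists m, ~~ free m /\ z m)) => [/least_nat[m [[fm zm] lm]]|/forallNP h].
  right; exists m; split=> // i im fi; apply/negP => zi; exact: (lm i im).
by left=> n m _ fm; apply/negP => zm; apply: (h m).
Qed.

Lemma oscset_agree w z z' m : ~~ free m -> spine_upto z m -> z m ->
  agree (m.+1 + m) z z' -> oscset w z' <-> oscset w z.
Proof.
move=> fm sm zm zz'.
have zz'm : agree m z z' by move=> i im; apply: zz'; lia.
rewrite (oscset_filler w fm sm zm) (oscset_filler w fm (spine_upto_agree zz'm sm)) ?zz'//; last lia.
by rewrite (level_agree w zz'm) (segment_agree zz').
Qed.

Lemma closed_oscset w : closed (oscset w).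
Proof.
rewrite -openC; apply/open_seqP => z nz.
case: (spine_split z) => [/(oscset_spine w)//|[m [fm sm zm]]].
by exists (m.+1 + m)%N => z' /(oscset_agree w fm sm zm) e /e.
Qed.

Definition upd (z : cantor_space) n b : cantor_space := fun i => if i == n then b else z i.

Lemma mkseq_upd z n b : mkseq (upd z n b) n.+1 = rcons (mkseq z n) b.
Proof.
rewrite mkseqS /upd eqxx; congr rcons.
by apply/eq_in_map => i; rewrite mem_iota add0n => ni; rewrite ltn_eqF.
Qed.

Lemma agree_upd z n b : agree n z (upd z n b).
Proof. by move=> i ni; rewrite /upd ltn_eqF. Qed.

Lemma dens_mkseq A z n : dens A (mkseq z n) =
  (dens A (mkseq (upd z n false) n.+1) + dens A (mkseq (upd z n true) n.+1)) / 2.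
Proof. by rewrite !mkseq_upd dens_split. Qed.

Lemma fill_step01 r b : 0 <= r <= 1 -> 0 <= fill_step r b <= 1.
Proof.
move=> /andP[r0 r1]; rewrite /fill_step; case: b.
  by rewrite le_max lexx ge_max ler01 /=; lra.
by rewrite le_min ler01 ge_min lexx /= andbT; lra.
Qed.

Lemma fill01 r t : 0 <= r <= 1 -> 0 <= fill r t <= 1.
Proof. by elim: t r => //= b t IH r r01; apply: IH; exact: fill_step01. Qed.

Lemma segment_upd z a n b : segment (upd z (a + n) b) a n.+1 = rcons (segment z a n) b.
Proof.
rewrite /segment mkseqS /upd eqxx; congr rcons.
by apply/eq_in_map => i; rewrite mem_iota add0n => ni; rewrite eqn_add2l ltn_eqF.
Qed.

Section Weights.
Variable w : seq bool -> R.
Hypothesis w01 : forall p, 0 <= w p <= 1.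

Lemma interp01 a b f : 0 <= a <= 1 -> 0 <= b <= 1 -> 0 <= f <= 1 -> 0 <= interp a b f <= 1.
Proof.
move=> /andP[a0 a1] /andP[b0 b1] /andP[f0 f1]; rewrite /interp.
have h1 : 0 <= (1 - f) * a by rewrite mulr_ge0 ?subr_ge0.
have h2 : (1 - f) * a <= 1 - f by rewrite ler_piMr ?subr_ge0.
have h3 : 0 <= f * b by rewrite mulr_ge0.
have h4 : f * b <= f by rewrite ler_piMr.
by apply/andP; split; lra.
Qed.

Lemma level01 z m : 0 <= level w z m <= 1.
Proof. by apply: interp01 => //; exact: frac_bounds. Qed.

Lemma dens_oscset_agree z m : ~~ free m -> spine_upto z m -> z m ->
  dens (oscset w) (mkseq z (m.+1 + m)) = (1 <= fill (level w z m) (segment z m.+1 m))%R%:R.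
Proof.
move=> fm sm zm; have h := oscset_filler w fm sm zm.
case: (boolP (1 <= _)) => f1 /=.
  apply: dens_cyl => z' /cyl_mkseq zz'; apply/(oscset_agree w fm sm zm zz').
  exact/h.
apply: dens_nmeets => -[z' [Az' /cyl_mkseq zz']].
by move/(oscset_agree w fm sm zm zz')/h: Az'; rewrite (negbTE f1).
Qed.

(* One of the two halves of a filler is always entirely inside or entirely
   outside, whence the geometric error. *)
Lemma dens_filler m d : ~~ free m -> forall z j, (j + d)%N = m -> spine_upto z m -> z m ->
  let D := dens (oscset w) (mkseq z (m.+1 + j)) in
  let r := fill (level w z m) (segment z m.+1 j) in
  [/\ `|D - r| <= 2 ^- d, r = 0 -> D = 0 & r = 1 -> D = 1].
Proof.
move=> fm; elim: d => [|d IH] z j jd sm zm.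
  rewrite addn0 in jd; subst j => /=.
  have /andP[f0 f1] := fill01 (segment z m.+1 m) (level01 z m).
  rewrite dens_oscset_agree//; move: (fill _ _) f0 f1 => r r0 r1.
  case: (leP 1 r) => h /=.
    have -> : r = 1 by apply/eqP; rewrite eq_le h r1.
    by rewrite subrr normr0 exp2_ge0; split=> // /eqP; rewrite oner_eq0.
  split=> // [|e]; last by rewrite e ltxx in h.
  by rewrite sub0r normrN expr0 invr1 ger0_norm.
move=> D r; have r01 : 0 <= r <= 1 by apply: fill01; exact: level01.
have h b : let Db := dens (oscset w) (mkseq (upd z (m.+1 + j) b) (m.+1 + j).+1) in
    [/\ `|Db - fill_step r b| <= 2 ^- d, fill_step r b = 0 -> Db = 0 &
      fill_step r b = 1 -> Db = 1].
  have ag : agree m z (upd z (m.+1 + j) b).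
    by move=> i im; apply: agree_upd; lia.
  have := IH (upd z (m.+1 + j) b) j.+1.
  rewrite (level_agree w ag) segment_upd addnS /fill -cats1 foldl_cat /=; apply.
  - by rewrite -jd addSnnS.
  - exact: spine_upto_agree sm.
  - have lt : (m < m.+1 + j)%N by lia.
    by rewrite (agree_upd _ _ lt).
have Dav := dens_mkseq (oscset w) z (m.+1 + j); rewrite -/D in Dav.
have [hf f0 f1] := h false; have [ht t0 t1] := h true.
rewrite Dav; move: hf f0 f1 ht t0 t1 => /=.
set Df := dens _ _; set Dt := dens _ _; rewrite /fill_step.
case/andP: r01 => r0 r1; case: (leP 1 (2 * r)) => hr.
  rewrite (max_idPr _) ?subr_ge0// => _ _ /(_ erefl) -> ht t0 t1; split.
  - by move: ht; rewrite exp2S !ler_norml => /andP[? ?]; apply/andP; split; lra.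
  - by move=> e; move: hr; rewrite e; lra.
  - by move=> e; rewrite t1 ?e; lra.
rewrite (max_idPl _) ?subr_le0 ?(ltW hr)// => hf f0 f1 _ /(_ erefl) -> _; split.
- by move: hf; rewrite exp2S !ler_norml => /andP[? ?]; apply/andP; split; lra.
- by move=> e; rewrite f0 ?e; lra.
- by move=> e; move: hr; rewrite e; lra.
Qed.

(** Each of the [2 ^ lev m] positions of a block contributes an equal share of the change of weight.
    The doubling distance between letters is chosen for this slowness. *)
Lemma level_step z m : `|level w z m.+1 - level w z m| <= 2 ^- lev m.
Proof.
have /andP[l1 l2] := lev_bounds m; have p0 : (0 < 2 ^ lev m)%N by rewrite expn_gt0.
have pR : 0 < (2 : R) ^+ lev m by rewrite exprn_gt0.
have key : level w z m.+1 - level w z m =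
    2 ^- lev m * (w (letters z (lev m).+1) - w (letters z (lev m))).
  rewrite /level; case: (leqP (2 ^ (lev m).+1) m.+2) => h.
    have em : m.+2 = (2 ^ (lev m).+1)%N by apply/eqP; rewrite eqn_leq l2 h.
    have lS : lev m.+1 = (lev m).+1 by rewrite /lev em trunc_expnK.
    have fr : free m.+1 by rewrite /free lS em.
    rewrite (frac_free fr) lS /interp /frac.
    have -> : (m.+1 - 2 ^ lev m)%:R = (2 : R) ^+ lev m - 1.
      rewrite natrB// natrX; have := congr1 (fun k => k%:R : R) em.
      by rewrite natrX exprS -[m.+2]addn1 natrD; lra.
    by rewrite natrX; move: (2 ^+ _) pR => x x0; field; rewrite gt_eqF.
  have lS : lev m.+1 = lev m.
    by apply: trunc_log_eq => //; rewrite h andbT; apply: leq_trans l1 _.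
  rewrite lS /interp /frac lS subSn// -[(_ - _).+1]addn1 natrD natrX.
  by move: (2 ^+ _) pR => x x0; field; rewrite gt_eqF.
rewrite key normrM ger0_norm ?exp2_ge0// ler_piMr ?exp2_ge0//.
have /andP[? ?] := w01 (letters z (lev m).+1); have /andP[? ?] := w01 (letters z (lev m)).
by rewrite ler_norml; apply/andP; split; lra.
Qed.

Lemma exp2_le m n : (m <= n)%N -> (2 : R) ^- n <= 2 ^- m.
Proof. by move=> mn; rewrite lef_pV2 ?posrE ?exprn_gt0// ler_eXn2l ?ltr1n. Qed.

Definition on_spine (z : cantor_space) := forall n, spine_upto z n.

(** Half of the cylinder is a filler with density near the target, the other half is the next spine
    node. The error [B] there is halved, as are the filler error and the drift of [level], both at
    most [2 ^- k]. *)
Lemma dens_level_nonfree k z m (B : R) : on_spine z -> ~~ free m -> (2 ^ k <= m.+1)%N ->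
  `|dens (oscset w) (mkseq z m.+1) - level w z m.+1| <= B ->
  `|dens (oscset w) (mkseq z m) - level w z m| <= B / 2 + 2 ^- k.
Proof.
move=> sz fm km hB.
have kl : (k <= lev m)%N by rewrite /lev trunc_log_max.
have hl := le_trans (level_step z m) (exp2_le kl).
have zm : z m = false := sz m.+1 m (ltnSn m) fm.
have su : spine_upto (upd z m true) m by apply: spine_upto_agree (sz m); exact: agree_upd.
have [] := @dens_filler m m fm (upd z m true) 0 (add0n m) su; first by rewrite /upd eqxx.
rewrite (level_agree w (agree_upd z true)) /= addn0 => hf _ _.
have {}hf := le_trans hf (exp2_le (leq_trans kl (lev_lt m))).
rewrite dens_mkseq.
have -> : mkseq (upd z m false) m.+1 = mkseq z m.+1.
  by rewrite mkseq_upd mkseqS zm.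
move: hB hl hf; rewrite !ler_norml => /andP[? ?] /andP[? ?] /andP[? ?].
by apply/andP; split; lra.
Qed.

(** Iterated halving brings the trivial error 1 down to [2 ^- j]. The constant 4 is stable: a
    nonfree position turns it into 2 + 1, and a free one, followed by two nonfree spine nodes, adds
    one more [level_step]. *)
Lemma dens_level k j z m : (0 < k)%N -> on_spine z -> (2 ^ k <= m.+1)%N ->
  `|dens (oscset w) (mkseq z m) - level w z m| <= 2 ^- j + 4 * 2 ^- k.
Proof.
move=> k0; elim: j z m => [|j IH] z m sz km.
  rewrite expr0 invr1; have /andP[? ?] := level01 z m; have := exp2_ge0 k.
  have := dens_ge0 (oscset w) (mkseq z m); have := dens_le1 (oscset w) (mkseq z m).
  by move=> ? ? ?; rewrite ler_norml; apply/andP; split; lra.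
have ek := exp2_ge0 k.
case: (boolP (free m)) => fm; last first.
  have := dens_level_nonfree sz fm km (IH z m.+1 sz (leqW km)).
  by rewrite (exp2S j) => h; apply: le_trans h _; lra.
have kl : (k <= lev m)%N by rewrite /lev trunc_log_max.
(* Consecutive free positions occur only at 0 and 1, which [0 < k] excludes. *)
have nfm : ~~ free m.+1.
  have m2 : (m.+1 < m.+2 < 2 ^ (lev m).+1)%N.
    rewrite ltnSn /= expnS (eqP fm) mul2n -addnn -{1}[m.+2]addn1 ltn_add2l.
    by rewrite -(eqP fm) -[1%N]/(2 ^ 0)%N ltn_exp2l// (leq_trans k0).
  have lS : lev m.+1 = lev m.
    by apply: trunc_log_eq => //; case/andP: m2 => _ ->; rewrite (eqP fm) leqnSn.
  by rewrite /free lS (eqP fm) neq_ltn ltnSn.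
have h b : `|dens (oscset w) (mkseq (upd z m b) m.+1) - level w z m| <=
    2 ^- j.+1 + 4 * 2 ^- k.
  have sb : on_spine (upd z m b).
    by move=> n i _ fi; rewrite /upd; case: eqP => [e|_]; [rewrite e fm in fi|exact: (sz i.+1)].
  have := dens_level_nonfree sb nfm (leqW km) (IH _ m.+2 sb (leqW (leqW km))).
  have := le_trans (level_step (upd z m b) m) (exp2_le kl).
  rewrite (level_agree w (agree_upd z b)) (exp2S j) !ler_norml => /andP[? ?] /andP[? ?].
  by apply/andP; split; lra.
rewrite dens_mkseq; have := h false; have := h true.
by rewrite !ler_norml => /andP[? ?] /andP[? ?]; apply/andP; split; lra.
Qed.

Lemma dens_level_lim k z m : (0 < k)%N -> on_spine z -> (2 ^ k <= m.+1)%N ->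
  `|dens (oscset w) (mkseq z m) - level w z m| <= 4 * 2 ^- k.
Proof.
move=> k0 sz km; rewrite leNgt; apply/negP => lt.
have [j hj] : exists j, 2 ^- j < `|dens (oscset w) (mkseq z m) - level w z m| - 4 * 2 ^- k.
  by apply: exp2_small; rewrite subr_gt0.
by have := dens_level j k0 sz km; lra.
Qed.

Lemma level_pow z k : level w z (2 ^ k).-1 = w (letters z k).
Proof. by rewrite /level frac_free ?free_pow// lev_pow /interp; lra. Qed.

(** The density follows [level], which at position [2 ^ k - 1] equals the weight of the first [k]
    letters and in between is a convex combination of two consecutive weights. *)
Lemma oscset_spine_density z r : on_spine z ->
  density_to (oscset w) z r <->
  forall e, 0 < e -> exists M, forall k, (M <= k)%N -> `|w (letters z k) - r| < e.
Proof.
move=> sz; rewrite density_toP; last exact: closed_oscset.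
have close e : 0 < e -> exists M, forall m, (M <= m)%N ->
    `|dens (oscset w) (mkseq z m) - level w z m| < e.
  move=> e0; have [k hk] : exists k, 2 ^- k < e / 4 by apply: exp2_small; rewrite divr_gt0.
  exists (2 ^ k.+1)%N => m km.
  apply: le_lt_trans (dens_level_lim (ltn0Sn k) sz (leqW km)) _.
  by move: hk; rewrite ltr_pdivlMr// (exp2S k); have := exp2_gt0 k.+1; lra.
split=> h e e0; have e2 : 0 < e / 2 by rewrite divr_gt0.
  have [M1 h1] := h _ e2; have [M2 h2] := close _ e2.
  exists (maxn M1 M2).+1 => k kM; rewrite -level_pow.
  have kk : (k <= (2 ^ k).-1)%N by rewrite -ltnS prednK ?expn_gt0// ltn_expl.
  have := h1 _ (leq_trans (leq_trans (leqW (leq_maxl M1 M2)) kM) kk).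
  have := h2 _ (leq_trans (leq_trans (leqW (leq_maxr M1 M2)) kM) kk).
  by rewrite !ltr_norml => /andP[? ?] /andP[? ?]; apply/andP; split; lra.
have [M1 h1] := h _ e2; have [M2 h2] := close _ e2.
exists (maxn (2 ^ M1) M2) => m mM.
have M1l : (M1 <= lev m)%N.
  by rewrite /lev trunc_log_max// leqW// (leq_trans (leq_maxl _ _) mM).
have := h1 _ M1l; have := h1 _ (leqW M1l); have := h2 _ (leq_trans (leq_maxr _ _) mM).
rewrite /level /interp; have /andP[f0 f1] := frac_bounds m.
set a := w _; set b := w _; set D := dens _ _; set f := frac m in f0 f1 *.
rewrite !ltr_norml => /andP[? ?] /andP[? ?] /andP[? ?].
have g1 : f * (b - r) <= f * (e / 2) by rewrite ler_wpM2l//; lra.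
have g2 : f * (- (e / 2)) <= f * (b - r) by rewrite ler_wpM2l//; lra.
have g3 : (1 - f) * (a - r) <= (1 - f) * (e / 2) by rewrite ler_wpM2l ?subr_ge0//; lra.
have g4 : (1 - f) * (- (e / 2)) <= (1 - f) * (a - r) by rewrite ler_wpM2l ?subr_ge0//; lra.
by apply/andP; split; lra.
Qed.

(** Leaving the spine means entering a clopen filler, so membership is constant near [z]. *)
Lemma oscset_off_spine z : ~ on_spine z ->
  density_to (oscset w) z 0 \/ density_to (oscset w) z 1.
Proof.
move=> nsz; have [/nsz//|[m [fm sm zm]]] := spine_split z.
have ag z' n : (m.+1 + m <= n)%N -> cyl (mkseq z n) z' -> oscset w z' <-> oscset w z.
  move=> mn /cyl_mkseq zz'; apply: (oscset_agree w fm sm zm) => i im.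
  by apply: zz'; exact: leq_trans mn.
case: (EM (oscset w z)) => [Az|nAz].
  right; apply/density_toP; first exact: closed_oscset.
  move=> e e0; exists (m.+1 + m)%N => n mn.
  by rewrite dens_cyl ?subrr ?normr0// => z' /(ag _ _ mn); tauto.
left; apply/density_toP; first exact: closed_oscset.
move=> e e0; exists (m.+1 + m)%N => n mn.
by rewrite dens_nmeets ?subrr ?normr0// => -[z' [Az' /(ag _ _ mn)]]; tauto.
Qed.

End Weights.

(** A node still on the spine always meets the set, by continuing with zeros; past the spine, the
    target density deciding membership reads [w] at words of length at most [size s]. This is why
    the compact set varies continuously with [w]. *)
Lemma meets_oscset w w' s : (forall p, (size p <= size s)%N -> w p = w' p) ->
  meets (oscset w) s -> meets (oscset w') s.
Proof.
move=> ww' [z [Az sz]].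
case: (EM (spine_upto z (size s))) => [su|/existsNP[m0 /not_implyP[m0s /not_implyP[fm0 zm0]]]].
  pose z' : cantor_space := fun i => if (i < size s)%N then z i else false.
  exists z'; split; last by move=> i si; rewrite /z' si sz.
  apply: oscset_spine => n i _ fi; rewrite /z'; case: ifP => // si.
  exact: su si fi.
have [/(_ m0.+1 m0 (ltnSn m0) fm0)//|[m [fm sm zm]]] := spine_split z.
have ms : (m < size s)%N.
  rewrite ltnNge; apply/negP => sm'; apply: zm0; apply: sm fm0.
  exact: leq_trans m0s sm'.
exists z; split=> //; apply/(oscset_filler w' fm sm zm).
move/(oscset_filler w fm sm zm): Az; congr (is_true (1 <= fill _ _)).
have ls : (lev m < size s)%N by apply: leq_ltn_trans ms; exact: lev_lt.
by rewrite /level !ww' ?size_mkseq// ltnW.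
Qed.

Definition spine (x : nat -> bool) : cantor_space := fun m => free m && x (lev m).

Lemma on_spineP z : on_spine z <-> exists x, z = spine x.
Proof.
split=> [sz|[x ->] n m _ fm]; last by rewrite /spine (negbTE fm).
exists (fun k => z (2 ^ k).-1); apply/funext => m; rewrite /spine.
case: (boolP (free m)) => fm /=; first by rewrite -free_lev.
exact: (sz m.+1).
Qed.

Lemma letters_spine x k : letters (spine x) k = mkseq x k.
Proof. by apply/eq_in_map => i _; rewrite /spine free_pow lev_pow. Qed.

Lemma spine_inj : injective spine.
Proof.
move=> x y e; apply/funext => k; have := congr1 (fun f => f (2 ^ k).-1) e.
by rewrite /spine free_pow lev_pow.
Qed.

(** * Blocks of zeros as letters of a sequence *)

(* The state lists the lengths of the blocks of zeros already closed by a one,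
   and the length of the current open block. *)
Definition decode_step (st : seq nat * nat) (b : bool) : seq nat * nat :=
  if b then (rcons st.1 st.2, 0%N) else (st.1, st.2.+1).

Definition decode (q : seq bool) : seq nat * nat := foldl decode_step ([::], 0%N) q.

Definition encode (st : seq nat * nat) : seq bool :=
  flatten [seq rcons (nseq a false) true | a <- st.1] ++ nseq st.2 false.

Lemma decode_rcons q b : decode (rcons q b) = decode_step (decode q) b.
Proof. by rewrite /decode -cats1 foldl_cat. Qed.

Lemma nseqS_rcons {A : Type} n (a : A) : nseq n.+1 a = rcons (nseq n a) a.
Proof. by elim: n => //= n ->. Qed.

Lemma encode_step st b : encode (decode_step st b) = rcons (encode st) b.
Proof.
case: b; rewrite /encode /decode_step /=; last by rewrite -[_ :: _]/(nseq st.2.+1 false) nseqS_rcons rcons_cat.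
by rewrite map_rcons flatten_rcons cats0 -rcons_cat.
Qed.

Lemma decodeK : cancel decode encode.
Proof. by elim/last_ind => // q b IH; rewrite decode_rcons encode_step IH. Qed.

Lemma encodeK : cancel encode decode.
Proof.
have closed s : decode (encode (s, 0%N)) = (s, 0%N) ->
    forall j, decode (encode (s, j)) = (s, j).
  move=> h0; elim=> // j IHj; have := encode_step (s, j) false.
  by rewrite /decode_step /= => ->; rewrite decode_rcons IHj.
move=> [s j]; elim/last_ind: s j => [|s a IHs]; apply: closed => //.
have := encode_step (s, a) true.
by rewrite /decode_step /= => ->; rewrite decode_rcons IHs.
Qed.

Lemma encode_cat s s' : encode (s ++ s', 0%N) = encode (s, 0%N) ++ encode (s', 0%N).
Proof. by rewrite /encode /= !cats0 map_cat flatten_cat. Qed.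

Lemma size_encode s : (size s <= size (encode (s, 0%N)))%N.
Proof.
elim: s => // a s IH; rewrite -cat1s encode_cat 2!size_cat leq_add//.
by rewrite /encode size_cat /= cats0 size_rcons.
Qed.

Lemma decode_prefix q q' : prefix q q' -> prefix (decode q).1 (decode q').1.
Proof.
move=> /prefixP[r ->]; elim/last_ind: r => [|r b IH]; first by rewrite cats0 prefix_refl.
apply: prefix_trans IH _; rewrite -rcons_cat decode_rcons /decode_step.
by case: b; rewrite /= ?prefix_rcons ?prefix_refl.
Qed.

(** Concatenation of blocks of [y i] zeros, each closed by a one. The digit at [k] is read in the
    first [k.+1] blocks, whose total length is at least [k.+1]. *)
Definition code (y : N) (k : nat) : bool := nth false (encode (mkseq y k.+1, 0%N)) k.

Lemma encode_mkseq y m n : (m <= n)%N ->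
  prefix (encode (mkseq y m, 0%N)) (encode (mkseq y n, 0%N)).
Proof.
move=> mn; apply/prefixP; exists (encode (drop m (mkseq y n), 0%N)).
by rewrite -encode_cat -{1}(minn_idPl mn) -take_mkseq cat_take_drop.
Qed.

Lemma size_encode_mkseq (y : N) n : (n <= size (encode (mkseq y n, 0%N)))%N.
Proof. by rewrite -{1}(size_mkseq y n) size_encode. Qed.

Lemma nth_prefix (T : eqType) (x0 : T) s t i : prefix s t -> (i < size s)%N ->
  nth x0 t i = nth x0 s i.
Proof. by move=> /prefixP[r ->] h; rewrite nth_cat h. Qed.

Lemma mkseq_code y n :
  mkseq (code y) (size (encode (mkseq y n, 0%N))) = encode (mkseq y n, 0%N).
Proof.
apply: (@eq_from_nth _ false); rewrite size_mkseq// => i h; rewrite nth_mkseq// /code.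
case: (leqP i.+1 n) => ni.
  by rewrite (nth_prefix _ (encode_mkseq y ni)) ?size_encode_mkseq.
by rewrite (nth_prefix _ (encode_mkseq y (ltnW ni))).
Qed.

Lemma decode_code y n :
  decode (mkseq (code y) (size (encode (mkseq y n, 0%N)))) = (mkseq y n, 0%N).
Proof. by rewrite mkseq_code encodeK. Qed.

Lemma prefix_mkseq {T : eqType} (x : nat -> T) m n : (m <= n)%N -> prefix (mkseq x m) (mkseq x n).
Proof. by move=> mn; rewrite -{1}(minn_idPl mn) -take_mkseq prefix_take. Qed.

Lemma decode_code_eventually y n : exists M, forall k, (M <= k)%N ->
  exists m j, (n <= m)%N /\ decode (mkseq (code y) k) = (mkseq y m, j).
Proof.
exists (size (encode (mkseq y n, 0%N))) => k nk.
exists (size (decode (mkseq (code y) k)).1), (decode (mkseq (code y) k)).2; split.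
  have := decode_prefix (prefix_mkseq (code y) nk); rewrite decode_code /=.
  by move/size_prefix; rewrite size_mkseq.
have := decode_prefix (prefix_mkseq (code y) (size_encode_mkseq y k)); rewrite decode_code /=.
case: (decode _) => s j /= h; congr pair; move/prefixP: h (size_prefix h) => [r e].
rewrite size_mkseq => sk; have := congr1 (take (size s)) e.
by rewrite take_mkseq (minn_idPl sk) take_size_cat.
Qed.

Lemma code_inj : injective code.
Proof.
move=> y y' e; apply/funext => i.
have [M h] := decode_code_eventually y i.+1; have [M' h'] := decode_code_eventually y' i.+1.
have [m [j [im]]] := h _ (leq_maxl M M'); have [m' [j' [im']]] := h' _ (leq_maxr M M').
by rewrite e => -> -[/(congr1 (nth 0%N ^~ i))]; rewrite !nth_mkseq.
Qed.

(** Infinitely many ones make [x] a code; otherwise its last block grows forever and [x] stands for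
    the finite sequence [s] of closed blocks. *)
Lemma code_dichotomy (x : nat -> bool) : (exists y, x = code y) \/
  exists K s j, forall i, decode (mkseq x (K + i)) = (s, j + i)%N.
Proof.
case: (EM (exists K, forall k, (K <= k)%N -> x k = false)) => [[K hK]|inf].
  right; exists K, (decode (mkseq x K)).1, (decode (mkseq x K)).2; elim=> [|i IH].
    by rewrite !addn0; case: (decode _).
  by rewrite addnS mkseqS decode_rcons IH hK ?leq_addr// /decode_step addnS.
have ones K : exists k, (K <= k)%N /\ x k.
  apply: contrapT => /forallNP h; apply: inf; exists K => k Kk.
  by apply/negP => xk; apply: (h k).
have big n : exists k, (n <= size (decode (mkseq x k)).1)%N.
  elim: n => [|n [k nk]]; first by exists 0%N.
  have [k' [kk' xk']] := ones k; exists k'.+1.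
  rewrite mkseqS decode_rcons xk' /decode_step /= size_rcons ltnS.
  by apply: leq_trans nk _; exact/size_prefix/decode_prefix/prefix_mkseq.
have /choice[K hK] := big.
pose y n := nth 0%N (decode (mkseq x (K n.+1))).1 n.
have dy k : (decode (mkseq x k)).1 = mkseq y (size (decode (mkseq x k)).1).
  apply: (@eq_from_nth _ 0%N) => [|i ik]; rewrite ?size_mkseq// nth_mkseq// /y.
  case: (leqP k (K i.+1)) => le.
    by rewrite (nth_prefix _ (decode_prefix (prefix_mkseq x le))).
  by rewrite (nth_prefix _ (decode_prefix (prefix_mkseq x (ltnW le)))).
left; exists y; apply/funext => i; have [k [ik xk]] := ones i.
have e : decode (mkseq x k.+1) = (mkseq y (size (decode (mkseq x k.+1)).1), 0%N).
  by rewrite -dy mkseqS decode_rcons xk.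
move: e; set n := size _ => /(congr1 encode); rewrite decodeK => e.
have := mkseq_code y n; rewrite -e size_mkseq => /(congr1 (nth false ^~ i)).
by rewrite !nth_mkseq ?ltnS.
Qed.

(** * Closed sets whose sharp or blurry points are the branches of a tree *)

Definition tends_along (w : seq bool -> R) (x : nat -> bool) (r : R) :=
  forall e, 0 < e -> exists M, forall k, (M <= k)%N -> `|w (mkseq x k) - r| < e.

Lemma tends_along_eventually w x K r : (forall i, w (mkseq x (K + i)) = r) -> tends_along w x r.
Proof.
by move=> h e e0; exists K => k Kk; rewrite -(subnKC Kk) h subrr normr0.
Qed.

Lemma tends_along_const w x r a : tends_along w x r ->
  (forall M, exists k, (M <= k)%N /\ w (mkseq x k) = a) -> r = a.
Proof.
move=> h ha; apply/eqP/negPn/negP => ne.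
have [|M hM] := h `|r - a|; first by rewrite normr_gt0 subr_eq0.
by have [k [/hM + e]] := ha M; rewrite e distrC ltxx.
Qed.

Definition clamp (r : R) : R := Num.max 0 (Num.min 1 r).

Lemma clamp01 r : 0 <= clamp r <= 1.
Proof. by rewrite /clamp le_max lexx ge_max ler01 ge_min lexx. Qed.

Lemma clamp_dist r a : 0 <= a <= 1 -> `|clamp r - a| <= `|r - a|.
Proof.
move=> /andP[a0 a1]; rewrite /clamp; case: (leP 1 r) => h1.
  by rewrite (max_idPr _)// !ger0_norm; lra.
by case: (leP 0 r) => h0//; rewrite !ler0_norm; lra.
Qed.

(** The point [r] of [[0; 1]] lies strictly between the two values, so clamping cannot merge them:
    the oscillation at a node survives it. *)
Lemma clamp_neq r d : 0 <= r <= 1 -> 0 < d -> clamp (r - d) < clamp (r + d).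
Proof.
move=> /andP[r0 r1] d0; rewrite /clamp (@min_idPr _ _ 1 (r - d) _); last lra.
rewrite (@max_idPr _ _ 0 (Num.min _ _) _); last by rewrite le_min ler01; lra.
by rewrite gt_max !lt_min ltr01 /=; apply/andP; split; [|apply/andP; split]; lra.
Qed.

Definition pad (s : seq nat) : N := nth 0%N s.

Definition real_continuous (f : N -> R) :=
  forall y e, 0 < e -> exists n, forall y', nat_eqn n y y' -> `|f y' - f y| < e.

Section TreeSet.
Variables (T : seq nat -> Prop) (phi : N -> R).

(* On a node [s], the weight oscillates with amplitude [2^-|s|] around the value
   prescribed by [phi] while the current block of zeros grows; outside the tree
   it is constant. *)
Definition sharp_weight (q : seq bool) : R :=
  let: (s, j) := decode q in
  if `[< T s >] then clamp (phi (pad s) + (-1) ^+ j * 2 ^- size s) else (head 0%N s != 0%N)%:R.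

(** The value 1 occurs only right after a one that closes an odd number of blocks. Along a branch 0
    and 1 both recur, while in a growing block or outside the tree the weight is eventually 0. *)
Definition blur_weight (q : seq bool) : R :=
  let: (s, j) := decode q in [&& `[< T s >], j == 0%N & odd (size s)]%:R.

Hypothesis T_tree : tree T.
Hypothesis phi_continuous : real_continuous phi.
Hypothesis phi01 : forall y, unit_open (phi y).

Lemma phi_bounds y : 0 <= phi y <= 1.
Proof. by have /andP[h1 h2] := phi01 y; rewrite !ltW. Qed.

Lemma bool01 (b : bool) : 0 <= (b%:R : R) <= 1.
Proof. by case: b; rewrite ?lexx ler01. Qed.

Lemma sharp_weight01 q : 0 <= sharp_weight q <= 1.
Proof.
rewrite /sharp_weight; case: (decode q) => s j; case: ifP => _; [exact: clamp01|exact: bool01].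
Qed.

Lemma blur_weight01 q : 0 <= blur_weight q <= 1.
Proof. by rewrite /blur_weight; case: (decode q) => s j; exact: bool01. Qed.

Lemma sharp_weight_branch y : branch T y -> tends_along sharp_weight (code y) (phi y).
Proof.
move=> Ty e e0; have e2 : 0 < e / 2 by rewrite divr_gt0.
have [n hn] := phi_continuous y e2; have [n' hn'] := exp2_small e2.
have [M hM] := decode_code_eventually y (maxn n n'); exists M => k /hM[m [j [nm hd]]].
rewrite /sharp_weight hd asboolT; last exact: Ty.
apply: le_lt_trans (clamp_dist _ (phi_bounds y)) _.
have h1 : `|phi (pad (mkseq y m)) - phi y| < e / 2.
  apply: hn => i ni; rewrite /pad nth_mkseq//.
  by apply: leq_trans ni _; apply: leq_trans nm; exact: leq_maxl.
have h2 : `|(-1) ^+ j * 2 ^- size (mkseq y m)| < e / 2.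
  rewrite normrM normrX normrN1 expr1n mul1r size_mkseq ger0_norm ?exp2_ge0//.
  by apply: le_lt_trans (exp2_le _) hn'; apply: leq_trans nm; exact: leq_maxr.
rewrite addrAC; apply: le_lt_trans (ler_normD _ _) _.
by lra.
Qed.

Lemma not_branch_eventually y : ~ branch T y -> exists n, forall m, (n <= m)%N -> ~ T (mkseq y m).
Proof.
move=> /existsNP[n nT]; exists n => m nm /(T_tree n).
by rewrite take_mkseq (minn_idPl nm).
Qed.

Lemma sharp_weight_dead y : ~ branch T y ->
  tends_along sharp_weight (code y) (y 0%N != 0%N)%:R.
Proof.
(* [n.+1] instead of [n]: at least one letter must be decoded for the head to be [y 0]. *)
move=> /not_branch_eventually[n hn]; have [M hM] := decode_code_eventually y n.+1.
apply: (@tends_along_eventually _ _ M) => i.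
have [m [j [nm hd]]] := hM _ (leq_addr i M).
rewrite /sharp_weight hd asboolF; last by apply: hn; exact: ltnW.
by case: m nm {hd}.
Qed.

Lemma sharp_weight_open x K s j : ~ T s ->
  (forall i, decode (mkseq x (K + i)) = (s, j + i)%N) ->
  tends_along sharp_weight x (head 0%N s != 0%N)%:R.
Proof.
move=> nT hd; apply: (@tends_along_eventually _ _ K) => i.
by rewrite /sharp_weight hd asboolF.
Qed.

Lemma sharp_weight_node x K s j : T s ->
  (forall i, decode (mkseq x (K + i)) = (s, j + i)%N) ->
  ~ exists r, tends_along sharp_weight x r.
Proof.
move=> Ts hd [r hr].
have h b : r = clamp (phi (pad s) + (-1) ^+ b * 2 ^- size s).
  (* The number of zeros read is then [j + (M.*2 + (b + j))], of the parity of [b], so both signs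
     recur. *)
  apply: tends_along_const hr _ => M; exists (K + (M.*2 + (b + j)))%N; split.
    by rewrite -addnn; lia.
  rewrite /sharp_weight hd asboolT//; congr (clamp (_ + _ * _)).
  rewrite -[LHS]signr_odd -[RHS]signr_odd; congr (_ ^+ _).
  by rewrite !oddD odd_double /=; case: (odd j); case: (odd b).
have := clamp_neq (phi_bounds (pad s)) (exp2_gt0 (size s)).
by have := h 1%N; have := h 0%N; rewrite expr0 mul1r expr1 mulN1r => <- <-; rewrite ltxx.
Qed.

Lemma blur_weight_branch y : branch T y -> ~ exists r, tends_along blur_weight (code y) r.
Proof.
move=> Ty [r hr].
have h (b : bool) : r = b%:R.
  apply: tends_along_const hr _ => M.
  (* The moment when [M.*2 + b] blocks are closed and the next one is still empty. *)
  exists (size (encode (mkseq y (M.*2 + b), 0%N))); split.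
    by apply: leq_trans (size_encode_mkseq _ _); rewrite -addnn; lia.
  rewrite /blur_weight decode_code asboolT; last exact: Ty.
  by rewrite size_mkseq oddD odd_double /=; case: b.
by have := h true; rewrite (h false) => /eqP; rewrite eq_sym oner_eq0.
Qed.

Lemma blur_weight_dead y : ~ branch T y -> tends_along blur_weight (code y) 0.
Proof.
move=> /not_branch_eventually[n hn]; have [M hM] := decode_code_eventually y n.
apply: (@tends_along_eventually _ _ M) => i.
have [m [j [nm hd]]] := hM _ (leq_addr i M).
by rewrite /blur_weight hd asboolF//; exact: hn.
Qed.

Lemma blur_weight_open x K s j : (forall i, decode (mkseq x (K + i)) = (s, j + i)%N) ->
  tends_along blur_weight x 0.
Proof.
move=> hd; apply: (@tends_along_eventually _ _ K.+1) => i.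
by rewrite /blur_weight addSnnS hd addnS /= andbF.
Qed.

Lemma tends_along_density w x r : (forall p, 0 <= w p <= 1) ->
  density_to (oscset w) (spine x) r <-> tends_along w x r.
Proof.
move=> w01; rewrite (oscset_spine_density w01); last by apply/on_spineP; exists x.
by split=> h e /h[M hM]; exists M => k /hM; rewrite letters_spine.
Qed.

Lemma density_uniq A z r r' : density_to A z r -> density_to A z r' -> r = r'.
Proof. exact: cvg_unique. Qed.

Let sharpset := oscset sharp_weight.
Let blurset := oscset blur_weight.

Lemma sharpset_branch y : branch T y -> density_to sharpset (spine (code y)) (phi y).
Proof. by move/sharp_weight_branch/(tends_along_density _ _ sharp_weight01). Qed.

Lemma sharpset_cases z : [\/ exists2 y, branch T y & z = spine (code y), Blur sharpset z,
  density_to sharpset z 0 | density_to sharpset z 1].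
Proof.
have dead x b : tends_along sharp_weight x (nat_of_bool b)%:R ->
    [\/ exists2 y, branch T y & spine x = spine (code y), Blur sharpset (spine x),
        density_to sharpset (spine x) 0 | density_to sharpset (spine x) 1].
  by move/(tends_along_density _ _ sharp_weight01); case: b; [constructor 4|constructor 3].
case: (EM (on_spine z)) => [/on_spineP[x ->]|/(oscset_off_spine sharp_weight)[]]; last 2 first.
- by constructor 3.
- by constructor 4.
case: (code_dichotomy x) => [[y ->]|[K [s [j hd]]]].
  case: (EM (branch T y)) => [Ty|/sharp_weight_dead/dead//].
  by constructor 1; exists y.
case: (EM (T s)) => [Ts|nTs]; last exact: dead (sharp_weight_open nTs hd).
constructor 2 => -[r /(tends_along_density _ _ sharp_weight01) hr].
by apply: (sharp_weight_node Ts hd); exists r.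
Qed.

Lemma decode_zeros n : decode (mkseq (fun=> false) n) = ([::], n).
Proof. by elim: n => // n IH; rewrite mkseqS decode_rcons IH. Qed.

Lemma sharpset_blur : T [::] -> Blur sharpset !=set0.
Proof.
move=> T0; exists (spine (fun=> false)) => -[r /(tends_along_density _ _ sharp_weight01) hr].
apply: (@sharp_weight_node (fun=> false) 0 [::] 0 T0); last by exists r.
by move=> i; rewrite !add0n decode_zeros.
Qed.

Lemma sharpset_dead a : ~ T [:: a] -> exists z, density_to sharpset z (a != 0%N)%:R.
Proof.
move=> nTa; exists (spine (code (fun=> a))); apply/(tends_along_density _ _ sharp_weight01).
by apply: sharp_weight_dead => /(_ 1%N).
Qed.

Lemma blurset_branch y : branch T y -> Blur blurset (spine (code y)).
Proof.
move=> Ty [r /(tends_along_density _ _ blur_weight01) hr].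
by apply: (blur_weight_branch Ty); exists r.
Qed.

Lemma blurset_cases z : [\/ exists2 y, branch T y & z = spine (code y),
  density_to blurset z 0 | density_to blurset z 1].
Proof.
case: (EM (on_spine z)) => [/on_spineP[x ->]|/(oscset_off_spine blur_weight)[]]; last 2 first.
- by constructor 2.
- by constructor 3.
case: (code_dichotomy x) => [[y ->]|[K [s [j /blur_weight_open hd]]]].
  case: (EM (branch T y)) => [Ty|/blur_weight_dead h]; first by constructor 1; exists y.
  by constructor 2; apply/(tends_along_density _ _ blur_weight01).
by constructor 2; apply/(tends_along_density _ _ blur_weight01).
Qed.

End TreeSet.

(* Reserving the first letters [0] and [1] as dead ends makes the densities [0]
   and [1] attained. *)
Definition forest (T : nat -> seq nat -> Prop) (s : seq nat) : Prop :=
  if s is a :: t then (2 <= a)%N /\ T (a - 2)%N t else True.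

Lemma mkseq_scons a (y : N) n : mkseq (scons a y) n.+1 = a :: mkseq y n.
Proof.
apply: (@eq_from_nth _ 0%N) => [|i]; rewrite size_mkseq /= ?size_mkseq// => ni.
by rewrite nth_mkseq//; case: i ni => //= i ni; rewrite nth_mkseq.
Qed.

Lemma forest_branch T y :
  branch (forest T) y <-> exists i y', y = scons i.+2 y' /\ branch (T i) y'.
Proof.
split=> [h|[i [y' [-> h]]] [|n] //]; last by rewrite mkseq_scons /= subn2.
exists (y 0%N - 2)%N, (stail y); split.
  rewrite -{1}(scons_stail y); have := h 1%N => -[+ _].
  by rewrite /= => y0; congr scons; lia.
by move=> n; have := h n.+1; rewrite -{1}(scons_stail y) mkseq_scons => -[].
Qed.

Lemma forest_tree T : (forall i, tree (T i)) -> tree (forest T).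
Proof.
move=> tT [|a s] [|k] //= [a2 /tT h]; split=> //; exact: h.
Qed.

Definition node i (y : N) : cantor_space := spine (code (scons i.+2 y)).

Lemma node_inj i y i' y' : node i y = node i' y' -> i = i' /\ y = y'.
Proof.
move/spine_inj/code_inj => e; split; first by have := congr1 (fun f => f 0%N) e => -[].
by apply/funext => k; have := congr1 (fun f => f k.+1) e.
Qed.

Lemma compact_oscset w : compact (oscset w).
Proof. by apply/compact_closedK; exact: closed_oscset. Qed.

Definition oscK w : Kspace := exist _ (oscset w) (@compact_oscset w).

Lemma vcont_oscK (Z : topologicalType) (w : Z -> seq bool -> R) :
  (forall p z, nbhs z [set z' | w z' p = w z p]) -> vcont (fun z => oscK (w z)).
Proof.
move=> cw.
have near_eq (s : seq bool) z : nbhs z [set z' | forall p, (size p <= size s)%N -> w z' p = w z p].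
  have h := @nbhs_all_in Z _ (words (size s)) (fun p => [set z' | w z' p = w z p]) z
    (fun p _ => cw p z).
  by apply: filterS h => z' h p /mem_words /h.
apply: vcont_meets => s; rewrite openE => z hz; rewrite /interior /=; apply: filterS (near_eq s z) => z' h.
  by apply: meets_oscset hz => p /h ->.
by move=> /(meets_oscset h).
Qed.

Definition clopen_family (Z : topologicalType) (T : Z -> seq nat -> Prop) :=
  (forall s, clopen [set z | T z s]) /\ (forall z, tree (T z)).

Lemma nbhs_clopen (Z : topologicalType) (U : set Z) z : clopen U -> nbhs z [set z' | U z' <-> U z].
Proof.
move=> [oU cU]; case: (EM (U z)) => Uz.
  by apply: filterS (open_nbhs_nbhs (conj oU Uz)) => z' Uz'.
have oC : open (~` U) by rewrite openC.
by apply: filterS (open_nbhs_nbhs (conj oC Uz)) => z' Uz'; split.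
Qed.

Lemma nbhs_forest (Z : topologicalType) (T : nat -> Z -> seq nat -> Prop) s z :
  (forall i, clopen_family (T i)) ->
  nbhs z [set z' | forest (T^~ z') s = forest (T^~ z) s].
Proof.
move=> cT; case: s => [|a s] /=; first by apply: filterS filterT.
have [cl _] := cT (a - 2)%N; apply: filterS (nbhs_clopen z (cl s)) => z' /= h.
by apply/propext; split=> -[-> /h].
Qed.

Lemma sharp_point (A : set cantor_space) z r : density_to A z r -> Sharp A z <-> unit_open r.
Proof. by move=> h; split=> [[r' [/(density_uniq h) <-]]//|]; exists r. Qed.

Lemma not_unit0 : ~ unit_open (0 : R).
Proof. by rewrite /unit_open /= ltxx. Qed.

Lemma not_unit1 : ~ unit_open (1 : R).
Proof. by rewrite /unit_open /= ltxx andbF. Qed.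

Lemma not_sharp01 (A : set cantor_space) z :
  density_to A z 0 \/ density_to A z 1 -> ~ Sharp A z.
Proof. by move=> [h|h] /(sharp_point h); [exact: not_unit0|exact: not_unit1]. Qed.

(** The first letter, shifted by 2, names the tree and selects the density function, so countably
    many trees live in one compact set. Clopenness of the nodes makes each weight locally constant
    in [z], whence continuity. *)
Lemma sharp_family (Z : topologicalType) (T : nat -> Z -> seq nat -> Prop) (psi : nat -> N -> R) :
  (forall i, clopen_family (T i)) -> (forall i, real_continuous (psi i)) ->
  (forall i y, unit_open (psi i y)) ->
  exists f : Z -> Kspace, vcont f /\ forall z, [/\
    Sharp (proj1_sig (f z)) = [set x | exists i y, branch (T i z) y /\ x = node i y],
    forall i y, branch (T i z) y -> density_to (proj1_sig (f z)) (node i y) (psi i y),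
    ranD (proj1_sig (f z)) = [set r | exists i y, branch (T i z) y /\ r = psi i y] `|` [set 0; 1]
    & Blur (proj1_sig (f z)) !=set0].
Proof.
move=> cT cpsi psi01; pose phi y := psi (y 0 - 2)%N (stail y).
have cphi : real_continuous phi.
  move=> y e /(cpsi (y 0 - 2)%N (stail y))[n hn]; exists n.+1 => y' yy'.
  have -> : phi y' = psi (y 0 - 2)%N (stail y') by rewrite /phi (yy' 0%N).
  by apply: hn => i ni; exact: (yy' i.+1).
have phi01 y : unit_open (phi y) by exact: psi01.
exists (fun z => oscK (sharp_weight (forest (T^~ z)) phi)); split.
  apply: vcont_oscK => q z; rewrite /sharp_weight; case: (decode q) => s j.
  by apply: filterS (nbhs_forest s z cT) => z' /= ->.
move=> z /=; set F := forest _; set A := oscset _.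
have tF : tree F by apply: forest_tree => i; have [_] := cT i.
have dens i y : branch (T i z) y -> density_to A (node i y) (psi i y).
  move=> Ty; have -> : psi i y = phi (scons i.+2 y) by rewrite /phi /= subn2.
  by apply: (@sharpset_branch F phi) => //; apply/forest_branch; exists i, y.
have casesA x : [\/ exists i y, branch (T i z) y /\ x = node i y, Blur A x,
    density_to A x 0 | density_to A x 1].
  have [[y /forest_branch[i [y' [-> Ty]]] ->]|h|h|h] := sharpset_cases tF phi01 x.
  - by constructor 1; exists i, y'.
  - by constructor 2.
  - by constructor 3.
  - by constructor 4.
split=> //; last exact: sharpset_blur.
- apply/seteqP; split=> x /=; last first.
    by move=> [i [y [Ty ->]]]; exists (psi i y); split; [exact: dens|exact: psi01].
  move=> Sx; have [//|Bx|h|h] := casesA x.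
  - by case: Sx => r [hr _]; case: Bx; exists r.
  - by case: (not_sharp01 (or_introl h) Sx).
  - by case: (not_sharp01 (or_intror h) Sx).
apply/seteqP; split=> r /=.
  move=> [x hr]; have [[i [y [Ty e]]]|Bx|h|h] := casesA x.
  - by left; exists i, y; split=> //; rewrite e in hr; exact: density_uniq hr (dens _ _ Ty).
  - by case: Bx; exists r.
  - by right; left; exact: density_uniq hr h.
  - by right; right; exact: density_uniq hr h.
move=> [[i [y [Ty ->]]]|[|] ->]; first by exists (node i y); exact: dens.
  (* The first letters 0 and 1 leave the forest at once, and the head of a dead sequence determines
     its density. *)
  by apply: (@sharpset_dead F phi tF 0) => -[].
by apply: (@sharpset_dead F phi tF 1) => -[].
Qed.

Lemma blur_family (Z : topologicalType) (T : nat -> Z -> seq nat -> Prop) :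
  (forall i, clopen_family (T i)) ->
  exists f : Z -> Kspace, vcont f /\ forall z,
    Blur (proj1_sig (f z)) = [set x | exists i y, branch (T i z) y /\ x = node i y] /\
    Sharp (proj1_sig (f z)) = set0.
Proof.
move=> cT; exists (fun z => oscK (blur_weight (forest (T^~ z)))); split.
  apply: vcont_oscK => q z; rewrite /blur_weight; case: (decode q) => s j.
  by apply: filterS (nbhs_forest s z cT) => z' /= ->.
move=> z /=; set F := forest _; set A := oscset _.
have tF : tree F by apply: forest_tree => i; have [_] := cT i.
have br i y : branch (T i z) y -> Blur A (node i y).
  by move=> Ty; apply: (@blurset_branch F); apply/forest_branch; exists i, y.
have casesA x : [\/ exists i y, branch (T i z) y /\ x = node i y,
    density_to A x 0 | density_to A x 1].
  have [[y /forest_branch[i [y' [-> Ty]]] ->]|h|h] := blurset_cases tF x.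
  - by constructor 1; exists i, y'.
  - by constructor 2.
  - by constructor 3.
split; apply/seteqP; split=> x //=.
- by move=> Bx; have [//|h|h] := casesA x; case: Bx; [exists 0|exists 1].
- by move=> [i [y [Ty ->]]]; exact: br.
- move=> Sx; have [[i [y [Ty e]]]|h|h] := casesA x.
  + by rewrite e in Sx; case: Sx => r [hr _]; apply: (br _ _ Ty); exists r.
  + exact: (not_sharp01 (or_introl h) Sx).
  + exact: (not_sharp01 (or_intror h) Sx).
Qed.

(** * Projective sets of zero-dimensional Polish spaces *)

Section PolishSpace.
Variable Z : topologicalType.
Hypothesis Zpolish : polish Z.
Hypothesis Zdim : zero_dim Z.

(** Each pair of basic balls that some clopen set separates is assigned one such set. Separability
    makes the pairs countable, zero-dimensionality makes them sufficient. *)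
Lemma separating_clopens : exists V : nat -> set Z, (forall i, clopen (V i)) /\
  forall z z', z <> z' -> exists i, V i z /\ ~ V i z'.
Proof.
have [d [d0 [dsym dtri] dop _ [D [/countable_injP[code code_inj] dD]]]] := Zpolish.
have dxx x : d x x = 0 by apply/d0.
have dge0 x y : 0 <= d x y.
  by have := dtri x y x; rewrite dxx (dsym y x); lra.
pose base n m := [set x | exists p, [/\ D p, code p = n & d p x < 2 ^- m]].
have basis (U : set Z) x : open U -> U x -> exists n m, base n m x /\ base n m `<=` U.
  move=> oU Ux; have [e [e0 eU]] := (dop U).1 oU x Ux.
  have [m hm] : exists m, 2 ^- m < e / 2 by apply: exp2_small; rewrite divr_gt0.
  have oball : open [set y | d x y < 2 ^- m].
    apply/dop => y /= xy; exists (2 ^- m - d x y); split; first by rewrite subr_gt0.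
    by move=> y' /= yy'; have := dtri x y y'; lra.
  have [|x0 [Dp xp]] := dD _ oball; first by exists x; rewrite /= dxx exp2_gt0.
  exists (code x0), m; split; first by exists x0; rewrite dsym.
  move=> y [p' [Dp' /code_inj ep' hy]]; rewrite ep' ?inE// in hy.
  by apply: eU => /=; have := dtri x x0 y; move: xp => /=; lra.
pose P (q : (nat * nat) * (nat * nat)) (W : set Z) := [/\ clopen W, base q.1.1 q.1.2 `<=` W &
  base q.2.1 q.2.2 `<=` ~` W].
have /choice[V hV] q : exists W, clopen W /\ ((exists W', P q W') -> P q W).
  case: (EM (exists W', P q W')) => [[W [cW h1 h2]]|nW].
    by exists W; split.
  by exists set0; split=> //; exact: clopen0.
exists (fun i => if unpickle i is Some q then V q else set0); split.
  move=> i; case: (unpickle i) => [q|]; first by have [] := hV q.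
  exact: clopen0.
move=> z z' zz'.
have oz' : open [set x | x <> z'].
  apply/dop => x xz'; exists (d x z'); split.
    by rewrite lt_neqAle dge0 andbT eq_sym; apply/eqP => /d0.
  by move=> y /= + yz'; rewrite yz' ltxx.
have [W [[oW cW] Wz Wz']] := Zdim oz' zz'.
have oCW : open (~` W) by rewrite openC.
have nWz' : (~` W) z' by move=> /Wz'.
have [n1 [m1 [b1 bW1]]] := basis W z oW Wz; have [n2 [m2 [b2 bW2]]] := basis _ z' oCW nWz'.
exists (pickle ((n1, m1), (n2, m2))); rewrite pickleK.
have [_ [|_ h1 h2]] := hV ((n1, m1), (n2, m2)); first by exists W.
by split; [exact: h1|exact: h2].
Qed.

Lemma clopen_imply (V : set Z) (Q : Prop) : clopen V -> clopen [set z | V z -> Q].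
Proof.
move=> cV; case: (EM Q) => q.
  have -> : [set z | V z -> Q] = setT by apply/seteqP; split=> z /=.
  exact: clopenT.
have -> : [set z | V z -> Q] = ~` V by apply/seteqP; split=> z /=; tauto.
by case: cV => oV cV; split; [rewrite openC|rewrite closedC].
Qed.

Lemma clopen_forall (V : nat -> set Z) (Q : nat -> Prop) n : (forall i, clopen (V i)) ->
  clopen [set z | forall i, (i < n)%N -> V i z -> Q i].
Proof.
move=> cV; elim: n => [|n IH].
  have -> : [set z | forall i, (i < 0)%N -> V i z -> Q i] = setT by apply/seteqP; split=> z /=.
  exact: clopenT.
have -> : [set z | forall i, (i < n.+1)%N -> V i z -> Q i] =
    [set z | forall i, (i < n)%N -> V i z -> Q i] `&` [set z | V n z -> Q n].
  apply/seteqP; split=> z /=.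
    by move=> h; split=> [i ni|]; apply: h => //; exact: ltnW.
  by move=> [h hn] i; rewrite ltnS leq_eqVlt => /orP[/eqP -> //|/h].
by apply: clopenI IH _; exact: clopen_imply.
Qed.

(** A node guesses the beginning of a preimage of [z] and is rejected once [g] maps its cylinder off
    one of the first [size s] clopen sets containing [z]. Finitely many clopen sets are consulted,
    so nodes are clopen conditions; continuity of [g] makes every branch a preimage. *)
Lemma SigmaZ_tree (B : set Z) : SigmaZ B ->
  exists T, clopen_family T /\ forall z, B z <-> exists y, branch (T z) y.
Proof.
move=> [->|[g [cg ->]]].
  exists (fun _ _ => False); split; first by split=> [s|z s k []]; exact: clopen0.
  by move=> z; split=> [[]|[y /(_ 0%N)]].
have [V [cV sV]] := separating_clopens.
pose T z s := forall i, (i < size s)%N -> V i z -> exists y, mkseq y (size s) = s /\ V i (g y).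
exists T; split; first split.
- by move=> s; exact: clopen_forall.
- move=> z s k h i; rewrite size_take_min ltn_min => /andP[ik /h] {}h /h[y [ys Vy]].
  by exists y; rewrite -take_mkseq ys.
move=> z; split=> [[y _ <-]|[y Ty]].
  by exists y => n i; rewrite size_mkseq => _ Vi; exists y.
exists y => //; apply: contrapT => ne; have [i [Viz nV]] := sV _ _ (nesym ne).
have oV : open (~` V i) by rewrite openC; case: (cV i).
have [n hn] := (nbhs_seqP _ _).1 (cg y _ (open_nbhs_nbhs (conj oV nV))).
have [|//|y' [+ /=]] := Ty (maxn n i.+1) i; first by rewrite size_mkseq leq_maxr.
rewrite size_mkseq => e Vy'; apply: (hn y') Vy' => j jn.
have := congr1 (nth 0%N ^~ j) e; rewrite !nth_mkseq//; exact: leq_trans jn (leq_maxl _ _).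
Qed.

Lemma PiZ_tree (B : set Z) : PiZ B ->
  exists T, clopen_family T /\ forall z, B z <-> ~ exists y, branch (T z) y.
Proof.
move=> /SigmaZ_tree[T [cT hT]]; exists T; split=> // z; rewrite -hT /=.
by split=> [Bz nBz //|/contrapT].
Qed.

End PolishSpace.

Section Tensor.
Variable T : seq nat -> Prop.

(* Pairing each branch of [T] with an arbitrary sequence makes the set of
   branches empty or uncountable. *)
Definition tensor (s : seq nat) := T (mkseq (fun i => nth 0%N s i.*2) (size s)./2).

Lemma half_mkseq (y : N) n :
  mkseq (fun i => nth 0%N (mkseq y n) i.*2) n./2 = mkseq (sleft y) n./2.
Proof.
apply/eq_in_map => i; rewrite mem_iota add0n => ni.
by rewrite nth_mkseq//; lia.
Qed.

Lemma tensor_branch y : branch tensor y <-> branch T (sleft y).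
Proof.
split=> h n; last by rewrite /tensor size_mkseq half_mkseq.
by have := h n.*2; rewrite /tensor size_mkseq half_mkseq doubleK.
Qed.

Lemma tensor_tree : tree T -> tree tensor.
Proof.
move=> tT s k; rewrite /tensor => /(tT _ (size (take k s))./2).
rewrite take_mkseq size_take_min (minn_idPl _) ?half_leq ?geq_minr//.
congr T; apply/eq_in_map => i; rewrite mem_iota add0n => ni.
by rewrite nth_take//; lia.
Qed.

End Tensor.

Lemma clopen_tensor (Z : topologicalType) (T : Z -> seq nat -> Prop) :
  clopen_family T -> clopen_family (fun z => tensor (T z)).
Proof.
by move=> [cT tT]; split=> [s|z]; [exact: cT|apply: tensor_tree].
Qed.

Definition constant_tree (b : Prop) (s : seq nat) := b /\ all (pred1 0%N) s.

Lemma clopen_constant (Z : topologicalType) (b : Prop) :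
  clopen_family (fun _ : Z => constant_tree b).
Proof.
split=> [s|z s k [hb hs]]; last first.
  by split=> //; apply/allP => a /mem_take; apply: allP.
case: (EM (constant_tree b s)) => h.
  by rewrite (_ : [set _ | _] = setT); [exact: clopenT|apply/seteqP; split=> z /=].
by rewrite (_ : [set _ | _] = set0); [exact: clopen0|apply/seteqP; split=> z /=].
Qed.

Lemma constant_branch b y : branch (constant_tree b) y <-> b /\ y = fun=> 0%N.
Proof.
split=> [h|[hb ->] n].
  split; first by case: (h 0%N).
  apply/funext => i; have [_ /allP hi] := h i.+1.
  by apply/eqP/(hi (y i))/map_f; rewrite mem_iota add0n leqnn.
by split=> //; apply/allP => a /mapP[i _ ->] /=.
Qed.

Lemma real_continuous_cst (c : R) : real_continuous (fun=> c).
Proof. by move=> y e e0; exists 0%N => y' _; rewrite subrr normr0. Qed.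

Lemma real_continuous_head (g : nat -> R) : real_continuous (fun y => g (y 0%N)).
Proof. by move=> y e e0; exists 1%N => y' yy'; rewrite -yy'// subrr normr0. Qed.

Lemma real_continuous_right (f : N -> R) : real_continuous f -> real_continuous (f \o sright).
Proof.
move=> cf y e /(cf (sright y))[n hn]; exists n.*2 => y' yy'; apply: hn => i ni.
by apply: yy'; rewrite ltn_Sdouble.
Qed.

(* The first coordinate is ignored, so that no value is attained only once. *)
Definition onto_itv (a : R) (v : N) : R :=
  a * (2 ^- (v 1%N).+2 + (1 - 2 ^- (v 1%N).+1) * val (fun i => v i.+2)).

Lemma exp2_lt1 n : (2 : R) ^- n.+1 <= 1 / 2.
Proof. by rewrite exprS invfM; have := exp2_le (leq0n n); rewrite expr0 invr1; lra. Qed.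

Lemma onto_itv_continuous a : 0 < a <= 1 -> real_continuous (onto_itv a).
Proof.
move=> /andP[a0 a1] y e e0; have [n hn] : exists n, 2 ^- n < e / 2.
  by apply: exp2_small; rewrite divr_gt0.
exists n.+2 => y' yy'; rewrite /onto_itv (yy' 1%N)//.
have hv : `|val (fun i => y i.+2) - val (fun i => y' i.+2)| < e.
  apply: le_lt_trans (@val_eqn n _ _ _) _; last by lra.
  by move=> i ni; exact: yy'.
have := exp2_lt1 (y' 1%N); have := exp2_gt0 (y' 1%N).+1.
move: (2 ^- (y' 1%N).+2) (2 ^- (y' 1%N).+1) (val _) (val _) hv => c d u' u; rewrite distrC => hv d0 d1.
have -> : a * (c + (1 - d) * u') - a * (c + (1 - d) * u) = a * (1 - d) * (u' - u) by lra.
rewrite normrM; apply: le_lt_trans hv; rewrite ler_piMl//.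
rewrite ger0_norm; [apply: mulr_ile1|apply: mulr_ge0]; lra.
Qed.

Lemma onto_itv_bounds a v : 0 < a -> 0 < onto_itv a v < a.
Proof.
move=> a0; rewrite /onto_itv; have /andP[v0 v1] := val_bounds (fun i => v i.+2).
have := exp2_lt1 (v 1%N); have := exp2S (v 1%N).+1; have := exp2_gt0 (v 1%N).+2.
move: (2 ^- (v 1%N).+2) (2 ^- (v 1%N).+1) (val _) v0 v1 => c d u u0 u1 c0 e d1.
have h1 : 0 <= (1 - d) * u by apply: mulr_ge0; lra.
have h2 : (1 - d) * u <= 1 - d by apply: ler_piMr; lra.
by apply/andP; split; [apply: mulr_gt0|rewrite gtr_pMr]; lra.
Qed.

(** When [v 1 = k] and the remaining coordinates vary, the values fill the closed interval obtained
    from [[0; a]] by removing [a * 2 ^- k.+2] at both ends; these closed intervals exhaust the open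
    one. *)
Lemma onto_itv_surj a r : 0 < r < a -> exists v, onto_itv a v = r.
Proof.
move=> /andP[r0 ra]; have a0 : 0 < a by exact: lt_trans ra.
pose q := r / a; have q0 : 0 < q by rewrite divr_gt0.
have q1 : q < 1 by rewrite /q ltr_pdivrMr// mul1r.
have [k hk] : exists k, 2 ^- k < Num.min q (1 - q).
  by apply: exp2_small; rewrite lt_min q0 subr_gt0.
move: hk; rewrite lt_min => /andP[k1 k2].
have e1 := exp2S k; have e2 := exp2S k.+1; have e3 := exp2_gt0 k.+2; have e4 := exp2_lt1 k.
have d0 : 0 < (1 : R) - 2 ^- k.+1 by lra.
have [|u hu] := @val_surj ((q - 2 ^- k.+2) / (1 - 2 ^- k.+1)).
  by apply/andP; split; [apply: divr_ge0|rewrite ler_pdivrMr]; lra.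
exists (scons 0 (scons k u)); rewrite /onto_itv /= (_ : (fun i => u i) = u)// hu.
rewrite mulrCA divff ?gt_eqF// mulr1 subrKC /q mulrC divfK// gt_eqF//.
Qed.

Lemma lam_unit (a : R) : 0 <= a -> (@lebesgue_measure R) [set r : R | 0 < r < a] = a%:E.
Proof.
move=> a0; have -> : [set r : R | 0 < r < a] = `]0, a[%classic.
  by apply/seteqP; split=> r /=; rewrite in_itv.
rewrite lebesgue_measure_itv /= lte_fin; case: ltgtP a0 => // [_|<-] _; last by [].
by rewrite oppr0 adde0.
Qed.

Lemma uncountable_unit : ~ countable unit_open.
Proof.
move=> /countable_lebesgue_measure0; rewrite (lam_unit ler01) => /eqP.
by rewrite eqe oner_eq0.
Qed.

Lemma nonmeager_unit : ~ meager_R unit_open.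
Proof.
move=> [F [nF cF]].
have hO i : open (~` closure (F i)) /\ dense (~` closure (F i)).
  split; first by rewrite openC; exact: closed_closure.
  move=> O [r Or] oO; apply: contrapT => /set0P/negP/negPn/eqP OF.
  have : (closure (F i))° r.
    apply: filterS (open_nbhs_nbhs (conj oO Or)) => s Os.
    by apply: contrapT => ns; have : (O `&` ~` closure (F i)) s by []; rewrite OF.
  by rewrite nF.
have [||r [/= r01 hr]] := @Baire R R^o (fun i => ~` closure (F i)) hO unit_open.
- by exists (1 / 2); rewrite /unit_open /=; lra.
- exact: open_between.
by have [i _ Fr] := cF r r01; apply: (hr i I); exact: subset_closure.
Qed.

(** * Hardness *)

Lemma countable_image {U V : Type} (f : U -> V) (A : set U) : countable A -> countable (f @` A).
Proof. exact/sub_countable/card_image_le. Qed.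

Lemma countable_sub {U : Type} (A B : set U) : A `<=` B -> countable B -> countable A.
Proof. by move=> AB; exact/sub_countable/subset_card_le. Qed.

Lemma unit_uncountable (A : set R) : unit_open `<=` A -> ~ countable A.
Proof. by move=> UA /(countable_sub UA); exact: uncountable_unit. Qed.

(** The density maps the sharp points onto the unit interval. *)
Lemma uncountable_sharp A : unit_open `<=` ranD A -> ~ countable (Sharp A).
Proof.
move=> UA cS; have /choice[D hD] z : exists r, (exists r', density_to A z r') -> density_to A z r.
  by case: (EM (exists r', density_to A z r')) => [[r hr]|n]; [exists r|exists 0].
apply: (@unit_uncountable (D @` Sharp A)); last exact: countable_image.
move=> r Ur; have [z hz] := UA r Ur; exists z; first by exists r.
exact: density_uniq (hD z (ex_intro _ r hz)) hz.
Qed.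

Lemma ranD_nonsharp A : compact A -> Sharp A = set0 -> ranD A `<=` [set 0; 1].
Proof.
move=> /compact_closedK cA S0 r [z hz]; have /andP[r0 r1] := density_bounds cA hz.
have nr : ~ unit_open r by move=> Ur; have : Sharp A z; [exists r|rewrite S0].
have [->|n0] := eqVneq r 0; first by left.
have [->|n1] := eqVneq r 1; first by right.
by case: nr; rewrite /unit_open /= !lt_neqAle r0 r1 n1 eq_sym n0.
Qed.

Lemma unit_disjoint01 : [set 0; 1] `&` unit_open = set0 :> set R.
Proof. by apply/seteqP; split=> r //= [[->|->]]; [exact: not_unit0|exact: not_unit1]. Qed.

Lemma lam01 : (@lebesgue_measure R) [set 0; 1] = 0%E.
Proof.
by apply/countable_lebesgue_measure0/finite_set_countable; rewrite finite_setU; split; exact: finite_set1.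
Qed.

Lemma meager01 : meager_R [set 0; 1].
Proof.
exists (fun=> [set 0; 1]); split; last by move=> r h; exists 0%N.
move=> _; rewrite /nowhere_dense_R.
have c01 : closed ([set 0; 1] : set R).
  have cl (x : R) : closed [set x].
    by apply: accessible_closed_set1; apply: hausdorff_accessible; exact: Rhausdorff.
  by apply: closedU.
rewrite -(closure_id _).1//; apply/seteqP; split=> // r.
move=> /(ritv_base (@open_interior _ _))[i [/andP[ir ri] sub]].
have h (s : R) : ratr i.1 < s <= r -> s = 0 \/ s = 1.
  move=> /andP[h1 h2]; suff : [set 0; 1] s by [].
  by apply: interior_subset; apply: sub; rewrite /ritv /= h1 (le_lt_trans h2 ri).
(* Three distinct points of the interval would all belong to a set of two elements. *)
have [] : [/\ ratr i.1 < r <= r, ratr i.1 < (r + ratr i.1) / 2 <= r &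
    ratr i.1 < (r + (r + ratr i.1) / 2) / 2 <= r].
  by split; apply/andP; split; lra.
by move=> /h[] e1 /h[] e2 /h[] e3; lra.
Qed.

Section Reductions.
Variable Z : topologicalType.
Hypothesis Zpolish : polish Z.
Hypothesis Zdim : zero_dim Z.

(** The trees of positive index supply one branch for each element of [Q], whatever [z] is; the tree
    of index 0 adds none or uncountably many. *)
Definition counted_trees (Q : set nat) (T : Z -> seq nat -> Prop) i z : seq nat -> Prop :=
  if i is k.+1 then constant_tree (Q k) else tensor (T z).

Lemma counted_trees_clopen Q T : clopen_family T -> forall i, clopen_family (counted_trees Q T i).
Proof. by move=> cT [|k]; [exact: clopen_tensor|exact: clopen_constant]. Qed.

Lemma counted_trees_empty Q T z : ~ (exists y, branch (T z) y) ->
  ([set x | exists i y, branch (counted_trees Q T i z) y /\ x = node i y] #= Q)%card.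
Proof.
move=> nT; rewrite (_ : [set x | _] = (fun k => node k.+1 (fun=> 0%N)) @` Q).
  by apply: inj_card_eq => k k' _ _ /node_inj[[]].
apply/seteqP; split=> x /=.
  move=> [[|k] [y [h ->]]]; last by have [Qk ->] := (constant_branch _ _).1 h; exists k.
  by case: nT; exists (sleft y); apply/tensor_branch.
by move=> [k Qk <-]; exists k.+1, (fun=> 0%N); split=> //; apply/constant_branch.
Qed.

Lemma counted_trees_nonempty Q T z u v : branch (T z) u -> branch (counted_trees Q T 0 z) (sjoin u v).
Proof. by move=> h; apply/tensor_branch; rewrite sleft_join. Qed.

(** The extra branches all get density [1 / 2]. The tree of index 0 reads its density from the free
    half of [tensor], so a single branch of [T z] yields all values of the open interval, each one
    repeatedly. *)
Lemma PiZ_sharp (Q : set nat) (B : set Z) : PiZ B ->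
  exists f : Z -> Kspace, vcont f /\ forall z, [/\ Blur (proj1_sig (f z)) !=set0,
    B z -> (Sharp (proj1_sig (f z)) #= Q)%card &
    ~ B z -> unit_open `<=` ranD (proj1_sig (f z)) /\ ~ Rng_inj (proj1_sig (f z))].
Proof.
move=> /(PiZ_tree Zpolish Zdim)[T [cT hT]].
pose psi i := if i is _.+1 then fun=> 1 / 2 else onto_itv 1 \o sright.
have cpsi i : real_continuous (psi i).
  case: i => [|i]; last exact: real_continuous_cst.
  by apply/real_continuous_right/onto_itv_continuous; rewrite ltr01 lexx.
have psi01 i y : unit_open (psi i y).
  by case: i => [|i]; [exact: onto_itv_bounds|rewrite /unit_open /=; lra].
have [f [cf hf]] := sharp_family (counted_trees_clopen Q cT) cpsi psi01.
exists f; split=> // z; have [eS hd eR Bf] := hf z; split=> //.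
  by move=> /hT nT; rewrite eS; exact: counted_trees_empty.
move=> nB; have [u Tu] : exists y, branch (T z) y by apply: contrapT => /hT.
have dens v : density_to (proj1_sig (f z)) (node 0 (sjoin u v)) (onto_itv 1 v).
  have := hd 0%N (sjoin u v) (counted_trees_nonempty Q v Tu).
  by rewrite /psi /= sright_join.
split=> [r /onto_itv_surj[v <-]|inj]; first by exists (node 0 (sjoin u v)).
have /node_inj[_ /(congr1 sright)] :=
  inj _ _ _ (dens (scons 0 (fun=> 0%N))) (dens (scons 1 (fun=> 0%N))) (onto_itv_bounds _ ltr01).
by rewrite !sright_join => /(congr1 (fun v => v 0%N)).
Qed.

Lemma PiZ_blur (Q : set nat) (B : set Z) : PiZ B ->
  exists f : Z -> Kspace, vcont f /\ forall z, [/\ Sharp (proj1_sig (f z)) = set0,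
    B z -> (Blur (proj1_sig (f z)) #= Q)%card & ~ B z -> ~ countable (Blur (proj1_sig (f z)))].
Proof.
move=> /(PiZ_tree Zpolish Zdim)[T [cT hT]].
have [f [cf hf]] := blur_family (counted_trees_clopen Q cT).
exists f; split=> // z; have [eB eS] := hf z; split=> //.
  by move=> /hT nT; rewrite eB; exact: counted_trees_empty.
move=> nB; have [u Tu] : exists y, branch (T z) y by apply: contrapT => /hT.
pose g v := node 0 (sjoin u v).
have gB : range g `<=` Blur (proj1_sig (f z)).
  move=> _ [v _ <-]; rewrite eB /=; exists 0%N, (sjoin u v); split=> //.
  exact: counted_trees_nonempty.
have ginj : injective g.
  by move=> v v' /node_inj[_ /(congr1 sright)]; rewrite !sright_join.
(* Uncountability is borrowed from the reals: the unit interval would be the image of a countable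
   set under [onto_itv 1]. *)
move=> /(countable_sub gB) cg; apply: (@unit_uncountable (range (onto_itv 1))).
  by move=> r /onto_itv_surj[v <-]; exists v.
apply: countable_image; rewrite -(eq_countable (inj_card_eq (f := g) _))//.
by move=> v v' _ _; exact: ginj.
Qed.

(** A branch of the tree [T2], i.e. failure of the coanalytic condition, floods the range with the
    open interval. Otherwise [T1] decides whether the values of [phi] appear at all. *)
Lemma D2SigmaZ_range (S : set R) (phi : N -> R) (B : set Z) : real_continuous phi ->
  range phi = S -> S `<=` unit_open -> D2SigmaZ B ->
  exists f : Z -> Kspace, vcont f /\ forall z,
    (B z -> ranD (proj1_sig (f z)) = S `|` [set 0; 1]) /\
    (~ B z -> unit_open `<=` ranD (proj1_sig (f z)) \/ ranD (proj1_sig (f z)) = [set 0; 1]).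
Proof.
move=> cphi phiS S01 [B1 [B2 [/(SigmaZ_tree Zpolish Zdim)[T1 [cT1 hT1]] [+ ->]]]].
move=> /(PiZ_tree Zpolish Zdim)[T2 [cT2 hT2]].
pose T i z := match i with
  0 => tensor (T2 z) | 1 => tensor (T1 z) | _ => constant_tree False end.
pose psi i := if i is _.+1 then phi \o sright else onto_itv 1 \o sright.
have cT i : clopen_family (T i).
  by case: i => [|[|i]]; [exact: clopen_tensor|exact: clopen_tensor|exact: clopen_constant].
have cpsi i : real_continuous (psi i).
  case: i => [|i]; apply: real_continuous_right => //.
  by apply: onto_itv_continuous; rewrite ltr01 lexx.
have psi01 i y : unit_open (psi i y).
  by case: i => [|i]; [exact: onto_itv_bounds|apply: S01; rewrite -phiS; exists (sright y)].
have [f [cf hf]] := sharp_family cT cpsi psi01.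
have br0 z : (exists y, branch (T2 z) y) -> unit_open `<=` ranD (proj1_sig (f z)).
  move=> [u Tu] r /onto_itv_surj[v <-]; have [_ _ -> _] := hf z; left.
  exists 0%N, (sjoin u v); rewrite /psi /= sright_join; split=> //.
  by apply/tensor_branch; rewrite sleft_join.
exists f; split=> // z; have [_ _ eR _] := hf z; split=> [[/hT1[u Tu] /hT2 nT]|nB].
  rewrite eR; congr (_ `|` _); rewrite -phiS; apply/seteqP; split=> r /=.
    move=> [[|[|i]] [y [h ->]]]; last by have [[]] := (constant_branch _ _).1 h.
      by case: nT; exists (sleft y); apply/tensor_branch.
    by exists (sright y).
  move=> [v _ <-]; exists 1%N, (sjoin u v); rewrite /psi /= sright_join; split=> //.
  by apply/tensor_branch; rewrite sleft_join.
case: (EM (exists y, branch (T2 z) y)) => [/br0|nT2]; first by left.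
right; rewrite eR (_ : [set r | _] = set0) ?set0U//.
apply/seteqP; split=> r //= -[[|[|i]] [y [h _]]]; last by have [[]] := (constant_branch _ _).1 h.
  by apply: nT2; exists (sleft y); apply/tensor_branch.
apply: nB; split; last exact/hT2.
by apply/hT1; exists (sleft y); apply/tensor_branch.
Qed.

End Reductions.

Lemma hardK_sharp (Q : set nat) (C : set cantor_space -> Prop) :
  (forall A, compact A -> Blur A !=set0 -> (Sharp A #= Q)%card -> C A) ->
  (forall A, unit_open `<=` ranD A -> ~ Rng_inj A -> ~ C A) -> hardK PiZ (KC C).
Proof.
move=> pos neg Z Zp Zd B /(PiZ_sharp Zp Zd Q)[f [cf hf]]; exists f; split=> //.
apply/seteqP; split=> z; have [b p n] := hf z.
  by move=> /p; apply: pos => //; exact: proj2_sig (f z).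
by move=> Cz; apply: contrapT => /n[h1 h2]; exact: neg Cz.
Qed.

Lemma hardK_blur (Q : set nat) (C : set cantor_space -> Prop) :
  (forall A, Sharp A = set0 -> (Blur A #= Q)%card -> C A) ->
  (forall A, ~ countable (Blur A) -> ~ C A) -> hardK PiZ (KC C).
Proof.
move=> pos neg Z Zp Zd B /(PiZ_blur Zp Zd Q)[f [cf hf]]; exists f; split=> //.
apply/seteqP; split=> z; have [s p n] := hf z; first by move=> /p; exact: pos.
by move=> Cz; apply: contrapT => /n h; exact: neg Cz.
Qed.

Lemma hardK_ranD (C : set cantor_space -> Prop) :
  (forall A, compact A -> Blur A !=set0 -> Sharp A = set0 -> ranD A `<=` [set 0; 1] -> C A) ->
  (forall A, unit_open `<=` ranD A -> ~ Rng_inj A -> ~ C A) -> hardK PiZ (KC C).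
Proof.
move=> pos; apply: (@hardK_sharp set0) => A cA bA; rewrite card_eq0 => /eqP S0.
by apply: pos => //; exact: ranD_nonsharp.
Qed.

Lemma hardK_range (S : set R) (phi : N -> R) (C : set cantor_space -> Prop) :
  real_continuous phi -> range phi = S -> S `<=` unit_open ->
  (forall A, ranD A = S `|` [set 0; 1] -> C A) ->
  (forall A, unit_open `<=` ranD A -> ~ C A) ->
  (forall A, ranD A = [set 0; 1] -> ~ C A) -> hardK D2SigmaZ (KC C).
Proof.
move=> cphi phiS S01 pos neg neg0 Z Zp Zd B.
move=> /(D2SigmaZ_range Zp Zd cphi phiS S01)[f [cf hf]]; exists f; split=> //.
apply/seteqP; split=> z; have [p n] := hf z; first by move=> /p; exact: pos.
by move=> Cz; apply: contrapT => /n[/neg|/neg0].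
Qed.

Lemma countable_card_eq {U : Type} (A : set U) (Q : set nat) : (A #= Q)%card -> countable A.
Proof. by rewrite card_eq_le => /andP[AQ _]; exact: sub_countable AQ (countableP _). Qed.

Lemma hard_Shrp_eq n : hardK PiZ (KC (Shrp_eq n)).
Proof.
by apply: (@hardK_sharp `I_n) => // A UA _ /countable_card_eq; exact: uncountable_sharp.
Qed.

Lemma hard_Shrp_le n : hardK PiZ (KC (Shrp_le n)).
Proof.
apply: hardK_ranD => [A _ _ S0 _|A UA _ /(sub_countable)/(_ (countableP _))]; last exact: uncountable_sharp.
by rewrite /Shrp_le S0; exact: card_ge0.
Qed.

Lemma hard_Shrp_fin : hardK PiZ (KC Shrp_fin).
Proof.
apply: hardK_ranD => [A _ _ S0 _|A UA _ /finite_set_countable]; last exact: uncountable_sharp.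
by rewrite /Shrp_fin S0; exact: finite_set0.
Qed.

Lemma hard_Shrp_ctbl : hardK PiZ (KC Shrp_ctbl).
Proof.
apply: hardK_ranD => [A _ _ S0 _|A UA _]; last exact: uncountable_sharp.
by rewrite /Shrp_ctbl S0; exact: countable0.
Qed.

Lemma hard_Shrp_omega : hardK PiZ (KC Shrp_omega).
Proof.
by apply: (@hardK_sharp setT) => // A UA _ /countable_card_eq; exact: uncountable_sharp.
Qed.

Lemma hard_Blr_eq n : hardK PiZ (KC (Blr_eq n)).
Proof. by apply: (@hardK_blur `I_n) => // A nc /countable_card_eq. Qed.

Lemma hard_Blr_le n : hardK PiZ (KC (Blr_le n)).
Proof.
apply: (@hardK_blur set0) => [A _|A nc /(sub_countable)/(_ (countableP _))//].
by rewrite card_eq0 /Blr_le => /eqP ->; exact: card_ge0.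
Qed.

Lemma hard_Blr_fin : hardK PiZ (KC Blr_fin).
Proof.
apply: (@hardK_blur set0) => [A _|A nc /finite_set_countable//].
by rewrite card_eq0 /Blr_fin => /eqP ->; exact: finite_set0.
Qed.

Lemma hard_Blr_ctbl : hardK PiZ (KC Blr_ctbl).
Proof.
apply: (@hardK_blur set0) => // A _.
by rewrite card_eq0 /Blr_ctbl => /eqP ->; exact: countable0.
Qed.

Lemma hard_Blr_omega : hardK PiZ (KC Blr_omega).
Proof. by apply: (@hardK_blur setT) => // A nc /countable_card_eq. Qed.

Lemma range_unit (A : set cantor_space) : unit_open `<=` ranD A ->
  ~ countable (ranD A `&` unit_open).
Proof. by move=> UA; apply: unit_uncountable => r Ur; split=> //; exact: UA. Qed.

Lemma range_empty (A : set cantor_space) : ranD A `<=` [set 0; 1] ->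
  ranD A `&` unit_open = set0.
Proof.
by move=> h; apply/seteqP; split=> // r [/h r01 Ur]; rewrite -unit_disjoint01.
Qed.

Lemma hard_Rng_le n : hardK PiZ (KC (Rng_le n)).
Proof.
apply: hardK_ranD => [A _ _ _ /range_empty R0|A UA _ /(sub_countable)/(_ (countableP _))].
  by rewrite /Rng_le R0; exact: card_ge0.
exact: range_unit.
Qed.

Lemma hard_Rng_fin : hardK PiZ (KC Rng_fin).
Proof.
apply: hardK_ranD => [A _ _ _ /range_empty R0|A UA _ /finite_set_countable].
  by rewrite /Rng_fin R0; exact: finite_set0.
exact: range_unit.
Qed.

Lemma hard_Rng_ctbl : hardK PiZ (KC Rng_ctbl).
Proof.
apply: hardK_ranD => [A _ _ _ /range_empty R0|A UA _]; last exact: range_unit.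
by rewrite /Rng_ctbl R0; exact: countable0.
Qed.

Lemma hard_Rng_inj : hardK PiZ (KC Rng_inj).
Proof.
apply: hardK_ranD => // A _ _ S0 _ z1 z2 r h1 _ Ur.
by have : Sharp A z1; [exists r|rewrite S0].
Qed.

Lemma hard_Rng_MGR : hardK PiZ (KC Rng_MGR).
Proof.
apply: hardK_ranD => [A _ _ _ h|A UA _ /(sub_meager UA)]; last exact: nonmeager_unit.
exact: sub_meager h meager01.
Qed.

Lemma lamD_unit (A : set cantor_space) : unit_open `<=` ranD A -> (1%:E <= lamD A)%E.
Proof. by move=> /le_lam; rewrite (lam_unit ler01). Qed.

Lemma lamD_01 (A : set cantor_space) : ranD A `<=` [set 0; 1] -> (lamD A <= 0)%E.
Proof. by move=> /le_lam; rewrite lam01. Qed.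

Lemma hard_Rng_lam_le (a : R) : 0 <= a < 1 -> hardK PiZ (KC (Rng_lam_le a)).
Proof.
move=> /andP[a0 a1]; apply: hardK_ranD => [A _ _ _ /lamD_01 h|A /lamD_unit h _].
  by apply: le_trans h _; rewrite lee_fin.
by move=> /(le_trans h); rewrite lee_fin leNgt a1.
Qed.

Lemma hard_Rng_lam_lt (a : R) : 0 < a <= 1 -> hardK PiZ (KC (Rng_lam_lt a)).
Proof.
move=> /andP[a0 a1]; apply: hardK_ranD => [A _ _ _ /lamD_01 h|A /lamD_unit h _].
  by apply: le_lt_trans h _; rewrite lte_fin.
by move=> /(le_lt_trans h); rewrite lte_fin ltNge a1.
Qed.

Lemma hard_Sld : hardK PiZ (KC Sld).
Proof.
apply: (@hardK_blur set0) => [A _|A nc B0]; first by rewrite card_eq0 => /eqP.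
by apply: nc; rewrite B0; exact: countable0.
Qed.

Lemma hard_qDl : hardK PiZ (KC qDl).
Proof.
apply: hardK_ranD => // A UA _ S0; apply: (uncountable_sharp UA).
by rewrite S0; exact: countable0.
Qed.

Lemma hard_Dl : hardK PiZ (KC Dl).
Proof.
apply: (@hardK_blur set0) => [A S0|A nc [B0 _]]; first by rewrite card_eq0 => /eqP.
by apply: nc; rewrite B0; exact: countable0.
Qed.

(** The sets built from [sharp_weight] always have blurry points, so being spongy reduces to having
    no sharp point. *)
Lemma hard_Spng_Pi : hardK PiZ (KC Spng).
Proof.
apply: hardK_ranD => [A _ B0 S0 _|A UA _ [S0 _]].
  by split=> // B0'; move: B0; rewrite B0' => -[].
by apply: (uncountable_sharp UA); rewrite S0; exact: countable0.
Qed.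

(** The sets built from [blur_weight] have no sharp points, so being spongy reduces to having a
    blurry one; the coanalytic reduction is applied to the complement of [B]. *)
Lemma hard_Spng_Sigma : hardK SigmaZ (KC Spng).
Proof.
move=> Z Zp Zd B SB; have PB : PiZ (~` B) by rewrite /PiZ /Pi11 setCK.
have [f [cf hf]] := PiZ_blur Zp Zd set0 PB; exists f; split=> //.
apply/seteqP; split=> z; have [s p n] := hf z.
  move=> Bz; split=> // B0; apply: n => //; rewrite B0; exact: countable0.
by move=> [_ nB]; apply: contrapT => /p; rewrite card_eq0 => /eqP.
Qed.

Lemma countable_enum (S : set R) : S !=set0 -> countable S -> exists g : nat -> R, range g = S.
Proof.
move=> [r0 Sr0] /countable_injP[e einj].
have /choice[g hg] n : exists r, S r /\ forall r', S r' -> e r' = n -> r = r'.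
  case: (EM (exists r, S r /\ e r = n)) => [[r [Sr er]]|h].
    by exists r; split=> // r' Sr' er'; apply: einj; rewrite ?inE// er er'.
  by exists r0; split=> // r' Sr' er'; case: h; exists r'.
exists g; apply/seteqP; split=> [_ [n _ <-]|r Sr]; first by have [] := hg n.
by exists (e r) => //; have [_] := hg (e r); apply.
Qed.

Lemma hardK_countable_range (S : set R) (C : set cantor_space -> Prop) :
  S !=set0 -> S `<=` unit_open -> countable S ->
  (forall A, ranD A = S `|` [set 0; 1] -> C A) ->
  (forall A, unit_open `<=` ranD A -> ~ C A) ->
  (forall A, ranD A = [set 0; 1] -> ~ C A) -> hardK D2SigmaZ (KC C).
Proof.
move=> S0 S01 /(countable_enum S0)[g gS]; apply: (hardK_range (real_continuous_head g)) => //.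
rewrite -gS; apply/seteqP; split=> [_ [v _ <-]|_ [n _ <-]]; first by exists (v 0%N).
by exists (fun=> n).
Qed.

Lemma range_open (A : set cantor_space) (S : set R) : S `<=` unit_open ->
  ranD A = S `|` [set 0; 1] -> ranD A `&` unit_open = S.
Proof.
by move=> S01 ->; rewrite setIUl unit_disjoint01 setU0; exact/setIidl.
Qed.

(** A copy of [Q] in the open unit interval; the shift by 2 keeps the values below 1. *)
Definition fractions (Q : set nat) : set R := (fun k => (k.+2%:R)^-1) @` Q.

Lemma fractions_card Q : (fractions Q #= Q)%card.
Proof.
by apply: inj_card_eq => k k' _ _ /invr_inj/eqP; rewrite eqr_nat => /eqP[].
Qed.

Lemma fractions_unit Q : fractions Q `<=` unit_open.
Proof.
by move=> _ [k _ <-]; rewrite /unit_open /= invr_gt0 ltr0n /= invf_lt1 ?ltr1n ?ltr0n.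
Qed.

Lemma hard_Rng_card (Q : set nat) : Q !=set0 ->
  hardK D2SigmaZ (KC (fun A => (ranD A `&` unit_open #= Q)%card)).
Proof.
move=> [q Qq]; apply: (@hardK_countable_range (fractions Q)).
- by exists (q.+2%:R^-1), q.
- exact: fractions_unit.
- exact: countable_card_eq (fractions_card Q).
- by move=> A /(range_open (@fractions_unit Q)) ->; exact: fractions_card.
- by move=> A /range_unit + /countable_card_eq.
- move=> A h; rewrite range_empty ?h// card_eq_sym card_eq0 => /eqP Q0.
  by rewrite Q0 in Qq.
Qed.

(** The prescribed values fill the interval between 0 and [a]; in the other two cases the measure is
    at least 1 or equal to 0. *)
Lemma hard_Rng_lam_eq (a : R) : 0 < a < 1 -> hardK D2SigmaZ (KC (Rng_lam_eq a)).
Proof.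
move=> /andP[a0 a1]; have a01 : 0 < a <= 1 by rewrite a0 ltW.
apply: (@hardK_range [set r : R | 0 < r < a] _ _ (onto_itv_continuous a01)).
- apply/seteqP; split=> [_ [v _ <-]|r /onto_itv_surj[v <-]]; last by exists v.
  exact: onto_itv_bounds.
- by move=> r /andP[r0 ra]; rewrite /unit_open /= r0 (lt_trans ra).
- move=> A hA; rewrite /Rng_lam_eq /lamD hA measureU0; first exact: lam_unit (ltW a0).
  + rewrite (_ : [set r | _] = `]0, a[%classic); first exact: measurable_itv.
    by apply/seteqP; split=> r /=; rewrite in_itv.
  + by apply: measurableU.
  + exact: lam01.
- by move=> A /lamD_unit + h; rewrite h lee_fin leNgt a1.
- move=> A hA; have /lamD_01 : ranD A `<=` [set 0; 1] by rewrite hA.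
  by move=> + h; rewrite h lee_fin leNgt a0.
Qed.

Lemma hard_Rng_S (S : set R) : S !=set0 -> S `<=` unit_open -> countable S ->
  hardK D2SigmaZ (KC (Rng_S S)).
Proof.
move=> S0 S01 cS; apply: (@hardK_countable_range S) => // A.
  by move=> /range_unit + /(range_open S01) e; rewrite e.
move=> h /(range_open S01); rewrite range_empty ?h// => e.
by case: S0 => r; rewrite -e.
Qed.

Theorem theorem6p1 :
  (* (a) Pi^1_1-complete *)
  ((forall n : nat,
      [/\ Pi11_completeK (KC (Shrp_eq n)), Pi11_completeK (KC (Shrp_le n)),
          Pi11_completeK (KC (Blr_eq n)), Pi11_completeK (KC (Blr_le n))
        & Pi11_completeK (KC (Rng_le n))]) /\
   [/\ Pi11_completeK (KC Shrp_fin), Pi11_completeK (KC Shrp_ctbl),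
       Pi11_completeK (KC Shrp_omega), Pi11_completeK (KC Blr_fin)
     & Pi11_completeK (KC Blr_ctbl)] /\
   [/\ Pi11_completeK (KC Blr_omega), Pi11_completeK (KC Rng_fin),
       Pi11_completeK (KC Rng_ctbl), Pi11_completeK (KC Rng_inj)
     & Pi11_completeK (KC Rng_MGR)] /\
   (forall a : R, 0 <= a < 1 -> Pi11_completeK (KC (Rng_lam_le a))) /\
   (forall a : R, 0 < a <= 1 -> Pi11_completeK (KC (Rng_lam_lt a))) /\
   [/\ Pi11_completeK (KC Sld), Pi11_completeK (KC qDl) & Pi11_completeK (KC Dl)])
  /\
  (* (b) 2-Sigma^1_1-complete *)
  ((forall n : nat, D2Sigma11_completeK (KC (Rng_eq n.+1))) /\
   D2Sigma11_completeK (KC Rng_omega) /\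
   (forall a : R, 0 < a < 1 -> D2Sigma11_completeK (KC (Rng_lam_eq a))) /\
   (forall S : set R, S !=set0 -> S `<=` unit_open -> countable S ->
      D2Sigma11_completeK (KC (Rng_S S))))
  /\
  (* (c) Spng *)
  (D2SigmaK (KC Spng) /\ hardK SigmaZ (KC Spng) /\ hardK PiZ (KC Spng)).
Proof.
split; [split; [|split; [|split; [|split; [|split]]]]|
  split; [split; [|split; [|split]]|split; [|split]]].
- move=> n; split; split.
  + by apply: (PiK_point_eq (C := Sharp)) => *; exact: Bor_sharp.
  + exact: hard_Shrp_eq.
  + by apply: (PiK_point_le (C := Sharp)) => *; exact: Bor_sharp.
  + exact: hard_Shrp_le.
  + by apply: (PiK_point_eq (C := Blur)) => *; exact: Bor_blur.
  + exact: hard_Blr_eq.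
  + by apply: (PiK_point_le (C := Blur)) => *; exact: Bor_blur.
  + exact: hard_Blr_le.
  + exact: PiK_Rng_le.
  + exact: hard_Rng_le.
- split; split.
  + by apply: (PiK_point_finite (C := Sharp)) => *; exact: Bor_sharp.
  + exact: hard_Shrp_fin.
  + by apply: (PiK_point_countable (C := Sharp)) => *; exact: Bor_sharp.
  + exact: hard_Shrp_ctbl.
  + by apply: (PiK_point_nat (C := Sharp)) => *; exact: Bor_sharp.
  + exact: hard_Shrp_omega.
  + by apply: (PiK_point_finite (C := Blur)) => *; exact: Bor_blur.
  + exact: hard_Blr_fin.
  + by apply: (PiK_point_countable (C := Blur)) => *; exact: Bor_blur.
  + exact: hard_Blr_ctbl.
- split; split.
  + by apply: (PiK_point_nat (C := Blur)) => *; exact: Bor_blur.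
  + exact: hard_Blr_omega.
  + exact: PiK_Rng_fin.
  + exact: hard_Rng_fin.
  + exact: PiK_Rng_ctbl.
  + exact: hard_Rng_ctbl.
  + exact: PiK_Rng_inj.
  + exact: hard_Rng_inj.
  + exact: PiK_Rng_MGR.
  + exact: hard_Rng_MGR.
- by move=> a ha; split; [exact: PiK_Rng_lam_le|exact: hard_Rng_lam_le].
- by move=> a ha; split; [exact: PiK_Rng_lam_lt|exact: hard_Rng_lam_lt].
- split; split; [exact: PiK_Sld|exact: hard_Sld|exact: PiK_qDl|exact: hard_qDl|exact: PiK_Dl|].
  exact: hard_Dl.
- move=> n; split; first exact: D2SigmaK_Rng_eq.
  by apply: hard_Rng_card; exists 0%N.
- split; first exact: D2SigmaK_Rng_omega.
  by apply: hard_Rng_card; exists 0%N.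
- by move=> a ha; split; [exact: D2SigmaK_Rng_lam_eq|exact: hard_Rng_lam_eq].
- by move=> S S0 S01 cS; split; [exact: D2SigmaK_Rng_S|exact: hard_Rng_S].
- exact: D2SigmaK_Spng.
- exact: hard_Spng_Sigma.
- exact: hard_Spng_Pi.
Qed.
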